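(* Let $h\in\mathbb{C}$. The solutions $c^h_{\mathfrak{I}_N}(\rho,x)$ and $s_{\mathfrak{I}_N}(\rho,x)$ of $\mathbf{L}_{q,\mathfrak{I}_N}u=\rho^2u$ with $c^h_{\mathfrak{I}_N}(\rho,0)=1$, $(c^h_{\mathfrak{I}_N})'(\rho,0)=h$, $s_{\mathfrak{I}_N}(\rho,0)=0$, $s_{\mathfrak{I}_N}'(\rho,0)=1$ admit the Neumann series of Bessel functions representations $$c^h_{\mathfrak{I}_N}(\rho,x)=\cos(\rho x)+\sum_{n=0}^\infty(-1)^ng_n(x)j_{2n}(\rho x),\qquad s_{\mathfrak{I}_N}(\rho,x)=\frac{\sin(\rho x)}{\rho}+\frac1\rho\sum_{n=0}^\infty(-1)^ns_n(x)j_{2n+1}(\rho x).$$ The series converge pointwise with respect to $x$ in $(0,b]$ and uniformly with respect to $\rho$ on any compact subset of the complex $\rho$-plane. Moreover, for $M\in\mathbb{N}$ the functions $$c^h_{\mathfrak{I}_N,M}(\rho,x)=\cos(\rho x)+\sum_{n=0}^M(-1)^ng_n(x)j_{2n}(\rho x),\qquad s_{\mathfrak{I}_N,M}(\rho,x)=\frac{\sin(\rho x)}{\rho}+\frac1\rho\sum_{n=0}^M(-1)^ns_n(x)j_{2n+1}(\rho x)$$ obey the estimates $$|c^h_{\mathfrak{I}_N}(\rho,x)-c^h_{\mathfrak{I}_N,M}(\rho,x)|\le2\epsilon_{2M}(x)\sqrt{\frac{\sinh(2bC)}{C}},\qquad|\rho s_{\mathfrak{I}_N}(\rho,x)-\rho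 s_{\mathfrak{I}_N,M}(\rho,x)|\le2\epsilon_{2M+1}(x)\sqrt{\frac{\sinh(2bC)}{C}}$$ for any $\rho\in\mathbb{C}$ belonging to the strip $|\operatorname{Im}\rho|\le C$, $C>0$, where $\epsilon_M(x)=\left\|K^h_{\mathfrak{I}_N}(x,\cdot)-K^h_{\mathfrak{I}_N,M}(x,\cdot)\right\|_{L_2(-x,x)}$.
   Context: Let $b>0$, let $q\in L_2(0,b)$ be complex valued, $N\in\mathbb{N}$, $0<x_1<\dots<x_N<b$, $\alpha_1,\dots,\alpha_N\in\mathbb{C}\setminus\{0\}$, $x_0=0$, $x_{N+1}=b$, $\mathfrak{I}_N=\{(x_j,\alpha_j)\}_{j=1}^N$. $\mathcal{D}_2(\mathbf{L}_{q,\mathfrak{I}_N})$ is the set of $u\in AC[0,b]$ such that $u|_{(x_k,x_{k+1})}\in H^2(x_k,x_{k+1})$ for $k=0,\dots,N$ and $u'(x_k+)-u'(x_k-)=\alpha_ku(x_k)$ for $k=1,\dots,N$. A solution of $\mathbf{L}_{q,\mathfrak{I}_N}u=\lambda u$ (formally $-u''+(q+\sum_{k=1}^N\alpha_k\delta(x-x_k))u=\lambda u$) is a function $u\in\mathcal{D}_2(\mathbf{L}_{q,\mathfrak{I}_N})$ satisfying $-u''+qu=\lambda u$ a.e. on each $(x_k,x_{k+1})$. $K^h_{\mathfrak{I}_N}(x,t)$, $0<x\le b$, $|t|\le x$, is the transmutation kernel: the ($\rho$-independent) kernel with $K^h_{\mathfrak{I}_N}(x,\cdot)\in L_2(-x,x)$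 such that $e^h_{\mathfrak{I}_N}(\rho,x)=e^{i\rho x}+\int_{-x}^xK^h_{\mathfrak{I}_N}(x,t)e^{i\rho t}dt$ for all $\rho\in\mathbb{C}$, where $e^h_{\mathfrak{I}_N}(\rho,\cdot)$ is the solution of $\mathbf{L}_{q,\mathfrak{I}_N}u=\rho^2u$ with $e^h_{\mathfrak{I}_N}(\rho,0)=1$, $(e^h_{\mathfrak{I}_N})'(\rho,0)=i\rho+h$. Such a kernel exists. With $P_n$ the Legendre polynomials, $a_n(x)=\left(n+\frac12\right)\int_{-x}^xK^h_{\mathfrak{I}_N}(x,t)P_n\left(\frac tx\right)dt$, so that $K^h_{\mathfrak{I}_N}(x,t)=\sum_{n=0}^\infty\frac{a_n(x)}{x}P_n\left(\frac tx\right)$ in $L_2(-x,x)$; $K^h_{\mathfrak{I}_N,M}(x,t)=\sum_{n=0}^M\frac{a_n(x)}{x}P_n\left(\frac tx\right)$; $g_n(x)=2a_{2n}(x)$ and $s_n(x)=2a_{2n+1}(x)$. $j_\nu(z)=\sqrt{\frac{\pi}{2z}}J_{\nu+\frac12}(z)$ is the spherical Bessel function ($J_\nu$ the Bessel function of order $\nu$). Expressions with $\frac1\rho$ are understood by continuity at $\rho=0$. *)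

(* Defs.v *)
(* Complex numbers are R[i], with the norm topology carried by R[i]^o. *)
From HB Require Import structures.
From mathcomp Require Import all_boot all_order all_algebra.
From mathcomp Require Import complex.
From mathcomp Require Import all_classical all_reals all_analysis.
Set Implicit Arguments.
Unset Strict Implicit.
Unset Printing Implicit Defensive.
Import Order.TTheory GRing.Theory Num.Theory.
Import numFieldNormedType.Exports.
Local Open Scope classical_set_scope.
Local Open Scope ring_scope.
Local Open Scope complex_scope.

Local Notation Re := complex.Re.
Local Notation Im := complex.Im.

Section ComplexFunctions.
Context {R : realType}.
Local Notation C := (R[i]).
Implicit Types (z w : C) (n : nat).

Definition cmod z : R := ComplexField.Normc.normc z.

Definition expC z : C := (expR (Re z))%:C * (cos (Im z) +i* sin (Im z)).
Definition cosC z : C := (expC ('i%C * z) + expC (- ('i%C * z))) / 2%:R.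
Definition sinC z : C := (expC ('i%C * z) - expC (- ('i%C * z))) / (2%:R * 'i%C).

Definition sinhR (y : R) : R := (expR y - expR (- y)) / 2%:R.

(* Principal argument, with values in ]-pi, pi]. *)
Definition argC z : R :=
  if z == 0 then 0
  else if 0 <= Im z then acos (Re z / cmod z) else - acos (Re z / cmod z).

(* Principal branch of z ^ s, real exponent s; only used for z != 0. *)
Definition powC z (s : R) : C := expC (s%:C * (ln (cmod z) +i* argC z)).

(* Value at z of f with its singularity at 0 removed by continuity. *)
Definition cont0 (f : C -> C) z : C :=
  if z == 0 then lim ((f : C^o -> C^o) w @[w --> (0 : C^o)^']) else f z.

(* Euler's integral; only used for s > 0. *)
Definition GammaR (s : R) : R :=
  (\int[lebesgue_measure]_(t in `]0, +oo[) (t `^ (s - 1) * expR (- t)))%R.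

Definition besselJ_term (nu : R) z (m : nat) : C :=
  ((-1) ^+ m / (m`!%:R * GammaR (m%:R + nu + 1)))%:C
    * powC (z / 2%:R) (2%:R * m%:R + nu).

Definition besselJ (nu : R) z : C :=
  limn (series (besselJ_term nu z : nat -> C^o)).

(* sqrt (pi / (2 z)) is written sqrt (pi / 2) * z ^ (-1/2): the branches of
   z ^ (-1/2) and of J_(n + 1/2) then match, and j_n is the usual entire function
   also on the negative real axis, where the principal value of sqrt (pi / (2 z))
   would give the opposite sign. *)
Definition sphbesselj n : C -> C := cont0 (fun z =>
  (Num.sqrt (pi / 2%:R))%:C * powC z (- 2^-1) * besselJ (n%:R + 2^-1) z).

(* Rodrigues' formula. *)
Definition legendre n : {poly R} :=
  (2%:R ^+ n * n`!%:R)^-1 *: (('X^2 - 1) ^+ n)^`(n).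

End ComplexFunctions.

(* Complex functions of a real variable. *)
Section RealVariable.
Context {R : realType}.
Local Notation C := (R[i]).
Local Notation mu := (@lebesgue_measure R).
Implicit Types (a b t : R) (u v w : R -> C).

Definition cint a b (f : R -> C) : C :=
  (\int[mu]_(t in `]a, b[) Re (f t))%R +i* (\int[mu]_(t in `]a, b[) Im (f t))%R.

Definition L2 a b (f : R -> C) : Prop :=
  [/\ measurable_fun `]a, b[ (fun t => Re (f t)),
      measurable_fun `]a, b[ (fun t => Im (f t)) &
      mu.-integrable `]a, b[ (fun t => ((cmod (f t)) ^+ 2)%:E)].

Definition normL2 a b (f : R -> C) : R :=
  Num.sqrt (\int[mu]_(t in `]a, b[) ((cmod (f t)) ^+ 2))%R.

Definition is_cderive u t (d : C) : Prop :=
  is_derive t (1 : R) (fun r => Re (u r)) (Re d) /\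
  is_derive t (1 : R) (fun r => Im (u r)) (Im d).

Definition cderive u t : C :=
  derive1 (fun r => Re (u r)) t +i* derive1 (fun r => Im (u r)) t.

Definition abs_continuous a b u : Prop :=
  forall eps : R, 0 < eps -> exists2 delta : R, 0 < delta &
  forall (n : nat) (l r : 'I_n -> R),
    (forall i, [/\ a <= l i, l i <= r i & r i <= b]) ->
    trivIset setT (fun i => [set` `]l i, r i[]) ->
    \sum_i (r i - l i) < delta ->
    \sum_i cmod (u (r i) - u (l i)) < eps.

(* H^2(a,b), for a continuous u: u is C^1 on (a,b), u' is (the restriction of)
   an absolutely continuous function on [a,b], and u'' is square integrable.
   The values of u outside (a,b) are irrelevant. *)
Definition H2 a b u : Prop :=
  exists v w, [/\ forall t, t \in `]a, b[ -> is_cderive u t (v t),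
    abs_continuous a b v, L2 a b w &
    {ae mu, forall t, t \in `]a, b[ -> is_cderive v t (w t)}].

(* u'(t+) and u'(t-) *)
Definition deriv_right u t : C :=
  lim ((cderive u : R -> C^o) r @[r --> t^'+]).
Definition deriv_left u t : C :=
  lim ((cderive u : R -> C^o) r @[r --> t^'-]).

End RealVariable.

(* x_ 0 = 0 < x_ 1 < ... < x_ N < x_ N.+1 = b are the nodes; only the values
   alpha k with 1 <= k <= N matter. *)
Section Operator.
Context {R : realType}.
Local Notation C := (R[i]).
Local Notation mu := (@lebesgue_measure R).
Variables (b : R) (q : R -> C) (N : nat) (x_ : nat -> R) (alpha : nat -> C).

Definition domain2 (u : R -> C) : Prop :=
  [/\ abs_continuous 0 b u,
      forall k, (k <= N)%N -> H2 (x_ k) (x_ k.+1) u &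
      forall k, (1 <= k <= N)%N ->
        deriv_right u (x_ k) - deriv_left u (x_ k) = alpha k * u (x_ k)].

Definition solution (lambda : C) (u : R -> C) : Prop :=
  domain2 u /\
  forall k, (k <= N)%N ->
    {ae mu, forall t, t \in `]x_ k, x_ k.+1[ ->
       - cderive (cderive u) t + q t * u t = lambda * u t}.

(* u is C^1 up to the endpoint 0, so that u'(0) = u'(0+). *)
Definition cauchy_solution (lambda u0 u1 : C) (u : R -> C) : Prop :=
  [/\ solution lambda u, u 0 = u0 & deriv_right u 0 = u1].

End Operator.

Section NeumannSeries.
Context {R : realType}.
Local Notation C := (R[i]).

(* e rho is the solution e^h(rho, .) *)
Definition transmutation_kernel (b : R) (e : C -> R -> C) (K : R -> R -> C) :=
  forall x, 0 < x -> x <= b ->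
    L2 (- x) x (K x) /\
    forall rho, e rho x = expC ('i%C * rho * x%:C)
      + cint (- x) x (fun t => K x t * expC ('i%C * rho * t%:C)).

Variable K : R -> R -> C.

Definition coef_a (n : nat) (x : R) : C :=
  (n%:R + 2^-1)%:C * cint (- x) x (fun t => K x t * ((legendre n).[t / x])%:C).

Definition kernel_trunc (M : nat) (x t : R) : C :=
  \sum_(n < M.+1) coef_a n x / x%:C * ((legendre n).[t / x])%:C.

Definition coef_g n x : C := 2%:R * coef_a n.*2 x.
Definition coef_s n x : C := 2%:R * coef_a n.*2.+1 x.

Definition eps_trunc (M : nat) (x : R) : R :=
  normL2 (- x) x (fun t => K x t - kernel_trunc M x t).

Definition c_term (rho : C) (x : R) (n : nat) : C :=
  (-1) ^+ n * coef_g n x * sphbesselj n.*2 (rho * x%:C).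
Definition s_term (rho : C) (x : R) (n : nat) : C :=
  (-1) ^+ n * coef_s n x * sphbesselj n.*2.+1 (rho * x%:C).

Definition c_trunc (M : nat) (rho : C) (x : R) : C :=
  cosC (rho * x%:C) + \sum_(n < M.+1) c_term rho x n.
Definition s_trunc (M : nat) (rho : C) (x : R) : C :=
  cont0 (fun r => sinC (r * x%:C) / r
                  + r^-1 * \sum_(n < M.+1) s_term r x n) rho.

Definition c_series (rho : C) (x : R) : C :=
  cosC (rho * x%:C) + limn (series (c_term rho x : nat -> C^o)).
Definition s_series (rho : C) (x : R) : C :=
  cont0 (fun r => sinC (r * x%:C) / r
                  + r^-1 * limn (series (s_term r x : nat -> C^o))) rho.

End NeumannSeries.

(* Main.v *)
Require Import Defs.
From HB Require Import structures.
From mathcomp Require Import all_boot all_order all_algebra.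
From mathcomp Require Import complex.
From mathcomp Require Import all_classical all_reals all_analysis.
From mathcomp Require Import measurable_realfun ring lra.
Set Implicit Arguments.
Unset Strict Implicit.
Unset Printing Implicit Defensive.
Import Order.TTheory GRing.Theory Num.Theory.
Import numFieldNormedType.Exports.
Local Open Scope classical_set_scope.
Local Open Scope ring_scope.
Local Open Scope complex_scope.

(** The equation depends on [rho] only through [rho ^+ 2], so [e rho] and
    [e (- rho)] solve the same equation as [c rho] and [s rho]; comparing the
    initial values, [e (+- rho) = c rho +- 'i * rho * s rho].  Hence [c rho x]
    and [rho * s rho x] are [cos (rho x)] and [sin (rho x)] plus the even part
    in [rho] of the Fourier integral of the kernel and its odd part divided by
    ['i].  The uniqueness used here comes from the Wronskian of two solutions:
    its almost everywhere derivative is [(lambda - lambda') * u * u'], the jump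
    conditions glue it continuously at the nodes, and an absolutely continuous
    function grows at most at the rate given by its almost everywhere derivative
    ([ac_le_slope], [wronskian_growth], [cauchy_solution_expand],
    [exponential_solution]).

    The Bessel functions enter through Poisson's integral
    [2 * 'i ^ n * j_n z = \int_(-1)^1 P_n t * exp ('i * z * t) dt]
    ([sphbesseljE]).  Both sides are power series: the moments of [P_n] follow
    from Rodrigues' formula by partial integrations, and the values of Gamma at
    the half-integers from the Gauss integral, so the coefficients can be
    compared.  Consequently the truncated Neumann series is, up to the
    trigonometric term, the Fourier integral of the truncated Legendre expansion
    of [K x], and the error is given in the same way by the Fourier
    integral [rem_exp] of the remainder [K x - kernel_trunc K M x]
    ([c_remainder], [s_remainder]).

    The remainder is orthogonal to the polynomials of degree at most [M], so the
    Taylor polynomial of the exponential can be subtracted under the integral,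
    and its norm is at most the norm of [K x] by Bessel's inequality.  By
    Cauchy-Schwarz the error is therefore at most a constant times
    [r ^+ M.+1 / M.+1`! * exp r] with [r = cmod rho * x] ([rem_exp_le]).  This
    gives the convergence, locally uniformly in [rho], without the completeness
    of the Legendre polynomials.  The estimates in the strip are Cauchy-Schwarz
    again, now with the trigonometric function itself, whose squared modulus is
    at most [cosh (2 L t)] ([strip_le]).

    At [rho = 0] the expressions with [rho^-1] are limits; what has to be known
    is that [s rho x] is continuous there ([s_cvg0]), which is the perturbation
    estimate [cauchy_solution_expand] between two spectral parameters. *)

(** * Moduli and derivatives *)

Local Notation Re := complex.Re.
Local Notation Im := complex.Im.

Section ComplexModulus.
Context {R : realType}.
Local Notation C := R[i].
Implicit Types z w : C.

Lemma normC_cmod z : `|z| = (cmod z)%:C.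
Proof. by case: z. Qed.

Lemma cmod_ge0 z : 0 <= cmod z.
Proof. by case: z => a b; exact: sqrtr_ge0. Qed.

Lemma cmod0 : cmod 0 = 0 :> R. Proof. exact: ComplexField.Normc.normc0. Qed.
Lemma cmod1 : cmod 1 = 1 :> R. Proof. exact: ComplexField.Normc.normc1. Qed.
Lemma cmodM z w : cmod (z * w) = cmod z * cmod w.
Proof. exact: ComplexField.Normc.normcM. Qed.
Lemma cmodV z : cmod z^-1 = (cmod z)^-1.
Proof. exact: ComplexField.Normc.normcV. Qed.
Lemma cmodN z : cmod (- z) = cmod z.
Proof. exact: normcN. Qed.
Lemma cmodB z w : cmod (z - w) = cmod (w - z).
Proof. by rewrite -cmodN opprB. Qed.
Lemma le_cmodD z w : cmod (z + w) <= cmod z + cmod w.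
Proof. exact: le_normcD. Qed.
Lemma le_cmodB z w : cmod (z - w) <= cmod z + cmod w.
Proof. by rewrite -(cmodN w); exact: le_cmodD. Qed.
Lemma cmodX z n : cmod (z ^+ n) = cmod z ^+ n.
Proof. by elim: n => [|n IH]; rewrite ?cmod1// !exprS cmodM IH. Qed.
Lemma cmod_eq0 z : (cmod z == 0) = (z == 0).
Proof.
apply/eqP/eqP => [|->]; last exact: cmod0.
exact: ComplexField.Normc.eq0_normc.
Qed.
Lemma cmod_gt0 z : (0 < cmod z) = (z != 0).
Proof. by rewrite lt_def cmod_eq0 cmod_ge0 andbT. Qed.
Lemma cmod_real (r : R) : cmod r%:C = `|r|.
Proof. by rewrite /cmod /= expr0n/= addr0 sqrtr_sqr. Qed.
Lemma cmod_sqr z : cmod z ^+ 2 = Re z ^+ 2 + Im z ^+ 2.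
Proof. by case: z => a b; rewrite sqr_sqrtr// addr_ge0// sqr_ge0. Qed.
Lemma cmod_nat n : cmod n%:R = n%:R :> R.
Proof. by rewrite -(rmorph_nat (real_complex R)) cmod_real ger0_norm. Qed.
Lemma cmodi : cmod 'i%C = 1 :> R.
Proof. by rewrite /cmod /= expr0n/= add0r expr1n sqrtr1. Qed.

Lemma Re_le_cmod z : `|Re z| <= cmod z.
Proof.
rewrite -(@ler_pXn2r _ 2%N) ?nnegrE ?cmod_ge0// cmod_sqr -normrX.
by rewrite ger0_norm ?sqr_ge0// lerDl sqr_ge0.
Qed.

Lemma Im_le_cmod z : `|Im z| <= cmod z.
Proof.
rewrite -(@ler_pXn2r _ 2%N) ?nnegrE ?cmod_ge0// cmod_sqr -normrX.
by rewrite ger0_norm ?sqr_ge0// lerDr sqr_ge0.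
Qed.

Lemma cmod_le_ReIm z : cmod z <= `|Re z| + `|Im z|.
Proof.
rewrite -(@ler_pXn2r _ 2%N) ?nnegrE ?cmod_ge0 ?addr_ge0// cmod_sqr.
rewrite sqrrD !real_normK ?num_real//.
by rewrite lerD2r lerDl mulrn_wge0// mulr_ge0.
Qed.

Lemma ReD z w : Re (z + w) = Re z + Re w.
Proof. by case: z; case: w. Qed.
Lemma ImD z w : Im (z + w) = Im z + Im w.
Proof. by case: z; case: w. Qed.
Lemma ReN z : Re (- z) = - Re z.
Proof. by case: z. Qed.
Lemma ImN z : Im (- z) = - Im z.
Proof. by case: z. Qed.
Lemma ReM z w : Re (z * w) = Re z * Re w - Im z * Im w.
Proof. by case: z; case: w. Qed.
Lemma ImM z w : Im (z * w) = Re z * Im w + Im z * Re w.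
Proof. by case: z; case: w. Qed.
Definition ReImE := (ReD, ImD, ReN, ImN, ReM, ImM).

Lemma complex_ext z w : Re z = Re w -> Im z = Im w -> z = w.
Proof. by case: z; case: w => ? ? ? ? /= -> ->. Qed.

Lemma complexRI z : z = Re z +i* Im z.
Proof. by case: z. Qed.

Lemma realcD (x y : R) : (x + y)%:C = x%:C + y%:C :> C.
Proof. exact: (rmorphD (real_complex R)). Qed.
Lemma realcM (x y : R) : (x * y)%:C = x%:C * y%:C :> C.
Proof. exact: (rmorphM (real_complex R)). Qed.
Lemma realcX (x : R) n : (x ^+ n)%:C = x%:C ^+ n :> C.
Proof. exact: (rmorphXn (real_complex R)). Qed.
Lemma realc_nat n : (n%:R : R)%:C = n%:R :> C.
Proof. exact: (rmorph_nat (real_complex R)). Qed.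
Lemma realcV (x : R) : (x^-1)%:C = (x%:C)^-1 :> C.
Proof. exact: (fmorphV (real_complex R)). Qed.
Lemma realc_neq0 (x : R) : (x%:C != 0 :> C) = (x != 0).
Proof. by rewrite -cmod_eq0 cmod_real normr_eq0. Qed.

(** Reduces an estimate of a complex quantity that is linear in some data to the
    estimate of a real part. *)
Lemma rotate_to_cmod z : exists2 u : C, cmod u = 1 & u * z = (cmod z)%:C.
Proof.
have [->|z0] := eqVneq z 0; first by exists 1; rewrite ?cmod1// mulr0 cmod0.
exists ((cmod z)%:C / z).
  by rewrite cmodM cmodV cmod_real ger0_norm ?cmod_ge0// divff// cmod_eq0.
by rewrite mulfVK.
Qed.

(** Neighbourhoods are indexed by complex radii, of which only the positive real
    ones count: convergence can be tested with the real-valued modulus. *)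
Lemma ccvgP {T : Type} (F : set_system T) {FF : Filter F} (f : T -> C) (l : C) :
  ((f : T -> C^o) @ F --> (l : C^o)) <->
  (forall eps : R, 0 < eps -> \forall t \near F, cmod (f t - l) < eps).
Proof.
split.
  move=> /cvgr_distC_lt H eps eps0.
  have := H eps%:C; rewrite ltcR => /(_ eps0).
  by apply: filterS => t; rewrite normC_cmod ltcR.
move=> H; apply/cvgrPdistC_lt => e.
rewrite ltcE => /andP[/eqP ime ree].
have -> : e = (Re e)%:C by case: e ime ree => a b /= -> _.
by apply: filterS (H _ ree) => t; rewrite normC_cmod ltcR.
Qed.

Lemma cnbhs0_dnbhs (eps : R) : 0 < eps -> \forall w \near (0 : C^o)^', cmod w < eps.
Proof.
move=> eps0; apply: nbhs_dnbhs; apply/nbhs_ballP; exists eps%:C => /=.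
  by rewrite ltcR.
by move=> w; rewrite /ball/= sub0r normrN normC_cmod ltcR.
Qed.

Lemma clim_eq {T : Type} (F : set_system T) {FF : ProperFilter F} (f : T -> C) (l : C) :
  (f : T -> C^o) @ F --> (l : C^o) -> lim ((f : T -> C^o) @ F) = l.
Proof. by move=> fl; apply: (@cvg_lim C^o) fl; exact: norm_hausdorff. Qed.

End ComplexModulus.

(** The differentiation rules, for functions given pointwise instead of by the
    operations of the ring of functions. *)
Section DerivativeRules.
Context {R : realType}.
Implicit Types (f g : R -> R) (t df dg : R).

Lemma is_derive1D f g t df dg :
  is_derive t (1 : R) f df -> is_derive t (1 : R) g dg ->
  is_derive t (1 : R) (fun x => f x + g x) (df + dg).
Proof. by move=> Hf Hg; exact: (is_deriveD Hf Hg). Qed.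

Lemma is_derive1B f g t df dg :
  is_derive t (1 : R) f df -> is_derive t (1 : R) g dg ->
  is_derive t (1 : R) (fun x => f x - g x) (df - dg).
Proof. by move=> Hf Hg; exact: (is_deriveB Hf Hg). Qed.

Lemma is_derive1M f g t df dg :
  is_derive t (1 : R) f df -> is_derive t (1 : R) g dg ->
  is_derive t (1 : R) (fun x => f x * g x) (df * g t + f t * dg).
Proof.
move=> Hf Hg; apply: (is_derive_eq (is_deriveM Hf Hg)).
by rewrite /GRing.scale /= addrC mulrC.
Qed.

Lemma is_derive1Z f t df (c : R) :
  is_derive t (1 : R) f df -> is_derive t (1 : R) (fun x => c * f x) (c * df).
Proof. by move=> Hf; exact: (is_deriveZ c Hf). Qed.

Lemma is_derive1Xn t n :
  is_derive t (1 : R) (fun x => x ^+ n) (n%:R * t ^+ n.-1).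
Proof.
have := DeriveDef (@exprn_derivable R n t 1) erefl.
by move/is_derive_eq; apply; rewrite exp_derive /GRing.scale /= mulr1.
Qed.

Lemma is_derive1_compose f g t df dg :
  is_derive (g t) (1 : R) f df -> is_derive t (1 : R) g dg ->
  is_derive t (1 : R) (fun x => f (g x)) (df * dg).
Proof. by move=> Hf Hg; exact: (is_derive1_comp Hf Hg). Qed.

End DerivativeRules.

(** * Legendre polynomials *)

Section PolyIntegral.
Context {R : realType}.
Implicit Types (p q f g : {poly R}) (n k m : nat).

Definition prim p : {poly R} := \poly_(i < (size p).+1) (p`_i.-1 / i%:R).

Lemma deriv_prim p : (prim p)^`() = p.
Proof.
apply/polyP => i; rewrite coef_deriv coef_poly ltnS /=.
case: ltnP => [_|si]; last by rewrite mul0rn nth_default.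
by rewrite -[LHS]mulr_natr mulfVK.
Qed.

Lemma deriv_eq0 p : p^`() = 0 -> p = (p`_0)%:P.
Proof.
move=> /polyP p'0; apply/polyP => -[|i]; rewrite coefC//=.
have /eqP := p'0 i; rewrite coef_deriv coef0 mulrn_eq0 /= => /eqP //.
Qed.

(** The integral from -1 to 1, taken formally: the moments are then a matter of
    algebra, and [Rintegral_poly] identifies it with Lebesgue's integral. *)
Definition pint p : R := (prim p).[1] - (prim p).[-1].

Lemma pint_deriv p : pint p^`() = p.[1] - p.[-1].
Proof.
rewrite /pint; have : (prim p^`() - p)^`() = 0.
  by rewrite derivB deriv_prim subrr.
move=> /deriv_eq0; set c := (X in X%:P) => /eqP; rewrite subr_eq => /eqP ->.
by rewrite !hornerE opprD addrACA subrr add0r.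
Qed.

Lemma pintE p q : q^`() = p -> pint p = q.[1] - q.[-1].
Proof. by move=> <-; exact: pint_deriv. Qed.

Lemma pintD p q : pint (p + q) = pint p + pint q.
Proof.
rewrite (@pintE _ (prim p + prim q)) ?derivD ?deriv_prim//.
by rewrite /pint !hornerD opprD addrACA.
Qed.

Lemma pintZ a p : pint (a *: p) = a * pint p.
Proof.
rewrite (@pintE _ (a *: prim p)) ?derivZ ?deriv_prim//.
by rewrite /pint !hornerZ mulrBr.
Qed.

Lemma pint_by_parts f g :
  pint (f^`() * g) = (f * g).[1] - (f * g).[-1] - pint (f * g^`()).
Proof. by rewrite -pint_deriv derivM pintD addrK. Qed.

Lemma pintX n : pint 'X^n = if odd n then 0 else 2 / n.+1%:R.
Proof.
rewrite (@pintE _ (n.+1%:R^-1 *: ('X^(n.+1) : {poly R}))); last first.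
  by rewrite derivZ derivXn /= -[X in _ *: X]scaler_nat scalerA mulVf ?scale1r.
rewrite !hornerZ !hornerXn expr1n -signr_odd /=.
case: (odd n) => /=; first by rewrite expr0 subrr.
by rewrite expr1 mulrN1 opprK mulr1 -mulr2n -[LHS]mulr_natl.
Qed.

End PolyIntegral.

Section Legendre.
Context {R : realType}.
Implicit Types (p q : {poly R}) (n k m : nat).
Local Notation u := ('X^2 - 1 : {poly R}).
Local Notation P := (@legendre R).
Local Notation w := (1 - 'X^2 : {poly R}).

Lemma derivn_exp_dvd p n j : (j <= n)%N ->
  exists r : {poly R}, (p ^+ n)^`(j) = p ^+ (n - j) * r.
Proof.
elim: j => [_|j IH jn]; first by exists 1; rewrite derivn0 subn0 mulr1.
have [r Hr] := IH (ltnW jn).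
rewrite derivnS Hr subnS; have : (0 < n - j)%N by rewrite subn_gt0.
case: (n - j)%N => // k _ /=.
exists (p^`() *+ k.+1 * r + p * r^`()).
by rewrite derivM deriv_exp /= exprS mulrDr !mulrA mulrnAr ![_ ^+ k * _]mulrC.
Qed.

Lemma derivn_u_root n j : (j < n)%N ->
  ((u ^+ n)^`(j)).[1] = 0 /\ ((u ^+ n)^`(j)).[-1] = 0.
Proof.
move=> jn; have [r ->] := derivn_exp_dvd u (ltnW jn).
have nj : (0 < n - j)%N by rewrite subn_gt0.
by split; rewrite hornerM horner_exp !hornerE ?sqrrN expr1n subrr expr0n
  (gtn_eqF nj) mul0r.
Qed.

(** No boundary terms appear: the derivatives of order less than [n] of
    [u ^+ n] still contain the factor [u], which vanishes at both ends. *)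
Lemma pint_derivn_u n j q : (j <= n)%N ->
  pint ((u ^+ n)^`(j) * q) = (-1) ^+ j * pint (u ^+ n * q^`(j)).
Proof.
elim: j q => [|j IH] q jn; first by rewrite !derivn0 expr0 mul1r.
rewrite derivnS pint_by_parts !hornerM.
have [-> ->] := derivn_u_root jn.
by rewrite !mul0r subrr sub0r IH 1?ltnW// -derivSn [(-1) ^+ j.+1]exprS mulN1r mulNr.
Qed.

(** The beta integrals to which Rodrigues' formula reduces the moments of [P n]. *)
Definition beta_int n m : R := pint (w ^+ n * 'X^m).

(** The derivative of [w ^+ n.+1 * 'X^(m.+1)] has integral zero, as [w] vanishes
    at both ends. *)
Lemma beta_intS n m :
  m.+1%:R * beta_int n.+1 m = n.+1.*2%:R * beta_int n m.+2.
Proof.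
have H : (w ^+ n.+1 * 'X^(m.+1))^`() =
    m.+1%:R *: (w ^+ n.+1 * 'X^m) -
    n.+1.*2%:R *: (w ^+ n * 'X^(m.+2)).
  rewrite derivM deriv_exp derivB derivXn derivXn derivC /= !scaler_nat.
  rewrite -muln2 mulrnA !exprS; ring.
have w0 : (w ^+ n.+1 * 'X^(m.+1)).[1] = 0 /\ (w ^+ n.+1 * 'X^(m.+1)).[-1] = 0.
  by split; rewrite hornerM horner_exp !hornerE ?sqrrN expr1n subrr expr0n mul0r.
have := pint_deriv (w ^+ n.+1 * 'X^(m.+1)); case: w0 => -> ->.
rewrite H -scaleNr pintD !pintZ subrr mulNr => /eqP.
by rewrite subr_eq0 => /eqP.
Qed.

Lemma beta_int_odd n m : odd m -> beta_int n m = 0.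
Proof.
elim: n m => [|n IH] m om; first by rewrite /beta_int expr0 mul1r pintX om.
have /eqP := beta_intS n m; rewrite (IH m.+2) ?mulr0; last by rewrite /= negbK.
by rewrite mulf_eq0 pnatr_eq0 => /eqP.
Qed.

Lemma fact_neq0 k : k`!%:R != 0 :> R.
Proof. by rewrite pnatr_eq0 -lt0n fact_gt0. Qed.

Lemma beta_int_even n m : beta_int n m.*2 =
  2 ^+ n.*2.+1 * n`!%:R * (m + n)`!%:R * m.*2`!%:R
  / ((m + n).*2.+1`!%:R * m`!%:R).
Proof.
elim: n m => [|n IH] m.
  rewrite /beta_int expr0 mul1r pintX odd_double !addn0 factS natrM /= double0 expr1 fact0.
  have m2 : m.*2.+1%:R != 0 :> R by rewrite pnatr_eq0.
  move: (fact_neq0 m) (fact_neq0 m.*2) m2.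
  move: (_%:R) (_%:R) (_.+1%:R) => a b c a0 b0 c0.
  by field; rewrite a0 b0 c0.
have m2 : m.*2.+1%:R != 0 :> R by rewrite pnatr_eq0.
have -> : beta_int n.+1 m.*2 = n.+1.*2%:R * beta_int n m.+1.*2 / m.*2.+1%:R.
  by rewrite doubleS -beta_intS mulrAC mulfV ?mul1r.
rewrite IH addSnnS.
have -> : 2 ^+ n.+1.*2.+1 = 4 * 2 ^+ n.*2.+1 :> R.
  by rewrite doubleS !exprS; ring.
have -> : n.+1`!%:R = n.+1%:R * n`!%:R :> R by rewrite factS natrM.
have -> : m.+1`!%:R = m.+1%:R * m`!%:R :> R by rewrite factS natrM.
have -> : m.+1.*2`!%:R = (2 * m.+1%:R) * (m.*2.+1%:R * m.*2`!%:R) :> R.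
  by rewrite doubleS !factS !natrM -doubleS -mul2n natrM.
have -> : n.+1.*2%:R = 2 * n.+1%:R :> R by rewrite -mul2n natrM.
have m1 : m.+1%:R != 0 :> R by rewrite pnatr_eq0.
move: m1 m2 (fact_neq0 (m + n.+1).*2.+1) (fact_neq0 m).
move: (2 ^+ _) (m.+1%:R) (n.+1%:R) (m.*2.+1%:R) (m.*2`!%:R) (m`!%:R) (n`!%:R)
  ((m + n.+1)`!%:R) ((m + n.+1).*2.+1`!%:R) => k1 k2 k3 k4 k5 k6 k7 k8 k9 H2 H4 H9 H6.
by field; rewrite H2 H4 H6 H9.
Qed.

(** Integrating Rodrigues' formula by parts [n] times. *)
Lemma pint_legendre n q :
  pint (P n * q) = (2 ^+ n * n`!%:R)^-1 * pint (w ^+ n * q^`(n)).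
Proof.
rewrite /legendre -scalerAl pintZ pint_derivn_u//; congr (_ * _).
have -> : u ^+ n = (-1) ^+ n *: w ^+ n by rewrite -exprZn scaleN1r opprB.
by rewrite -scalerAl pintZ mulrA -exprMn mulrNN mulr1 expr1n mul1r.
Qed.

Lemma pint_legendreX n k : pint (P n * 'X^k) =
  (2 ^+ n * n`!%:R)^-1 * (k ^_ n)%:R * beta_int n (k - n).
Proof.
by rewrite pint_legendre derivnXn -[_ *+ (k ^_ n)]scaler_nat -scalerAr pintZ mulrA.
Qed.

Lemma pint_legendre_small n q : (size q <= n)%N -> pint (P n * q) = 0.
Proof.
move=> qn; rewrite pint_legendre derivn_poly0// mulr0.
by rewrite -[0](scale0r 0) pintZ mul0r mulr0.
Qed.

Lemma pint_legendreX_odd n k : (n <= k)%N -> odd (k - n) -> pint (P n * 'X^k) = 0.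
Proof. by move=> _ o; rewrite pint_legendreX beta_int_odd ?mulr0. Qed.

Lemma pint_legendreX_even n m : pint (P n * 'X^(n + m.*2)) =
  2 ^+ n.+1 * (n + m.*2)`!%:R * (m + n)`!%:R / ((m + n).*2.+1`!%:R * m`!%:R).
Proof.
rewrite pint_legendreX addKn beta_int_even.
have -> : ((n + m.*2) ^_ n)%:R = (n + m.*2)`!%:R / m.*2`!%:R :> R.
  have := ffact_fact (leq_addr m.*2 n); rewrite addKn => <-.
  by rewrite natrM mulfK// fact_neq0.
have -> : 2 ^+ n.*2.+1 = 2 ^+ n * 2 ^+ n.+1 :> R by rewrite -addnn -addnS exprD.
have t0 : 2 ^+ n != 0 :> R by rewrite expf_neq0.
move: t0 (fact_neq0 (m + n).*2.+1) (fact_neq0 m) (fact_neq0 m.*2) (fact_neq0 n).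
move: (2 ^+ n) (2 ^+ n.+1) (_ `!%:R) (_ `!%:R) (_ `!%:R) (_ `!%:R) (_ `!%:R) (_`!%:R) => 
  k1 k2 k3 k4 k5 k6 k7 k8 H1 H2 H3 H4 H5.
by field; rewrite H1 H2 H3 H4 H5.
Qed.

Lemma size_u_exp n : size (u ^+ n) = n.*2.+1.
Proof.
have su : size u = 3 by rewrite (@size_XnsubC R 2 1).
rewrite -[LHS]prednK ?size_exp ?su//= ?mul2n// lt0n size_poly_eq0 expf_eq0.
by rewrite negb_and -(size_poly_eq0 u) su orbT.
Qed.

Lemma coef_legendre n : (P n)`_n = n.*2`!%:R / (2 ^+ n * n`!%:R ^+ 2).
Proof.
rewrite /legendre coefZ coef_derivn addnn.
have -> : (u ^+ n)`_n.*2 = 1.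
  have /monicP : u ^+ n \is monic by rewrite monic_exp// monicXnsubC.
  by rewrite /lead_coef size_u_exp.
have := ffact_fact (leq_addr n n); rewrite addKn addnn => <-.
rewrite natrM; have t0 : 2 ^+ n != 0 :> R by rewrite expf_neq0.
move: (2 ^+ n) (n`!%:R) (_ ^_ _) t0 (fact_neq0 n) => a c k a0 c0.
by field; rewrite a0 c0.
Qed.

Lemma coef_legendre_neq0 n : (P n)`_n != 0.
Proof.
rewrite coef_legendre mulf_eq0 invr_eq0 mulf_eq0 !expf_eq0 !pnatr_eq0/= andbF.
by rewrite !eqn0Ngt !fact_gt0.
Qed.

Lemma size_legendre n : size (P n) = n.+1.
Proof.
apply/eqP; rewrite eqn_leq; apply/andP; split.
  apply/leq_sizeP => j nj; rewrite coefZ coef_derivn nth_default ?mul0rn ?mulr0//.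
  by rewrite size_u_exp -addnn -addnS leq_add2l.
rewrite ltnNge; apply/negP => /leq_sizeP/(_ n (leqnn n))/eqP.
by rewrite (negbTE (coef_legendre_neq0 n)).
Qed.

Lemma pint_legendre_orth n m : n != m -> pint (P n * P m) = 0.
Proof.
wlog mn : n m / (m < n)%N => [H|_].
  rewrite neq_ltn => /orP[nm|mn]; last by rewrite H// gtn_eqF.
  by rewrite mulrC H// gtn_eqF.
by rewrite pint_legendre_small// size_legendre.
Qed.

Lemma pint_legendre_sqr n : pint (P n * P n) = (n%:R + 2^-1)^-1.
Proof.
rewrite pint_legendre.
have -> : (P n)^`(n) = (n.*2`!%:R / (2 ^+ n * n`!%:R))%:P.
  apply/polyP => i; rewrite coef_derivn coefC; case: eqP => [->|/eqP i0].
    rewrite addn0 coef_legendre ffactnn -[LHS]mulr_natr.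
    have t0 : 2 ^+ n != 0 :> R by rewrite expf_neq0.
    move: (2 ^+ n) (n`!%:R) (n.*2`!%:R) t0 (fact_neq0 n) => a c k a0 c0.
    by field; rewrite a0 c0.
  by rewrite nth_default ?mul0rn// size_legendre -addn1 leq_add2l lt0n.
rewrite [X in pint X]mulrC mul_polyC pintZ.
have := beta_int_even n 0; rewrite /beta_int double0 expr0 mulr1 add0n => ->.
rewrite fact0 factS natrM.
have -> : 2 ^+ n.*2.+1 = 2 * (2 ^+ n * 2 ^+ n) :> R by rewrite exprS -addnn exprD.
have -> : n.*2.+1%:R = 2 * n%:R + 1 :> R by rewrite -natr1 -mul2n natrM.
have t0 : 2 ^+ n != 0 :> R by rewrite expf_neq0.
have n0 : 0 <= n%:R :> R by [].
move: (2 ^+ n) (n`!%:R) (n.*2`!%:R) (n%:R) n0 t0 (fact_neq0 n) (fact_neq0 n.*2) =>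
  a c k d d0 a0 c0 k0.
field; rewrite a0 c0 k0 /= andbT; apply: lt0r_neq0; lra.
Qed.

(** [P n] has degree exactly [n], so the leading term of a polynomial can be
    removed by a multiple of a Legendre polynomial, one degree after another. *)
Lemma legendre_ind (T : {poly R} -> Prop) M :
  T 0 -> (forall a p q, T p -> T q -> T (a *: p + q)) ->
  (forall n, (n <= M)%N -> T (P n)) ->
  forall p, (size p <= M.+1)%N -> T p.
Proof.
move=> T0 Tl TP p; have [k] := ubnP (size p); elim: k p => // k IH p pk pM.
have [->//|p0] := eqVneq p 0.
pose n := (size p).-1; have sn : size p = n.+1 by rewrite prednK// lt0n size_poly_eq0.
pose c := p`_n / (P n)`_n.
have Pn0 := coef_legendre_neq0 n.
have nM : (n <= M)%N by rewrite -ltnS -sn.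
have sq : (size (p - c *: P n)%R <= n)%N.
  apply/leq_sizeP => j; rewrite leq_eqVlt => /orP[/eqP<-|nj].
    by rewrite coefB coefZ mulfVK ?subrr.
  by rewrite coefB coefZ !nth_default ?mulr0 ?subr0 ?size_legendre ?sn.
rewrite -(subrK (c *: P n) p) addrC; apply: Tl; first exact: TP.
apply: IH; first by rewrite (leq_ltn_trans sq)// -sn -ltnS.
by rewrite (leq_trans sq)// ltnW.
Qed.

End Legendre.

(** * The Gamma function at half-integers *)

Section Gamma.
Context {R : realType}.
Local Notation mu := (@lebesgue_measure R).
Import gauss_integral_proof.
Implicit Types (t : R) (k : nat).

Definition gamma_integrand k t : R := Num.sqrt t * t ^+ k * expR (- t).

(** An antiderivative of [gamma_integrand k]: the incomplete Gamma function at
    [k + 3/2], through the Gauss integral. *)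
Fixpoint gamma_prim k t : R :=
  if k is k'.+1 then (k'%:R + 3 / 2) * gamma_prim k' t - gamma_integrand k t
  else integral0_gauss (Num.sqrt t) - gamma_integrand 0 t.

Lemma is_derive_integral0_gauss t : 0 < t ->
  is_derive t 1 (@integral0_gauss R) (gauss_fun t).
Proof.
move=> t0; have tt1 : t < t + 1 by rewrite ltrDl.
have [|||d e] := @continuous_FTC1_closed R gauss_fun 0 t (t + 1) tt1.
- apply: continuous_compact_integrable => //; first exact: segment_compact.
  by apply: continuous_subspaceT; exact: continuous_gauss_fun.
- exact: t0.
- exact: continuous_gauss_fun.
- by rewrite derive1E in e; exact: (DeriveDef d e).
Qed.

Lemma is_derive_gamma_integrand k t : 0 < t ->
  is_derive t 1 (gamma_integrand k)
    ((2 * Num.sqrt t)^-1 * t ^+ k * expR (- t)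
     + Num.sqrt t * (k%:R * t ^+ k.-1) * expR (- t) - gamma_integrand k t).
Proof.
move=> t0.
have dE : is_derive t (1 : R) (fun x : R => expR (- x)) (expR (- t) * -1).
  exact: (is_derive1_compose (is_derive_expR _) (is_deriveNid t (1 : R))).
have H := is_derive1M (is_derive1M (is_derive1_sqrt t0) (is_derive1Xn t k)) dE.
apply: (is_derive_eq H); rewrite /gamma_integrand /=.
by ring.
Qed.

Lemma is_derive_gamma_prim k t : 0 < t ->
  is_derive t 1 (gamma_prim k) (gamma_integrand k t).
Proof.
move=> t0; have st0 : 0 < Num.sqrt t by rewrite sqrtr_gt0.
have st : t = Num.sqrt t ^+ 2 by rewrite sqr_sqrtr// ltW.
elim: k => [|k IH] /=.
  have dc := is_derive1_compose (is_derive_integral0_gauss st0) (is_derive1_sqrt t0).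
  apply: (is_derive_eq (is_derive1B dc (is_derive_gamma_integrand 0 t0))).
  rewrite /gauss_fun -st /gamma_integrand /=.
  by rewrite !mul0r mulr0 mul0r addr0 expr0 mulr1 mulrC opprB addrC subrK mulr1.
apply: (is_derive_eq (is_derive1B (is_derive1Z (k%:R + 3 / 2) IH) (is_derive_gamma_integrand k.+1 t0))).
rewrite /gamma_integrand /= exprS -(natr1 k).
move: (Num.sqrt t : R) st st0 (t ^+ k) (expR (- t)) (k%:R) => y -> y0 a b c.
by field; rewrite gt_eqF.
Qed.

Lemma gamma_integrand_ge0 k t : 0 <= t -> 0 <= gamma_integrand k t.
Proof. by move=> t0; rewrite !mulr_ge0 ?exprn_ge0 ?expR_ge0. Qed.

Lemma continuous_gamma_integrand k : continuous (gamma_integrand k).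
Proof.
move=> t; apply: cvgM; first apply: cvgM.
- exact: sqrt_continuous.
- exact: exprn_continuous.
- apply: (@continuous_comp _ _ _ (fun x : R => - x) expR).
    exact: opp_continuous.
  exact: continuous_expR.
Qed.

(** For [t >= 1] the integrand is at most [t ^+ k.+1 * exp (- t)], and the
    exponential dominates [t ^+ k.+2 / k.+2`!]. *)
Lemma gamma_integrand_cvgy k : gamma_integrand k t @[t --> +oo] --> (0 : R).
Proof.
apply: (@squeeze_cvgr _ _ _ _ (cst 0) (fun t => k.+2`!%:R * t^-1)).
- near=> t; have t1 : 1 <= t by near: t; apply: nbhs_pinfty_ge; rewrite num_real.
  have t0 : 0 < t by apply: lt_le_trans t1.
  have st : Num.sqrt t <= t.
    by rewrite -[leRHS](ger0_norm (ltW t0)) -sqrtr_sqr ler_sqrt ?sqr_ge0// ler_eXnr.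
  rewrite /= (gamma_integrand_ge0 _ (ltW t0))/=.
  suff : t * (Num.sqrt t * t ^+ k) <= k.+2`!%:R * expR t.
    rewrite /gamma_integrand expRN => H.
    by rewrite ler_pdivrMr ?expR_gt0// mulrAC ler_pdivlMr// mulrC.
  have : t ^+ k.+2 <= k.+2`!%:R * expR t.
    rewrite -ler_pdivrMl ?ltr0n ?fact_gt0// mulrC.
    by rewrite (le_trans _ (expR_ge1Dxn k.+1 (ltW t0)))// lerDr.
  apply: le_trans; rewrite 2!exprS; apply: (ler_wpM2l (ltW t0)).
  by apply: ler_wpM2r; rewrite ?exprn_ge0 ?(ltW t0).
- exact: cvg_cst.
- rewrite -[X in _ --> X](mulr0 (k.+2`!%:R)); apply: cvgM; first exact: cvg_cst.
  apply/cvgrPdist_lt => e e0; near=> t.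
  have t0 : 0 < t by near: t; apply: nbhs_pinfty_gt; rewrite num_real.
  rewrite sub0r normrN ger0_norm ?invr_ge0 ?(ltW t0)// invf_plt ?posrE//.
  by near: t; apply: nbhs_pinfty_gt; rewrite num_real.
Unshelve. all: by end_near. Qed.

Lemma gamma_integrand0 k : gamma_integrand k 0 = 0.
Proof. by rewrite /gamma_integrand sqrtr0 !mul0r. Qed.

Lemma gamma_prim0 k : gamma_prim k 0 = 0.
Proof.
elim: k => [|k IH] /=; last by rewrite IH mulr0 gamma_integrand0 subrr.
by rewrite gamma_integrand0 subr0 sqrtr0 /integral0_gauss set_itv1 Rintegral_set1.
Qed.

Lemma gamma_prim_cvg0 k : gamma_prim k t @[t --> 0^'+] --> gamma_prim k 0.
Proof.
have ci j : gamma_integrand j t @[t --> 0^'+] --> gamma_integrand j 0.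
  exact/cvg_at_right_filter/continuous_gamma_integrand.
elim: k => [|k IH] /=; apply: cvgB => //; last exact: cvgZr.
rewrite sqrtr0.
have := @parameterized_integral_cvg_left R 0 1 gauss_fun ltr01.
have gi : mu.-integrable `[0, 1] (EFin \o @gauss_fun R).
  apply: continuous_compact_integrable => //; first exact: segment_compact.
  by apply: continuous_subspaceT; exact: continuous_gauss_fun.
move=> /(_ gi) H.
have -> : integral0_gauss 0 = 0 :> R.
  by rewrite /integral0_gauss set_itv1 Rintegral_set1.
apply: (@cvg_comp _ _ _ Num.sqrt (fun x => parameterized_integral mu 0 x gauss_fun) _ _ _ _ H).
have : Num.sqrt t @[t --> 0^'+] --> Num.sqrt (0 : R).
  exact/cvg_at_right_filter/sqrt_continuous.
by rewrite sqrtr0.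
Qed.

Fixpoint gamma_val k : R :=
  if k is k'.+1 then (k'%:R + 3 / 2) * gamma_val k' else Num.sqrt pi / 2.

Lemma gamma_prim_cvgy k : gamma_prim k t @[t --> +oo] --> gamma_val k.
Proof.
elim: k => [|k IH] /=; rewrite -[X in _ --> X]subr0; apply: cvgB;
  try exact: gamma_integrand_cvgy; last exact: cvgZr.
have H : @integral0_gauss R x @[x --> +oo] --> Num.sqrt pi / 2.
  have : Num.sqrt (@integral0_gauss R x ^+ 2) @[x --> +oo] --> Num.sqrt (pi / 4).
    by apply: continuous_cvg => //; [exact: sqrt_continuous|exact: cvg_integral0_gauss_sqr].
  rewrite sqrtrM ?pi_ge0// sqrtrV// (_ : 4 = 2 ^+ 2); last by rewrite expr2 -natrM.
  rewrite sqrtr_sqr ger0_norm// (_ : (fun _ => Num.sqrt _) = @integral0_gauss R)//.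
  by apply/funext => r; rewrite sqrtr_sqr// ger0_norm// integral0_gauss_ge0.
apply: (@cvg_comp _ _ _ Num.sqrt _ _ _ _ _ H).
apply/cvgryPge => A; near=> t.
have A0 : 0 <= `|A| by [].
rewrite (le_trans (ler_norm A))// -[leLHS](ger0_norm A0) -sqrtr_sqr ler_sqrt ?sqr_ge0//.
Unshelve. all: by end_near. Qed.

(** The fundamental theorem of calculus on the half-line, for the antiderivative
    [gamma_prim].  Starting at 3/2 and not at 1/2 keeps the integrand continuous
    at 0. *)
Lemma GammaR_half k : GammaR (k%:R + 3 / 2) = gamma_val k :> R.
Proof.
have -> : gamma_val k = \int[mu]_(t in `[0, +oo[) gamma_integrand k t.
  rewrite (@Rintegral_ge0_continuous_FTC2y R _ (gamma_prim k) 0 (gamma_val k)).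
  - by rewrite gamma_prim0 subr0.
  - exact: gamma_integrand_ge0.
  - exact/continuous_subspaceT/continuous_gamma_integrand.
  - exact: gamma_prim_cvgy.
  - by move=> x x0; have [] := is_derive_gamma_prim k x0.
  - exact: gamma_prim_cvg0.
  - move=> x; rewrite in_itv/= andbT => x0.
    by have [_ <-] := is_derive_gamma_prim k x0; rewrite derive1E.
have mg : measurable_fun (`]0, +oo[%classic : set R) (gamma_integrand k).
  apply: measurable_funTS; apply: continuous_measurable_fun.
  exact: continuous_gamma_integrand.
rewrite [RHS]/Rintegral -integral_itv_obnd_cbnd ?measurable_EFinP// -/(Rintegral _ _ _).
apply: eq_Rintegral => t; rewrite inE/= in_itv/= andbT => t0.
rewrite /gamma_integrand mulrAC (_ : k%:R + 3 / 2 - 1 = 2^-1 + k%:R); last by field.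
by rewrite powRD ?gt_eqF ?implybT// powR12_sqrt ?ltW// powR_mulrn ?ltW// mulrAC.
Qed.

Lemma gamma_valE k :
  gamma_val k = Num.sqrt pi * k.*2.+2`!%:R / (4 ^+ k.+1 * k.+1`!%:R).
Proof.
elim: k => [|k IH] /=; first by rewrite expr1 mulr1; change (0.*2.+2`!) with 2%N; field.
have f0 : k.+1`!%:R != 0 :> R by rewrite pnatr_eq0 -lt0n fact_gt0.
have e0 : 4 ^+ k.+1 != 0 :> R by rewrite expf_neq0.
have -> : k.+1.*2.+2`!%:R = (2 * (k%:R + 2)) * (2 * k%:R + 3) * k.*2.+2`!%:R :> R.
  rewrite doubleS factS (factS k.*2.+2) !natrM mulrA; congr (_ * _ * _).
    by rewrite -(addn4 k.*2) natrD -mul2n natrM; ring.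
  by rewrite -(addn3 k.*2) natrD -mul2n natrM.
have -> : k.+2`!%:R = (k%:R + 2) * k.+1`!%:R :> R.
  by rewrite factS natrM -[in X in X * _]addn2 natrD.
rewrite IH [4 ^+ k.+2]exprS.
have k0 : 0 <= k%:R :> R by [].
move: (Num.sqrt pi : R) (4 ^+ _) (k.+1`!%:R) (k%:R) e0 f0 k0 (_`!%:R) =>
  a b c d b0 c0 d0 g.
have d1 : d + 2 != 0 by apply: lt0r_neq0; lra.
by field; rewrite b0 c0 d1.
Qed.

End Gamma.

(** * Absolutely continuous functions *)

Section AbsolutelyContinuous.
Context {R : realType}.
Local Notation mu := (@lebesgue_measure R).
Implicit Types (a b t x y z e M : R).

Lemma is_derive_growth (f : R -> R) t d e : is_derive t (1 : R) f d -> 0 < e ->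
  exists2 eta : R, 0 < eta &
    forall y, `|y - t| < eta -> `|f y - f t - d * (y - t)| <= e * `|y - t|.
Proof.
move=> [df dE] e0.
have : (fun h => h^-1 *: ((f \o shift t) (h *: (1 : R)) - f t)) h @[h --> (0 : R)^'] --> d.
  by rewrite -dE; exact: df.
move=> /cvgrPdist_le /(_ e e0) /nbhs_ballP[eta /= eta0 H].
exists eta => // y yt; have [->|yt0] := eqVneq y t.
  by rewrite !subrr mulr0 subrr normr0 mulr0.
have y0 : y - t != 0 by rewrite subr_eq0.
have := H (y - t); rewrite /ball/= sub0r normrN => /(_ yt y0).
rewrite /GRing.scale /= mulr1 subrK => {}H.
rewrite -[X in `|X|](mulVKf y0) normrM mulrC ler_pM2r ?normr_gt0//.
by rewrite mulrBr [_^-1 * (d * _)]mulrCA mulVf// mulr1 distrC.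
Qed.

Section MeanValue.
Variables (f : R -> R) (a b : R) (U : set R) (c : R).
Hypothesis ab : a <= b.

(** [x] is reached from [a] by intervals lying in [U], whose contributions are
    kept apart, and by intervals on which [f] grows at rate at most [c]. *)
Definition reached x := exists (n : nat) (l r : 'I_n -> R),
  [/\ forall i, [/\ a <= l i, l i <= r i & r i <= x],
      trivIset setT (fun i => [set` `]l i, r i[]),
      forall i, `]l i, r i[ `<=` U &
      f x - f a <= c * (x - a) + \sum_i `|f (r i) - f (l i)|].

Lemma reached_refl : reached a.
Proof.
exists 0%N, (fun=> a), (fun=> a); split; [by case|by case|by case|].
by rewrite big_ord0 !subrr mulr0 addr0.
Qed.

Lemma reached_growth x y : x <= y -> f y - f x <= c * (y - x) ->
  reached x -> reached y.
Proof.
move=> xy fxy [n [l [r [lr tr lrU H]]]]; exists n, l, r; split => //.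
  by move=> i; have [? ? rx] := lr i; split => //; exact: le_trans xy.
rewrite (_ : f y - f a = (f y - f x) + (f x - f a)); last by ring.
rewrite (_ : c * (y - a) = c * (y - x) + c * (x - a)); last by ring.
by rewrite -[leRHS]addrA; apply: lerD.
Qed.

Lemma reached_open x y : 0 <= c -> a <= x -> x <= y -> `]x, y[ `<=` U ->
  reached x -> reached y.
Proof.
move=> c0 ax xy xyU [n [l [r [lr tr lrU H]]]].
pose l' (i : 'I_n.+1) := oapp l x (unlift ord_max i).
pose r' (i : 'I_n.+1) := oapp r y (unlift ord_max i).
have lE i : l' (lift ord_max i) = l i by rewrite /l' liftK.
have rE i : r' (lift ord_max i) = r i by rewrite /r' liftK.
have lM : l' ord_max = x by rewrite /l' unlift_none.
have rM : r' ord_max = y by rewrite /r' unlift_none.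
exists n.+1, l', r'; split.
- move=> i; case: (unliftP ord_max i) => [j ->|->]; last by rewrite lM rM.
  by rewrite lE rE; have [? ? rx] := lr j; split => //; exact: le_trans xy.
- have disj j z : l j < z -> z < r j -> x < z -> False.
    move=> _ zr xz; have [_ _ rx] := lr j.
    by have := lt_trans (lt_le_trans zr rx) xz; rewrite ltxx.
  move=> i j _ _ [z [/= ]]; rewrite !in_itv/= => /andP[].
  case: (unliftP ord_max i) => [i' ->|->]; case: (unliftP ord_max j) => [j' ->|->//].
  + rewrite !lE !rE => lz zr /andP[lz' zr']; congr (lift _ _); apply: tr => //.
    by exists z; split => /=; rewrite in_itv/= ?lz ?zr ?lz' ?zr'.
  + by rewrite lE rE lM rM => lz zr /andP[xz _]; have := disj _ _ lz zr xz.
  + by rewrite lE rE lM rM => xz _ /andP[lz zr]; have := disj _ _ lz zr xz.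
- move=> i; case: (unliftP ord_max i) => [j ->|->]; first by rewrite lE rE.
  by rewrite lM rM.
- rewrite big_ord_recr /= lM rM.
  have -> : \sum_(i < n) `|f (r' (widen_ord (leqnSn n) i)) - f (l' (widen_ord (leqnSn n) i))|
      = \sum_(i < n) `|f (r i) - f (l i)|.
    apply: eq_bigr => i _; rewrite (_ : widen_ord _ i = lift ord_max i) ?lE ?rE//.
    by apply: val_inj; rewrite /= /bump leqNgt ltn_ord.
  have := ler_norm (f y - f x).
  have : 0 <= c * (y - x) by rewrite mulr_ge0// subr_ge0.
  by move: H; rewrite !mulrBr; lra.
Qed.

(** If every point has a neighbourhood across which reachability propagates, the
    supremum of the reached points is reached and cannot be less than [b]. *)
Lemma reached_end :
  (forall t, a <= t <= b -> exists2 eta : R, 0 < eta &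
     forall y z, a <= y -> y <= t -> t <= z -> z <= b ->
       t - y < eta -> z - t < eta -> reached y -> reached z) ->
  reached b.
Proof.
move=> loc; pose S := [set x | a <= x <= b /\ reached x].
have Sa : S a by split; [rewrite lexx ab|exact: reached_refl].
have Sub : ubound S b by move=> x [/andP[]].
have supS : has_sup S by split; [exists a|exists b].
pose s := sup S.
have as_ : a <= s by apply: ub_le_sup => //; exists b.
have sb : s <= b by apply: ge_sup => //; exists a.
have [|eta eta0 H] := loc s; first by rewrite as_ sb.
have [y [/andP[ay yb] Ry] sy] := sup_adherent eta0 supS.
have ys : y <= s by apply: ub_le_sup => //; [exists b|split => //; rewrite ay].
pose z := Num.min (s + eta / 2) b.
have sz : s <= z by rewrite le_min sb andbT lerDl divr_ge0// ltW.
have zb : z <= b by rewrite ge_min lexx orbT.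
have Rz : reached z.
  apply: (H y) => //; first by move: sy; rewrite -/s; lra.
  have : z <= s + eta / 2 by rewrite ge_min lexx.
  by lra.
have zs : z <= s.
  by apply: ub_le_sup; [exists b|split => //; rewrite zb (le_trans as_ sz)].
suff -> : b = z by [].
apply/eqP; rewrite eq_le zb andbT; move: zs; rewrite {1}/z ge_min => /orP[|bs].
  by move=> ?; exfalso; lra.
exact: le_trans sz.
Qed.

End MeanValue.

Lemma trivIset_itv_len n (l r : 'I_n -> R) (U : set R) :
  (forall i, l i <= r i) -> trivIset setT (fun i => [set` `]l i, r i[]) ->
  (forall i, `]l i, r i[ `<=` U) -> measurable U ->
  ((\sum_i (r i - l i))%:E <= mu U)%E.
Proof.
move=> lr tr lrU mU.
have -> : (\sum_i (r i - l i))%:E = mu (\big[setU/set0]_(i < n) [set` `]l i, r i[]).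
  rewrite measure_semi_additive_ord//; last exact: bigsetU_measurable.
  rewrite -sumEFin; apply: eq_bigr => i _.
  rewrite /= lebesgue_measure_itv/= lte_fin; case: ltP => // rl.
  by rewrite (_ : l i = r i) ?subrr//; apply/eqP; rewrite eq_le lr rl.
apply: le_measure; rewrite ?inE//; first exact: bigsetU_measurable.
elim/big_ind : _ => //.
by move=> A B AU BU; rewrite subUset.
Qed.

(** The exceptional null set is covered by an open set [U] of measure less than
    the modulus of absolute continuity for [e].  The intervals of a chain from
    [a] to [b] on which the slope is not controlled lie in [U] and contribute less
    than [e] altogether; on the others the growth rate is at most [M + e]. *)
Lemma ac_real_le_slope (f : R -> R) a b M : a <= b -> 0 <= M ->
  abs_continuous a b (fun t => (f t)%:C) ->
  {ae mu, forall t, t \in `]a, b[ -> exists2 d, is_derive t (1 : R) f d & d <= M} ->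
  f b - f a <= M * (b - a).
Proof.
move=> ab M0 fac [N [mN N0 HN]].
suff H e : 0 < e -> f b - f a <= (M + e) * (b - a) + e.
  apply/ler_addgt0Pr => e e0; have e'0 : 0 < e / (b - a + 1).
    by rewrite divr_gt0// ltr_wpDl// subr_ge0.
  rewrite (le_trans (H _ e'0))// mulrDl -addrA lerD2l -{2}(mulr1 (_ / _)) -mulrDr.
  by rewrite mulfVK// gt_eqF// ltr_wpDl// subr_ge0.
move=> e0; have [del del0 Hac] := fac _ e0.
(* Nothing is assumed about derivatives at the end points, so they are put in
   the exceptional set. *)
pose N' := N `|` [set a; b].
have mN' : measurable N' by apply: measurableU => //; exact: measurableU.
have N'0 : mu N' = 0%E.
  apply: null_set_setU => //; first exact: measurableU.
  apply: countable_lebesgue_measure0; apply: finite_set_countable.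
  exact: finite_set2.
have N'y : (mu N' < +oo)%E by rewrite N'0.
have [U [oU NU muU]] := lebesgue_regularity_outer mN' N'y del0.
have mU : measurable U by exact: open_measurable.
have {}muU : (mu U < del%:E)%E.
  rewrite -[U](setDUK NU); apply: le_lt_trans muU.
  have mUN : measurable (U `\` N') by exact: measurableD.
  have : (mu (N' `|` U `\` N') <= mu N' + mu (U `\` N'))%E by exact: measureU2.
  by rewrite N'0 add0e.
have c0 : 0 <= M + e by rewrite addr_ge0// ltW.
have : reached f a U (M + e) b.
  apply: reached_end => // t /andP[at_ tb].
  have [Ut|nUt] := pselect (U t).
    have /nbhs_ballP[eta /= eta0 HU] := open_nbhs_nbhs (conj oU Ut).
    exists eta => // y z ay yt tz zb ty zt; apply: reached_open => //.
      exact: le_trans tz.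
    move=> r /=; rewrite in_itv/= => /andP[yr rz]; apply: HU.
    rewrite /ball/= ltr_norml; apply/andP; split; lra.
  have tab : t \in `]a, b[.
    rewrite in_itv/= !lt_neqAle at_ tb !andbT; apply/andP; split.
      by apply/eqP => at'; apply/nUt/NU; right; left.
    by apply/eqP => at'; apply/nUt/NU; right; right.
  have [d df dM] : exists2 d, is_derive t (1 : R) f d & d <= M.
    apply: contrapT => nd; apply/nUt/NU; left; apply: HN => /= H.
    exact/nd/H.
  have [eta eta0 Hd] := is_derive_growth df e0.
  exists eta => // y z ay yt tz zb ty zt; apply: reached_growth; first exact: le_trans tz.
  have := Hd z; have := Hd y.
  rewrite distrC ger0_norm ?subr_ge0// => /(_ ty); rewrite ler_norml => /andP[Hy _].
  rewrite ger0_norm ?subr_ge0// => /(_ zt); rewrite ler_norml => /andP[_ Hz].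
  have H1 : d * (z - t) <= M * (z - t) by rewrite ler_wpM2r// subr_ge0.
  have H2 : d * (t - y) <= M * (t - y) by rewrite ler_wpM2r// subr_ge0.
  move: Hy Hz H1 H2; rewrite !mulrBr !mulrDl; lra.
move=> [n [l [r [lr tr lrU]]]] /le_trans; apply; rewrite lerD2l ltW//.
under eq_bigr do rewrite -cmod_real rmorphB /=.
apply: Hac => //; rewrite -lte_fin; apply: le_lt_trans muU.
by apply: trivIset_itv_len => // i; have [] := lr i.
Qed.

End AbsolutelyContinuous.

Section ComplexAbsolutelyContinuous.
Context {R : realType}.
Local Notation mu := (@lebesgue_measure R).
Local Notation C := R[i].
Implicit Types (a b t M : R) (F G H : R -> C).

(** Absolute continuity of products, differences and real parts all follow from
    a domination of increments. *)
Lemma ac_dominated a b F G H (c : R) :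
  (forall l r, a <= l -> l <= r -> r <= b ->
    cmod (F r - F l) <= c * (cmod (G r - G l) + cmod (H r - H l))) ->
  abs_continuous a b G -> abs_continuous a b H -> abs_continuous a b F.
Proof.
move=> FGH acG acH e e0.
wlog c0 : c FGH / 0 < c => [wl|].
  apply: (wl (`|c| + 1)); last by rewrite ltr_wpDl.
  move=> l r al lr rb; apply: le_trans (FGH l r al lr rb) _.
  by rewrite ler_wpM2r ?addr_ge0 ?cmod_ge0// (le_trans (ler_norm c))// lerDl.
have e'0 : 0 < e / (2 * c) by rewrite divr_gt0// mulr_gt0.
have [d1 d10 H1] := acG _ e'0; have [d2 d20 H2] := acH _ e'0.
exists (Num.min d1 d2); first by rewrite lt_min d10.
move=> n l r lr tr; rewrite lt_min => /andP[/(H1 n l r lr tr) s1 /(H2 n l r lr tr) s2].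
apply: (@le_lt_trans _ _ (c * (\sum_i cmod (G (r i) - G (l i)) +
    \sum_i cmod (H (r i) - H (l i))))).
  rewrite -big_split mulr_sumr; apply: ler_sum => i _.
  by have [? ? ?] := lr i; exact: FGH.
have -> : e = c * (e / (2 * c) + e / (2 * c)) by field; rewrite gt_eqF.
by rewrite ltr_pM2l// ltrD.
Qed.

Lemma ac_sub a b a' b' F : a <= a' -> b' <= b ->
  abs_continuous a b F -> abs_continuous a' b' F.
Proof.
move=> aa bb acF e /acF[d d0 H]; exists d => // n l r lr.
apply: H => i; have [al ? rb] := lr i.
by split => //; [exact: le_trans al|exact: le_trans bb].
Qed.

Lemma ac_modulus a b F e : abs_continuous a b F -> 0 < e ->
  exists2 d : R, 0 < d & forall s t, a <= s <= b -> a <= t <= b ->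
    `|t - s| < d -> cmod (F t - F s) < e.
Proof.
move=> acF e0; have [d d0 H] := acF e e0; exists d => //.
have H' s t : a <= s -> s <= t -> t <= b -> t - s < d -> cmod (F t - F s) < e.
  move=> as_ st tb tsd; have := H 1%N (fun=> s) (fun=> t); rewrite !big_ord1; apply => //.
  by move=> i j _ _ _; rewrite !ord1.
move=> s t /andP[as_ sb] /andP[at_ tb].
have [st|/ltW ts] := leP s t.
  by rewrite ger0_norm ?subr_ge0//; exact: H'.
by rewrite ler0_norm ?subr_le0// opprB cmodB; exact: H'.
Qed.

Lemma ac_max a b F : a <= b -> abs_continuous a b F ->
  exists2 c, a <= c <= b & forall t, a <= t <= b -> cmod (F t) <= cmod (F c).
Proof.
move=> ab acF.
have cF : {within `[a, b], continuous (fun t => cmod (F t))}.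
  apply/subspace_continuousP => x /=; rewrite in_itv/= => xab.
  apply/cvgrPdist_lt => e e0; have [d d0 H] := ac_modulus acF e0.
  rewrite near_withinE; near=> t; rewrite /= in_itv/= => tab.
  have xt : `|x - t| < d by near: t; exact: cvgr_dist_lt.
  apply: le_lt_trans (H t x tab xab xt).
  rewrite /from_subspace/= ler_norml; apply/andP; split.
    have := le_cmodD (F t - F x) (F x); rewrite subrK (cmodB (F t)); lra.
  by have := le_cmodD (F x - F t) (F t); rewrite subrK; lra.
have [c cab cmax] := EVT_max ab cF.
by exists c => // t tab; apply: cmax.
Unshelve. all: by end_near. Qed.

Lemma ac_bounded a b F : a <= b -> abs_continuous a b F ->
  exists2 B, 0 <= B & forall t, a <= t <= b -> cmod (F t) <= B.
Proof.
move=> ab /(ac_max ab)[c _ H]; by exists (cmod (F c)) => //; exact: cmod_ge0.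
Qed.

Lemma ac_mulB a b F G H K : a <= b ->
  abs_continuous a b F -> abs_continuous a b G ->
  abs_continuous a b H -> abs_continuous a b K ->
  abs_continuous a b (fun t => F t * G t - H t * K t).
Proof.
move=> ab.
have acM A B : abs_continuous a b A -> abs_continuous a b B ->
    abs_continuous a b (fun t => A t * B t).
  move=> acA acB.
  have [MA MA0 HA] := ac_bounded ab acA; have [MB MB0 HB] := ac_bounded ab acB.
  apply: (@ac_dominated a b _ A B (MA + MB)) => // l r al lr rb.
  have -> : A r * B r - A l * B l = (A r - A l) * B r + A l * (B r - B l) by ring.
  rewrite (le_trans (le_cmodD _ _))// !cmodM mulrDr; apply: lerD.
    rewrite mulrC ler_wpM2r ?cmod_ge0//.
    by rewrite (le_trans (HB r _)) ?lerDr// rb (le_trans al).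
  rewrite ler_wpM2r ?cmod_ge0//.
  by rewrite (le_trans (HA l _)) ?lerDl// al (le_trans lr).
move=> /acM + + /acM => FG' + HK' => /FG' FG /HK' HK.
apply: (@ac_dominated a b _ _ _ 1 _ FG HK) => l r _ _ _; rewrite mul1r.
rewrite (_ : _ - _ - _ = (F r * G r - F l * G l) - (H r * K r - H l * K l)); last by ring.
exact: le_cmodB.
Qed.

Lemma ac_cvg_right a b F : a < b -> abs_continuous a b F ->
  (F : R -> C^o) t @[t --> a^'+] --> (F a : C^o).
Proof.
move=> ab acF; apply/ccvgP => e e0; have [d d0 H] := ac_modulus acF e0.
near=> t; apply: H; first by rewrite lexx ltW.
  by apply/andP; split; near: t; [exact: nbhs_right_ge|exact: nbhs_right_le].
have at_ : a <= t by near: t; exact: nbhs_right_ge.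
rewrite ger0_norm ?subr_ge0// ltrBlDr addrC.
by near: t; apply: nbhs_right_lt; rewrite ltrDl.
Unshelve. all: by end_near. Qed.

Lemma ac_cvg_left a b F : a < b -> abs_continuous a b F ->
  (F : R -> C^o) t @[t --> b^'-] --> (F b : C^o).
Proof.
move=> ab acF; apply/ccvgP => e e0; have [d d0 H] := ac_modulus acF e0.
near=> t; apply: H; first by rewrite lexx ltW.
  by apply/andP; split; near: t; [exact: nbhs_left_ge|exact: nbhs_left_le].
have tb : t <= b by near: t; exact: nbhs_left_le.
rewrite distrC ger0_norm ?subr_ge0// ltrBlDr -ltrBlDl.
by near: t; apply: nbhs_left_gt; rewrite ltrBlDr ltrDl.
Unshelve. all: by end_near. Qed.

Lemma is_cderiveM (u w : R -> C) t d d' : is_cderive u t d -> is_cderive w t d' ->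
  is_cderive (fun s => u s * w s) t (d * w t + u t * d').
Proof.
move=> [ur ui] [wr wi]; split => /=.
  have -> : (fun r => Re (u r * w r)) = (fun r => Re (u r) * Re (w r) - Im (u r) * Im (w r)).
    by apply/funext => r; rewrite ReM.
  apply: (is_derive_eq (is_derive1B (is_derive1M ur wr) (is_derive1M ui wi))).
  by rewrite !ReImE; ring.
have -> : (fun r => Im (u r * w r)) = (fun r => Re (u r) * Im (w r) + Im (u r) * Re (w r)).
  by apply/funext => r; rewrite ImM.
apply: (is_derive_eq (is_derive1D (is_derive1M ur wi) (is_derive1M ui wr))).
by rewrite !ReImE; ring.
Qed.

Lemma is_cderiveB (u w : R -> C) t d d' : is_cderive u t d -> is_cderive w t d' ->
  is_cderive (fun s => u s - w s) t (d - d').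
Proof.
move=> [ur ui] [wr wi]; split => /=.
  have -> : (fun r => Re (u r - w r)) = (fun r => Re (u r) - Re (w r)).
    by apply/funext => r; rewrite ReD ReN.
  by rewrite ReD ReN; exact: is_derive1B.
have -> : (fun r => Im (u r - w r)) = (fun r => Im (u r) - Im (w r)).
  by apply/funext => r; rewrite ImD ImN.
by rewrite ImD ImN; exact: is_derive1B.
Qed.

Lemma is_cderive_cst (c : C) t : is_cderive (fun=> c) t 0.
Proof. by split => /=; exact: is_derive_cst. Qed.

Lemma is_cderiveE (u : R -> C) t d : is_cderive u t d -> cderive u t = d.
Proof.
move=> [ur ui]; rewrite /cderive !derive1E.
by rewrite (@derive_val _ _ _ _ _ _ _ ur) (@derive_val _ _ _ _ _ _ _ ui) -complexRI.
Qed.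

Lemma near_eq_cderive (u w : R -> C) t :
  (\forall s \near t, u s = w s) -> cderive u t = cderive w t.
Proof.
move=> uw; rewrite /cderive !derive1E; congr (_ +i* _); apply: near_eq_derive;
  by apply: filterS uw => s ->.
Qed.

(** The mean value inequality: the real case, applied to the real part of [F]
    rotated so that its increment is real. *)
Lemma ac_le_slope a b M F : a <= b -> 0 <= M -> abs_continuous a b F ->
  {ae mu, forall t, t \in `]a, b[ -> exists2 d, is_cderive F t d & cmod d <= M} ->
  cmod (F b - F a) <= M * (b - a).
Proof.
move=> ab M0 acF dF; have [u u1 uF] := rotate_to_cmod (F b - F a).
pose f t := Re (u * F t).
have fE s t : f s - f t = Re (u * (F s - F t)) by rewrite mulrBr ReD ReN.
have -> : cmod (F b - F a) = f b - f a by rewrite fE uF.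
apply: ac_real_le_slope => //.
  apply: (@ac_dominated a b _ F F 1 _ acF acF) => l r _ _ _.
  rewrite -rmorphB cmod_real mul1r fE (le_trans (Re_le_cmod _))//.
  by rewrite cmodM u1 mul1r lerDl cmod_ge0.
move: dF; apply: (@filterS _ _ (ae_filter_ringOfSetsType mu)) => t Ht /Ht[d dF dM]; exists (Re (u * d)).
  have [+ _] := is_cderiveM (is_cderive_cst u t) dF.
  by rewrite mul0r add0r.
apply: le_trans dM; apply: le_trans (ler_norm _) _.
by apply: le_trans (Re_le_cmod _) _; rewrite cmodM u1 mul1r.
Qed.

End ComplexAbsolutelyContinuous.

(** * Solutions of the equation with point interactions *)

Section Wronskian.
Context {R : realType}.
Local Notation mu := (@lebesgue_measure R).
Local Notation C := R[i].
Variables (b : R) (q : R -> C) (N : nat) (x_ : nat -> R) (alpha : nat -> C).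
Hypothesis x0 : x_ 0%N = 0.
Hypothesis xN : x_ N.+1 = b.
Hypothesis x_lt : forall k, (k <= N)%N -> x_ k < x_ k.+1.
Implicit Types (u : R -> C) (v : nat -> R -> C) (lambda : C).

(** [v k] is the derivative of the solution [u] on the [k]-th interval, extended
    by continuity to its end points. *)
Record solution_with_deriv lambda u v := SolutionWithDeriv {
  swd_ac : forall k, (k <= N)%N -> abs_continuous (x_ k) (x_ k.+1) u;
  swd_ac' : forall k, (k <= N)%N -> abs_continuous (x_ k) (x_ k.+1) (v k);
  swd_deriv : forall k, (k <= N)%N ->
    forall t, t \in `]x_ k, x_ k.+1[ -> is_cderive u t (v k t);
  swd_eq : forall k, (k <= N)%N ->
    {ae mu, forall t, t \in `]x_ k, x_ k.+1[ ->
       is_cderive (v k) t ((q t - lambda) * u t)};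
  swd_jump : forall k, (k < N)%N ->
    v k.+1 (x_ k.+1) - v k (x_ k.+1) = alpha k.+1 * u (x_ k.+1) }.

Lemma x_ge0 k : (k <= N.+1)%N -> 0 <= x_ k.
Proof.
elim: k => [|k IH] kN; first by rewrite x0.
by rewrite (le_trans (IH (ltnW kN)))// ltW// x_lt.
Qed.

Lemma x_leb k : (k <= N.+1)%N -> x_ k <= b.
Proof.
move=> kN; rewrite -xN; have [n] := ubnP (N.+1 - k)%N.
elim: n k kN => // n IH k; rewrite leq_eqVlt => /predU1P[->//|kN] nk.
rewrite (le_trans (ltW (x_lt kN)))//; apply: IH => //.
by rewrite subnS -ltnS (leq_trans _ nk)// ltnS prednK// subn_gt0.
Qed.

Lemma x_cover t : 0 < t -> t <= b ->
  exists2 k, (k <= N)%N & x_ k < t /\ t <= x_ k.+1.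
Proof.
move=> t0 tb.
suff H n : (n <= N)%N -> t <= x_ n.+1 -> exists2 k, (k <= N)%N & x_ k < t /\ t <= x_ k.+1.
  by apply: (H N) => //; rewrite xN.
elim: n => [|n IH] nN tx; first by exists 0%N => //; rewrite x0.
have [tn|nt] := leP t (x_ n.+1); first exact: IH (ltnW nN) tn.
by exists n.+1.
Qed.

(** The derivative on each interval extends absolutely continuously to the closed
    interval, so that the one-sided derivatives at the nodes are end values of
    the extensions and the jump conditions become equations between them. *)
Lemma cauchy_solutionP lambda (u0 u1 : C) u :
  cauchy_solution b q N x_ alpha lambda u0 u1 u ->
  [/\ abs_continuous 0 b u, u 0 = u0 &
      exists2 v, solution_with_deriv lambda u v & v 0%N 0 = u1].
Proof.
move=> [[[acu H2u jump] eqn] u00 u01]; split => //.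
have : forall k, exists v : R -> C, (k <= N)%N ->
    [/\ abs_continuous (x_ k) (x_ k.+1) v,
        forall t, t \in `]x_ k, x_ k.+1[ -> is_cderive u t (v t) &
    {ae mu, forall t, t \in `]x_ k, x_ k.+1[ -> is_cderive v t ((q t - lambda) * u t)}].
  move=> k; have [kN|] := leqP k N; last by exists (fun=> 0).
  have [v [w [du acv _ dv]]] := H2u k kN; exists v => _; split => //.
  move: (eqn k kN) dv; apply: (@filterS2 _ _ (ae_filter_ringOfSetsType mu)) => t Ht Hv tx.
  have cu : cderive (cderive u) t = w t.
    rewrite -(is_cderiveE (Hv tx)); apply: near_eq_cderive.
    have : open_nbhs t `]x_ k, x_ k.+1[ by split; [exact: itv_open|exact: tx].
    move/open_nbhs_nbhs; apply: filterS => s sx; apply: is_cderiveE; exact: du.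
  have -> : (q t - lambda) * u t = w t; last exact: Hv.
  by rewrite mulrBl -(Ht tx) cu; ring.
move=> /choice[v Hv].
have right k : (k <= N)%N -> deriv_right u (x_ k) = v k (x_ k).
  move=> kN; have [acv du _] := Hv k kN.
  apply: clim_eq; apply: cvg_trans (ac_cvg_right (x_lt kN) acv).
  apply: near_eq_cvg; near=> t; symmetry; apply: is_cderiveE; apply: du.
  rewrite in_itv/=; apply/andP; split; near: t; first exact: nbhs_right_gt.
  exact/nbhs_right_lt/x_lt.
have left k : (k <= N)%N -> deriv_left u (x_ k.+1) = v k (x_ k.+1).
  move=> kN; have [acv du _] := Hv k kN.
  apply: clim_eq; apply: cvg_trans (ac_cvg_left (x_lt kN) acv).
  apply: near_eq_cvg; near=> t; symmetry; apply: is_cderiveE; apply: du.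
  rewrite in_itv/=; apply/andP; split; near: t; last exact: nbhs_left_lt.
  exact/nbhs_left_gt/x_lt.
exists v; last by rewrite -u01 -x0 right.
split.
- by move=> k kN; apply: ac_sub acu; rewrite ?x_ge0 ?x_leb// ltnW.
- by move=> k /Hv[].
- by move=> k /Hv[].
- by move=> k /Hv[].
- by move=> k kN; rewrite -right// -left ?(ltnW kN)// jump.
Unshelve. all: by end_near. Qed.

Definition wronskian u v u' v' k t : C := u t * v' k t - v k t * u' t.

(** The almost everywhere derivative of the Wronskian is
    [(lambda - lambda') * u * u'], and the jump conditions make it continuous at
    the nodes. *)
Lemma wronskian_growth lambda u v lambda' u' v' M :
  solution_with_deriv lambda u v -> solution_with_deriv lambda' u' v' ->
  0 <= M -> (forall t, 0 <= t <= b -> cmod (u t * u' t) <= M) ->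
  forall k t, (k <= N)%N -> x_ k <= t <= x_ k.+1 ->
  cmod (wronskian u v u' v' k t - wronskian u v u' v' 0 0)
    <= cmod (lambda - lambda') * M * t.
Proof.
move=> S S' M0 uM; pose c := cmod (lambda - lambda') * M.
have c0 : 0 <= c by rewrite mulr_ge0// cmod_ge0.
have step k t : (k <= N)%N -> x_ k <= t <= x_ k.+1 ->
    cmod (wronskian u v u' v' k t - wronskian u v u' v' k (x_ k)) <= c * (t - x_ k).
  move=> kN /andP[xt tx]; apply: ac_le_slope => //.
    apply: ac_sub (lexx _) tx _; apply: ac_mulB; first exact/ltW/x_lt.
    - exact: swd_ac S _ kN.
    - exact: swd_ac' S' _ kN.
    - exact: swd_ac' S _ kN.
    - exact: swd_ac S' _ kN.
  move: (swd_eq S kN) (swd_eq S' kN).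
  apply: (@filterS2 _ _ (ae_filter_ringOfSetsType mu)) => s Hs Hs'.
  rewrite in_itv/= => /andP[xs st].
  have sx : s \in `]x_ k, x_ k.+1[ by rewrite in_itv/= xs (lt_le_trans st).
  have := is_cderiveB (is_cderiveM (swd_deriv S kN sx) (Hs' sx))
    (is_cderiveM (Hs sx) (swd_deriv S' kN sx)).
  move=> H; eexists; first exact: H.
  rewrite (_ : _ - _ = (lambda - lambda') * (u s * u' s)); last by ring.
  rewrite cmodM ler_wpM2l ?cmod_ge0// uM//; apply/andP; split.
    by rewrite (le_trans (x_ge0 (leqW kN)))// ltW.
  by rewrite (le_trans (ltW st))// (le_trans tx)// x_leb.
have glue k : (k < N)%N ->
    wronskian u v u' v' k.+1 (x_ k.+1) = wronskian u v u' v' k (x_ k.+1).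
  move=> kN; rewrite /wronskian.
  have /eqP := swd_jump S kN; rewrite subr_eq => /eqP ->.
  have /eqP := swd_jump S' kN; rewrite subr_eq => /eqP ->.
  by ring.
suff nodes k : (k <= N)%N ->
    cmod (wronskian u v u' v' k (x_ k) - wronskian u v u' v' 0 0) <= c * x_ k.
  move=> k t kN xt; rewrite -/c -[wronskian _ _ _ _ k t](subrK (wronskian u v u' v' k (x_ k))).
  rewrite -addrA (le_trans (le_cmodD _ _))//.
  by have := step k t kN xt; have := nodes k kN; rewrite mulrBr; lra.
elim: k => [|k IH] kN; first by rewrite x0 subrr cmod0 mulr0.
rewrite glue// -[wronskian _ _ _ _ k _](subrK (wronskian u v u' v' k (x_ k))).
rewrite -addrA (le_trans (le_cmodD _ _))//.
have := step k (x_ k.+1) (ltnW kN); rewrite lexx andbT => /(_ (ltW (x_lt (ltnW kN)))).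
by have := IH (ltnW kN); rewrite mulrBr; lra.
Qed.

(** Expressing a solution through the fundamental system [c0], [s0] of a nearby
    spectral parameter by Cramer's rule: the Wronskians that occur are almost
    constant. *)
Lemma cauchy_solution_expand h lambda0 c0 s0 :
  cauchy_solution b q N x_ alpha lambda0 1 h c0 ->
  cauchy_solution b q N x_ alpha lambda0 0 1 s0 ->
  exists2 B, 0 <= B & forall lambda (u0 u1 : C) u M,
    cauchy_solution b q N x_ alpha lambda u0 u1 u -> 0 <= M ->
    (forall t, 0 <= t <= b -> cmod (u t) <= M) ->
    forall t, 0 < t -> t <= b ->
    cmod (u t - (u0 * c0 t + (u1 - u0 * h) * s0 t)) <= B * cmod (lambda - lambda0) * M.
Proof.
move=> /cauchy_solutionP[acc c00 [vc Sc vc0]] /cauchy_solutionP[acs s00 [vs Ss vs0]].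
have b0 : 0 <= b by rewrite -xN x_ge0.
have [Bc Bc0 Hc] := ac_bounded b0 acc; have [Bs Bs0 Hs] := ac_bounded b0 acs.
exists (2 * Bc * Bs * b); first by rewrite !mulr_ge0.
move=> lambda u0 u1 u M /cauchy_solutionP[acu u00 [vu Su vu0]] M0 Hu t t0 tb.
have [k kN [xt tx]] := x_cover t0 tb.
have xtx : x_ k <= t <= x_ k.+1 by rewrite tx ltW.
have t0b : 0 <= t <= b by rewrite ltW.
have cs1 : wronskian c0 vc s0 vs k t = 1.
  have [E E0 HE] : exists2 E, 0 <= E & forall t, 0 <= t <= b -> cmod (c0 t * s0 t) <= E.
    exists (Bc * Bs); first by rewrite mulr_ge0.
    by move=> s sb; rewrite cmodM ler_pM ?cmod_ge0 ?Hc ?Hs.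
  have := wronskian_growth Sc Ss E0 HE kN xtx; rewrite subrr cmod0 !mul0r => H.
  have : wronskian c0 vc s0 vs k t - wronskian c0 vc s0 vs 0 0 == 0.
    by rewrite -cmod_eq0 eq_le H cmod_ge0.
  by rewrite subr_eq0 => /eqP ->; rewrite /wronskian c00 s00 vs0 mulr0 subr0 mulr1.
have Ws : cmod (wronskian u vu s0 vs k t - u0) <= cmod (lambda - lambda0) * (M * Bs) * b.
  have W0 : wronskian u vu s0 vs 0 0 = u0 by rewrite /wronskian u00 s00 vs0 mulr0 subr0 mulr1.
  rewrite -{1}W0; apply: le_trans (wronskian_growth (M := M * Bs) Su Ss _ _ kN xtx) _.
  - by rewrite mulr_ge0.
  - by move=> s sb; rewrite cmodM ler_pM ?cmod_ge0 ?Hu ?Hs.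
  - by apply: ler_wpM2l => //; do ?apply: mulr_ge0; rewrite ?cmod_ge0.
have Wc : cmod (wronskian u vu c0 vc k t - (u0 * h - u1)) <= cmod (lambda - lambda0) * (M * Bc) * b.
  have W0 : wronskian u vu c0 vc 0 0 = u0 * h - u1.
    by rewrite /wronskian u00 c00 vc0 vu0 mulr1.
  rewrite -{1}W0; apply: le_trans (wronskian_growth (M := M * Bc) Su Sc _ _ kN xtx) _.
  - by rewrite mulr_ge0.
  - by move=> s sb; rewrite cmodM ler_pM ?cmod_ge0 ?Hu ?Hc.
  - by apply: ler_wpM2l => //; do ?apply: mulr_ge0; rewrite ?cmod_ge0.
have -> : u t - (u0 * c0 t + (u1 - u0 * h) * s0 t) =
    c0 t * (wronskian u vu s0 vs k t - u0) - s0 t * (wronskian u vu c0 vc k t - (u0 * h - u1)).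
  rewrite -[X in X - _](mulr1 (u t)) -cs1 /wronskian; ring.
rewrite (le_trans (le_cmodB _ _))// !cmodM.
have H1 := ler_pM (cmod_ge0 _) (cmod_ge0 _) (Hc t t0b) Ws.
have H2 := ler_pM (cmod_ge0 _) (cmod_ge0 _) (Hs t t0b) Wc.
apply: le_trans (lerD H1 H2) _; rewrite le_eqVlt; apply/orP; left; apply/eqP; ring.
Qed.

End Wronskian.

(** * The complex exponential *)

Section ComplexExponential.
Context {R : realType}.
Local Notation C := R[i].
Implicit Types (z w : C) (n : nat) (t : R).

Lemma cmod_expC z : cmod (expC z) = expR (Re z).
Proof.
rewrite /expC cmodM cmod_real ger0_norm ?expR_ge0// /cmod /=.
by rewrite cos2Dsin2 sqrtr1 mulr1.
Qed.

Lemma expC0 : expC 0 = 1 :> C.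
Proof.
by apply: complex_ext; rewrite /expC ReImE /= expR0 cos0 sin0 ?mul0r ?mulr0 ?addr0 ?subr0 ?mulr1.
Qed.

Lemma expCD z w : expC (z + w) = expC z * expC w.
Proof.
apply: complex_ext; rewrite /expC !ReImE /= expRD cosD sinD;
  by rewrite !mul0r ?subr0 ?addr0; ring.
Qed.

Lemma is_cderive_expC z t :
  is_cderive (fun s => expC (s%:C * z)) t (z * expC (t%:C * z)).
Proof.
have dl (c : R) : is_derive t (1 : R) (fun s => s * c) c.
  apply: (is_derive_eq (is_derive1M (is_derive_id t (1 : R)) (is_derive_cst c t (1 : R)))).
  by rewrite mul1r mulr0 addr0.
have dE := is_derive1_compose (is_derive_expR _) (dl (Re z)).
have dC := is_derive1_compose (is_derive_cos _) (dl (Im z)).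
have dS := is_derive1_compose (is_derive_sin _) (dl (Im z)).
have eE s : expC (s%:C * z) =
    expR (s * Re z) * cos (s * Im z) +i* (expR (s * Re z) * sin (s * Im z)).
  by apply: complex_ext; rewrite /expC !ReImE /= !mul0r ?subr0 ?addr0.
split.
  under eq_fun do rewrite eE /=.
  apply: (is_derive_eq (is_derive1M dE dC)).
  by rewrite eE ReM /=; ring.
under eq_fun do rewrite eE /=.
apply: (is_derive_eq (is_derive1M dE dS)).
by rewrite eE ImM /=; ring.
Qed.

Definition exp_taylor n z : C := \sum_(k < n) z ^+ k / k`!%:R.

Lemma is_cderive_expn z t n :
  is_cderive (fun s => (s%:C * z) ^+ n) t (n%:R * z * (t%:C * z) ^+ n.-1).
Proof.
elim: n => [|n IH].
  by rewrite !mul0r; under eq_fun do rewrite expr0; exact: is_cderive_cst.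
have d1 : is_cderive (fun s => s%:C * z) t z.
  have did : is_cderive (fun s => s%:C) t 1.
    by split => /=; [exact: is_derive_id|exact: is_derive_cst].
  have := is_cderiveM did (is_cderive_cst z t).
  by rewrite mul1r mulr0 addr0.
under eq_fun do rewrite exprS.
have := is_cderiveM d1 IH.
set d := (X in is_cderive _ _ X); set d' := (X in _ -> is_cderive _ _ X).
suff -> : d = d' by [].
rewrite /d /d' /= -natr1; case: n {IH d d'} => [|n] /=.
  by rewrite !expr0; ring.
by rewrite exprS; ring.
Qed.

Lemma is_cderive_exp_taylor z t n :
  is_cderive (fun s => exp_taylor n.+1 (s%:C * z)) t (z * exp_taylor n (t%:C * z)).
Proof.
have F0 k : (k`!%:R : C) != 0 by rewrite pnatr_eq0 -lt0n fact_gt0.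
elim: n => [|n IH].
  rewrite /exp_taylor big_ord0 mulr0.
  under eq_fun do rewrite big_ord1 expr0; exact: is_cderive_cst.
have -> : (fun s : R => exp_taylor n.+2 (s%:C * z)) =
    (fun s => exp_taylor n.+1 (s%:C * z) - (- (n.+1`!%:R)^-1) * (s%:C * z) ^+ n.+1).
  by apply/funext => s; rewrite [LHS]big_ord_recr /= mulNr opprK [X in _ = _ + X]mulrC.
have := is_cderiveB IH (is_cderiveM (is_cderive_cst (- (n.+1`!%:R)^-1) t) (is_cderive_expn z t n.+1)).
rewrite [exp_taylor n.+1 _]big_ord_recr /= mul0r add0r mulNr opprK mulrDr.
suff -> : (n.+1`!%:R)^-1 * (n.+1%:R * z * (t%:C * z) ^+ n) = z * ((t%:C * z) ^+ n / n`!%:R) by [].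
have n0 : (n.+1%:R : C) != 0 by rewrite pnatr_eq0.
rewrite factS natrM; move: (n.+1%:R : C) (n`!%:R : C) n0 (F0 n) => a c a0 c0.
by field; rewrite a0 c0.
Qed.

(** After rotating [F t] to a nonnegative real, [Re (u * F) - g] is
    nonincreasing. *)
Lemma cmod_le_integral (F : R -> C) (dF : R -> C) (g dg : R -> R) (t : R) :
  0 <= t -> F 0 = 0 -> g 0 = 0 ->
  (forall s, is_cderive F s (dF s)) -> (forall s, is_derive s (1 : R) g (dg s)) ->
  (forall s, 0 <= s <= t -> cmod (dF s) <= dg s) -> cmod (F t) <= g t.
Proof.
rewrite le_eqVlt => /predU1P[<- -> -> _ _ _|t0 F0 g0 dFE dgE dFg]; first by rewrite cmod0.
have [u u1 uF] := rotate_to_cmod (F t).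
pose f s := Re (u * F s) - g s.
have df s : is_derive s (1 : R) f (Re (u * dF s) - dg s).
  apply: is_derive1B => //; have [+ _] := is_cderiveM (is_cderive_cst u s) (dFE s).
  by rewrite mul0r add0r.
have cf : {within `[0, t], continuous f}.
  by apply: derivable_within_continuous => s _; have [] := df s.
have [s st] := MVT t0 (fun s _ => df s) cf.
rewrite {1 2}/f uF F0 g0 mulr0 /= !subr0 => E.
rewrite -subr_ge0 -oppr_le0 opprB E mulr_le0_ge0 ?(ltW t0)// subr_le0.
apply: le_trans (ler_norm _) _; apply: le_trans (Re_le_cmod _) _.
rewrite cmodM u1 mul1r dFg//.
by move: st; rewrite in_itv/= => /andP[? ?]; rewrite !ltW.
Qed.

(** Induction on [n]: along the segment from 0 to [z], the derivative of the
    remainder of order [n.+1] is [z] times the remainder of order [n]. *)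
Lemma expC_taylor n z :
  cmod (expC z - exp_taylor n z) <= cmod z ^+ n / n`!%:R * expR (cmod z).
Proof.
suff H t : 0 <= t <= 1 ->
    cmod (expC (t%:C * z) - exp_taylor n (t%:C * z))
      <= (cmod z ^+ n * expR (cmod z) / n`!%:R) * t ^+ n.
  by have := H 1; rewrite lexx ler01 mul1r expr1n mulr1 mulrAC; exact.
elim: n t => [|n IH] t /andP[t0 t1].
  rewrite /exp_taylor big_ord0 subr0 cmod_expC !expr0 mul1r mulr1 fact0 divr1 ler_expR.
  rewrite (le_trans (ler_norm _))// (le_trans (Re_le_cmod _))// cmodM cmod_real.
  by rewrite ger0_norm// ler_piMl ?cmod_ge0.
pose dF s := z * expC (s%:C * z) - z * exp_taylor n (s%:C * z).
pose k := cmod z ^+ n.+1 * expR (cmod z) / n.+1`!%:R.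
apply: (@cmod_le_integral (fun s => expC (s%:C * z) - exp_taylor n.+1 (s%:C * z))
  dF (fun s => k * s ^+ n.+1) (fun s => k * (n.+1%:R * s ^+ n)) t).
- exact: t0.
- rewrite mul0r expC0 /exp_taylor big_ord_recl expr0 fact0 divr1 big1 ?addr0 ?subrr//.
  by move=> i _; rewrite exprS !mul0r.
- by rewrite expr0n mulr0.
- move=> s; apply: is_cderiveB; first exact: is_cderive_expC.
  exact: is_cderive_exp_taylor.
- by move=> s; apply: is_derive1Z; exact: is_derive1Xn.
- move=> s /andP[s0 st]; rewrite /dF -mulrBr cmodM.
  have := IH s; rewrite s0 (le_trans st t1) => /(_ isT) H.
  rewrite (le_trans (ler_wpM2l (cmod_ge0 z) H))// /k factS natrM exprS.
  rewrite le_eqVlt; apply/orP; left; apply/eqP.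
  have F0 : (n`!%:R : R) != 0 by rewrite pnatr_eq0 -lt0n fact_gt0.
  have n0 : (n.+1%:R : R) != 0 by rewrite pnatr_eq0.
  move: (n.+1%:R : R) (n`!%:R : R) F0 n0 => a c c0 a0.
  by field; rewrite a0 c0.
Qed.

End ComplexExponential.

(** * Integrals of complex-valued functions *)

Section ComplexIntegral.
Context {R : realType}.
Local Notation mu := (@lebesgue_measure R).
Local Notation C := R[i].
Variables (a b : R).
Hypothesis ab : a < b.
Local Notation D := (`]a, b[%classic : set R).
Implicit Types (f g : R -> C) (F G : R -> R).

Definition cintegrable f :=
  mu.-integrable D (fun t => (Re (f t))%:E) /\ mu.-integrable D (fun t => (Im (f t))%:E).

Definition ccont (g : R -> C) :=
  continuous (fun t => Re (g t)) /\ continuous (fun t => Im (g t)).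

Lemma integrable_dominated F G : measurable_fun D F ->
  mu.-integrable D (fun t => (G t)%:E) -> (forall t, t \in `]a, b[ -> `|F t| <= G t) ->
  mu.-integrable D (fun t => (F t)%:E).
Proof.
move=> mF iG FG; apply: le_integrable iG => //.
  exact/measurable_EFinP.
move=> t /= tab; rewrite lee_fin (le_trans (FG t tab))//.
exact: ler_norm.
Qed.

Lemma rintegrableD F G : mu.-integrable D (fun t => (F t)%:E) ->
  mu.-integrable D (fun t => (G t)%:E) -> mu.-integrable D (fun t => (F t + G t)%:E).
Proof. by move=> iF iG; apply: eq_integrable (integrableD _ iF iG). Qed.

Lemma rintegrableB F G : mu.-integrable D (fun t => (F t)%:E) ->
  mu.-integrable D (fun t => (G t)%:E) -> mu.-integrable D (fun t => (F t - G t)%:E).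
Proof. by move=> iF iG; apply: eq_integrable (integrableB _ iF iG). Qed.

Lemma rintegrableZ (c : R) F : mu.-integrable D (fun t => (F t)%:E) ->
  mu.-integrable D (fun t => (c * F t)%:E).
Proof. by move=> iF; apply: eq_integrable (integrableZl _ c iF). Qed.

Lemma measurable_cont F : continuous F -> measurable_fun D F.
Proof. by move=> cF; apply: measurable_funTS; exact: continuous_measurable_fun. Qed.

Lemma integrable_cont F : continuous F -> mu.-integrable D (fun t => (F t)%:E).
Proof.
move=> cF; apply: (@integrableS _ _ _ mu `[a, b]%classic) => //.
- exact: subset_itv_oo_cc.
- apply: continuous_compact_integrable; first exact: segment_compact.
  exact: continuous_subspaceT.
Qed.

Lemma ccont_bounded g : ccont g ->
  exists2 B, 0 <= B & forall t, t \in `]a, b[ -> cmod (g t) <= B.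
Proof.
move=> [cr ci].
have bd F : continuous F -> exists2 B, 0 <= B & forall t, t \in `]a, b[ -> `|F t| <= B.
  move=> cF; have [c _ cmax] := EVT_max (ltW ab) (continuous_subspaceT cF).
  have [d _ dmin] := EVT_min (ltW ab) (continuous_subspaceT cF).
  exists (`|F c| + `|F d|) => [|t tab]; first by rewrite addr_ge0.
  have tab' : t \in `[a, b] by apply: subset_itv_oo_cc.
  rewrite ler_norml; apply/andP; split.
    rewrite lerNl; have := dmin t tab'; have := ler_norm (- F d).
    by rewrite normrN; have := normr_ge0 (F c); lra.
  by have := cmax t tab'; have := ler_norm (F c); have := normr_ge0 (F d); lra.
have [B1 B10 H1] := bd _ cr; have [B2 B20 H2] := bd _ ci.
exists (B1 + B2) => [|t tab]; first exact: addr_ge0.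
by rewrite (le_trans (cmod_le_ReIm _))// lerD ?H1 ?H2.
Qed.

Lemma cintegrable_mul f g : L2 a b f -> ccont g -> cintegrable (fun t => f t * g t).
Proof.
move=> [mr mi i2] cg; have [B B0 gB] := ccont_bounded cg; case: cg => cr ci.
have iG : mu.-integrable D (fun t => (B * (1 + cmod (f t) ^+ 2))%:E).
  exact/rintegrableZ/rintegrableD/i2/integrable_cont/cst_continuous.
have bound t : t \in `]a, b[ -> cmod (f t * g t) <= B * (1 + cmod (f t) ^+ 2).
  move=> tab; rewrite cmodM mulrC ler_pM ?cmod_ge0 ?gB//.
  by have := sqr_ge0 (cmod (f t) - 2^-1); rewrite sqrrB; lra.
have mfr : measurable_fun D (fun t => Re (f t * g t)).
  rewrite (_ : (fun t => _) = fun t => Re (f t) * Re (g t) - Im (f t) * Im (g t)); last first.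
    by apply/funext => t; rewrite ReM.
  by apply: measurable_funB; apply: measurable_funM => //; exact: measurable_cont.
have mfi : measurable_fun D (fun t => Im (f t * g t)).
  rewrite (_ : (fun t => _) = fun t => Re (f t) * Im (g t) + Im (f t) * Re (g t)); last first.
    by apply/funext => t; rewrite ImM.
  by apply: measurable_funD; apply: measurable_funM => //; exact: measurable_cont.
split; (apply: integrable_dominated; [by []|exact: iG|move=> t tab]).
- by rewrite (le_trans (Re_le_cmod _))// bound.
- by rewrite (le_trans (Im_le_cmod _))// bound.
Qed.

Lemma L2_cont g : ccont g -> L2 a b g.
Proof.
move=> cg; have [B B0 gB] := ccont_bounded cg; case: cg => cr ci.
split; [exact: measurable_cont|exact: measurable_cont|].
have mg : measurable_fun D (fun t => cmod (g t) ^+ 2).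
  rewrite (_ : (fun t => _) = fun t => Re (g t) ^+ 2 + Im (g t) ^+ 2); last first.
    by apply/funext => t; rewrite cmod_sqr.
  by apply: measurable_funD; apply: measurable_funX; exact: measurable_cont.
apply: (@integrable_dominated _ (fun=> B ^+ 2)); first exact: mg.
- exact: (integrable_cont (fun x => @cst_continuous R R (B ^+ 2) x)).
- by move=> t tab; rewrite ger0_norm ?sqr_ge0// ler_pXn2r ?nnegrE ?cmod_ge0 ?gB.
Qed.

Lemma cintegrable_cont g : ccont g -> cintegrable g.
Proof. by move=> [cr ci]; split; exact: integrable_cont. Qed.

Lemma L2B f g : L2 a b f -> L2 a b g -> L2 a b (fun t => f t - g t).
Proof.
move=> [fr fi f2] [gr gi g2].
have mr : measurable_fun D (fun t => Re (f t - g t)).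
  rewrite (_ : (fun t => _) = fun t => Re (f t) - Re (g t)); first exact: measurable_funB.
  by apply/funext => t; rewrite ReD ReN.
have mi : measurable_fun D (fun t => Im (f t - g t)).
  rewrite (_ : (fun t => _) = fun t => Im (f t) - Im (g t)); first exact: measurable_funB.
  by apply/funext => t; rewrite ImD ImN.
split => //.
have mfg : measurable_fun D (fun t => cmod (f t - g t) ^+ 2).
  rewrite (_ : (fun t => _) = fun t => Re (f t - g t) ^+ 2 + Im (f t - g t) ^+ 2); last first.
    by apply/funext => t; rewrite cmod_sqr.
  by apply: measurable_funD; exact: measurable_funX.
apply: (@integrable_dominated _ (fun t => 2 * (cmod (f t) ^+ 2 + cmod (g t) ^+ 2))).
- exact: mfg.
- exact/rintegrableZ/rintegrableD.
- move=> t _; rewrite ger0_norm ?sqr_ge0//.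
  have := le_cmodB (f t) (g t); have := sqr_ge0 (cmod (f t) - cmod (g t)).
  have := cmod_ge0 (f t - g t); have := cmod_ge0 (f t); have := cmod_ge0 (g t).
  move: (cmod (f t - g t)) (cmod (f t)) (cmod (g t)) => x y z; nra.
Qed.

Lemma cintegrableD f g : cintegrable f -> cintegrable g ->
  cintegrable (fun t => f t + g t).
Proof.
move=> [fr fi] [gr gi]; split.
- by apply: eq_integrable (rintegrableD fr gr) => // t _; rewrite ReD.
- by apply: eq_integrable (rintegrableD fi gi) => // t _; rewrite ImD.
Qed.

Lemma cintegrableZ (c : C) f : cintegrable f -> cintegrable (fun t => c * f t).
Proof.
move=> [fr fi]; split.
- have := rintegrableB (rintegrableZ (Re c) fr) (rintegrableZ (Im c) fi).
  by apply: eq_integrable => // t _; rewrite ReM.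
- have := rintegrableD (rintegrableZ (Re c) fi) (rintegrableZ (Im c) fr).
  by apply: eq_integrable => // t _; rewrite ImM.
Qed.

Lemma eq_cint f g : (forall t, t \in `]a, b[ -> f t = g t) -> cint a b f = cint a b g.
Proof.
move=> fg; rewrite /cint; congr (_ +i* _); apply: eq_Rintegral => t;
  by rewrite inE => /fg ->.
Qed.

Lemma cintD f g : cintegrable f -> cintegrable g ->
  cint a b (fun t => f t + g t) = cint a b f + cint a b g.
Proof.
move=> [fr fi] [gr gi]; apply: complex_ext; rewrite ?ReD ?ImD /= -RintegralD//.
  by apply: eq_Rintegral => t _; rewrite ReD.
by apply: eq_Rintegral => t _; rewrite ImD.
Qed.

Lemma cintZ (c : C) f : cintegrable f ->
  cint a b (fun t => c * f t) = c * cint a b f.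
Proof.
move=> [fr fi].
apply: complex_ext; rewrite ?ReM ?ImM /=.
  rewrite -RintegralZl// -RintegralZl//.
  rewrite -RintegralB//; try exact: rintegrableZ.
  by apply: eq_Rintegral => t _; rewrite ReM.
rewrite -RintegralZl// -RintegralZl//.
rewrite -RintegralD//; try exact: rintegrableZ.
by apply: eq_Rintegral => t _; rewrite ImM.
Qed.

Lemma cintB f g : cintegrable f -> cintegrable g ->
  cint a b (fun t => f t - g t) = cint a b f - cint a b g.
Proof.
move=> If Ig; rewrite -(mulN1r (cint a b g)) -cintZ// -cintD//.
  by apply: eq_cint => t _; rewrite mulN1r.
exact: cintegrableZ.
Qed.

Lemma cint0 : cint a b (fun=> 0) = 0.
Proof. by rewrite /cint /= Rintegral_cst ?mul0r. Qed.

Lemma cintegrable0 : cintegrable (fun=> 0).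
Proof. by apply: cintegrable_cont; split; exact: cst_continuous. Qed.

Lemma cint_sum n (F : 'I_n -> R -> C) : (forall i, cintegrable (F i)) ->
  cintegrable (fun t => \sum_(i < n) F i t) /\
  cint a b (fun t => \sum_(i < n) F i t) = \sum_(i < n) cint a b (F i).
Proof.
elim: n F => [|n IH] F iF.
  under eq_fun do rewrite big_ord0; rewrite big_ord0 cint0; split => //.
  exact: cintegrable0.
have [iS eS] := IH (fun i => F (widen_ord (leqnSn n) i)) (fun i => iF _).
under eq_fun do rewrite big_ord_recr /=; rewrite big_ord_recr /=.
by split; [exact: cintegrableD|rewrite cintD// eS].
Qed.

(** Rotating the integral to a real number turns it into the integral of a real
    part. *)
Lemma cmod_cint_le f G : cintegrable f -> mu.-integrable D (fun t => (G t)%:E) ->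
  (forall t, t \in `]a, b[ -> cmod (f t) <= G t) ->
  cmod (cint a b f) <= (\int[mu]_(t in D) G t)%R.
Proof.
move=> If iG fG; have [u u1 uF] := rotate_to_cmod (cint a b f).
have -> : cmod (cint a b f) = Re (cint a b (fun t => u * f t)) by rewrite cintZ// uF.
apply: le_Rintegral => //; first by have [] := cintegrableZ u If.
move=> t /= tab; apply: le_trans (ler_norm _) _; apply: le_trans (Re_le_cmod _) _.
by rewrite cmodM u1 mul1r fG.
Qed.

(** Cauchy-Schwarz, from the weighted inequality
    [2 |f g| <= s |f|^2 + |g|^2 / s] for all [s > 0]. *)
Lemma cint_cauchy_schwarz f g : L2 a b f -> ccont g ->
  cmod (cint a b (fun t => f t * g t)) <= normL2 a b f * normL2 a b g.
Proof.
move=> f2 cg; have [_ _ if2] := f2; have [_ _ ig2] := L2_cont cg.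
set I := cmod _; pose A := (\int[mu]_(t in D) (cmod (f t) ^+ 2))%R.
pose B := (\int[mu]_(t in D) (cmod (g t) ^+ 2))%R.
have A0 : 0 <= A by apply: Rintegral_ge0 => t _; exact: sqr_ge0.
have B0 : 0 <= B by apply: Rintegral_ge0 => t _; exact: sqr_ge0.
have H s : 0 < s -> 2 * I <= s * A + s^-1 * B.
  move=> s0.
  have : I <= (\int[mu]_(t in D) ((s / 2) * cmod (f t) ^+ 2 + (s^-1 / 2) * cmod (g t) ^+ 2))%R.
    apply: cmod_cint_le; first exact: cintegrable_mul.
      by apply: rintegrableD; exact: rintegrableZ.
    move=> t _; rewrite cmodM.
    have : 0 <= (s * cmod (f t) - cmod (g t)) ^+ 2 / s by rewrite divr_ge0 ?sqr_ge0 ?ltW.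
    have -> : (s * cmod (f t) - cmod (g t)) ^+ 2 / s =
      s * cmod (f t) ^+ 2 + s^-1 * cmod (g t) ^+ 2 - 2 * (cmod (f t) * cmod (g t)).
      by field; rewrite gt_eqF.
    by lra.
  rewrite RintegralD//; try exact: rintegrableZ.
  by rewrite RintegralZl// RintegralZl// -/A -/B; lra.
rewrite /normL2 -/A -/B -sqrtrM//.
have I0 : 0 <= I := cmod_ge0 _.
suff : I ^+ 2 <= A * B.
  by move=> IAB; rewrite -(ger0_norm I0) -sqrtr_sqr ler_sqrt// mulr_ge0.
have [A00|Apos] := eqVneq A 0.
  have [->|In0] := eqVneq I 0; first by rewrite expr0n mulr_ge0.
  have Ip : 0 < I by rewrite lt_def In0.
  (* A choice of [s] for which the weighted inequality reads
     [2 * I <= I * (B / (B + 1))]. *)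
  have s0 : 0 < (B + 1) / I by rewrite divr_gt0// ltr_wpDl.
  have := H _ s0; rewrite A00 mulr0 add0r invf_div mulrAC ler_pdivlMr ?ltr_wpDl//.
  rewrite [2 * I]mulrC -mulrA ler_pM2l//; lra.
have Ap : 0 < A by rewrite lt_def Apos.
have [I00|In0] := eqVneq I 0; first by rewrite I00 expr0n mulr_ge0.
have Ip : 0 < I by rewrite lt_def In0.
(* The weight [s = I / A] balances the inequality. *)
have := H _ (divr_gt0 Ip Ap); rewrite mulfVK ?gt_eqF// invf_div.
have : A / I * B = A * B / I by rewrite mulrAC.
move=> ->; rewrite -lerBlDl (_ : 2 * I - I = I); last by ring.
by rewrite ler_pdivlMr// expr2.
Qed.

End ComplexIntegral.

(** * Legendre moments of the exponential *)

Section LegendreExponential.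
Context {R : realType}.
Local Notation mu := (@lebesgue_measure R).
Local Notation C := R[i].
Implicit Types (x t : R) (z : C) (n N : nat) (p : {poly R}).

(** The fundamental theorem of calculus, over the open interval. *)
Lemma Rintegral_derive (F F' : R -> R) (a b : R) : a < b ->
  (forall t, is_derive t (1 : R) F (F' t)) -> continuous F' ->
  (\int[mu]_(t in `]a, b[) F' t)%R = F b - F a.
Proof.
move=> ab dF cF'.
have cF : continuous F.
  by move=> t; apply/differentiable_continuous/derivable1_diffP; have [] := dF t.
rewrite Rintegral_itv_bndo_bndc; last exact: integrable_cont.
rewrite Rintegral_itv_obnd_cbnd; last first.
  apply: (@integrableS _ _ _ mu `[a, b]%classic) => //.
    exact: subset_itv_oc_cc.
  apply: continuous_compact_integrable; first exact: segment_compact.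
  exact: continuous_subspaceT.
rewrite /Rintegral (continuous_FTC2 (F := F) ab) ?fineB//.
- exact: continuous_subspaceT.
- split => [t _||]; first by have [] := dF t.
  + exact/cvg_at_right_filter/cF.
  + exact/cvg_at_left_filter/cF.
- by move=> t _; rewrite derive1E; have [_ ->] := dF t.
Qed.

Lemma cint_real (a b : R) (F : R -> R) :
  cint a b (fun t => (F t)%:C) = (\int[mu]_(t in `]a, b[) F t)%R%:C.
Proof.
apply: complex_ext => //=.
by rewrite Rintegral_cst ?mul0r.
Qed.

Lemma is_derive_poly_scaled p x t :
  is_derive t (1 : R) (fun s => p.[s / x]) (p^`().[t / x] / x).
Proof.
have dl : is_derive t (1 : R) (fun s => s / x) x^-1.
  have := is_derive1M (is_derive_id t (1 : R)) (is_derive_cst x^-1 t (1 : R)).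
  by move/is_derive_eq; apply; rewrite mul1r mulr0 addr0.
exact: (is_derive1_compose (is_derive_poly _ _) dl).
Qed.

Lemma continuous_poly_scaled p x : continuous (fun t => p.[t / x]).
Proof.
move=> t; apply/differentiable_continuous/derivable1_diffP.
by have [] := is_derive_poly_scaled p x t.
Qed.

Lemma Rintegral_poly p x : 0 < x ->
  (\int[mu]_(t in `](- x), x[) p.[t / x])%R = x * pint p.
Proof.
move=> x0; have xx : - x < x by lra.
have dF t : is_derive t (1 : R) (fun t => x * (prim p).[t / x]) p.[t / x].
  apply: (is_derive_eq (is_derive1Z x (is_derive_poly_scaled (prim p) x t))).
  by rewrite deriv_prim mulrC mulfVK// gt_eqF.
have -> := Rintegral_derive xx dF (@continuous_poly_scaled p x).
by rewrite mulNr divff ?gt_eqF// -mulrBr.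
Qed.

Lemma is_cderive_ccont (g dg : R -> C) : (forall t, is_cderive g t (dg t)) -> ccont g.
Proof.
by move=> d; split => t; apply/differentiable_continuous/derivable1_diffP;
  have [[? _] [? _]] := d t.
Qed.

Lemma ccont_expC z x : ccont (fun t => expC ((t / x)%:C * z)).
Proof.
rewrite (_ : (fun t => _) = fun t => expC (t%:C * (x^-1%:C * z))).
  by apply: is_cderive_ccont => t; exact: is_cderive_expC.
by apply/funext => t; rewrite realcM mulrA.
Qed.

Lemma ccont_real (F : R -> R) : continuous F -> ccont (fun t => (F t)%:C).
Proof. by move=> cF; split => //; exact: cst_continuous. Qed.

Lemma ccontM (f g : R -> C) : ccont f -> ccont g -> ccont (fun t => f t * g t).
Proof.
move=> [fr fi] [gr gi]; split.
- rewrite (_ : (fun t => _) = fun t => Re (f t) * Re (g t) - Im (f t) * Im (g t)).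
    by move=> t; apply: cvgB; apply: cvgM; [exact: fr|exact: gr|exact: fi|exact: gi].
  by apply/funext => t; rewrite ReM.
- rewrite (_ : (fun t => _) = fun t => Re (f t) * Im (g t) + Im (f t) * Re (g t)).
    by move=> t; apply: cvgD; apply: cvgM; [exact: fr|exact: gi|exact: fi|exact: gr].
  by apply/funext => t; rewrite ImM.
Qed.

Lemma ccontB (f g : R -> C) : ccont f -> ccont g -> ccont (fun t => f t - g t).
Proof.
move=> [fr fi] [gr gi]; split.
- rewrite (_ : (fun t => _) = fun t => Re (f t) - Re (g t)).
    by move=> t; apply: cvgB; [exact: fr|exact: gr].
  by apply/funext => t; rewrite ReD ReN.
- rewrite (_ : (fun t => _) = fun t => Im (f t) - Im (g t)).
    by move=> t; apply: cvgB; [exact: fi|exact: gi].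
  by apply/funext => t; rewrite ImD ImN.
Qed.

Lemma ccont_cst (c : C) : ccont (fun=> c).
Proof. by split; exact: cst_continuous. Qed.

Lemma ccontJ (f : R -> C) : ccont f -> ccont (fun t => (f t)^*%C).
Proof.
move=> [fr fi]; split.
- by rewrite (_ : (fun t => _) = fun t => Re (f t))//; apply/funext => t; case: (f t).
- rewrite (_ : (fun t => _) = fun t => - Im (f t)).
    by move=> t; apply: cvgN; exact: fi.
  by apply/funext => t; case: (f t).
Qed.

Lemma ccont_sum n (F : 'I_n -> R -> C) : (forall i, ccont (F i)) ->
  ccont (fun t => \sum_(i < n) F i t).
Proof.
elim: n F => [|n IH] F cF.
  by rewrite (_ : (fun t => _) = fun=> 0); [exact: ccont_cst|apply/funext => t; rewrite big_ord0].
rewrite (_ : (fun t => _) = fun t => \sum_(i < n) F (widen_ord (leqnSn n) i) t - (0 - F ord_max t)).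
  by apply: ccontB; [exact: IH|apply: ccontB; [exact: ccont_cst|]].
by apply/funext => t; rewrite big_ord_recr /= sub0r opprK.
Qed.

Lemma ccont_poly p x : ccont (fun t => (p.[t / x])%:C).
Proof. exact/ccont_real/continuous_poly_scaled. Qed.

Lemma cint_poly p x : 0 < x ->
  cint (- x) x (fun t => (p.[t / x])%:C) = (x * pint p)%:C.
Proof. by move=> x0; rewrite cint_real Rintegral_poly. Qed.

Lemma exp_small (r e : R) : 0 <= r -> 0 < e ->
  exists N, forall n, (N <= n)%N -> r ^+ n / n`!%:R < e.
Proof.
move=> r0 e0; have := cvg_series_cvg_0 (is_cvg_series_exp_coeff r).
move=> /cvgrPdist_lt/(_ e e0)[N _ HN]; exists N => n /HN.
by rewrite sub0r normrN ger0_norm// exp_coeff_ge0.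
Qed.

(** The integral of the exponential against [P_n], rescaled to the interval from
    [-x] to [x].  At [x = 1] and imaginary [z] it is the Fourier transform of
    [P_n]. *)
Definition legendre_exp n x z : C :=
  cint (- x) x (fun t => ((legendre n).[t / x])%:C * expC ((t / x)%:C * z)).

(** Partial sum of the power series in [z] of [legendre_exp n 1]. *)
Definition legendre_exp_series n N z : C :=
  \sum_(k < N) z ^+ k / k`!%:R * (pint (legendre n * 'X^k) : R)%:C.

Lemma scaled_itv x t : 0 < x -> t \in `](- x), x[ -> `|t / x| <= 1.
Proof.
move=> x0; rewrite in_itv/= => /andP[xt tx].
by rewrite normrM normfV (gtr0_norm x0) ler_pdivrMr// mul1r ler_norml !ltW.
Qed.

Lemma ccont_exp_taylor N x z : ccont (fun t => exp_taylor N ((t / x)%:C * z)).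
Proof.
apply: ccont_sum => k.
rewrite (_ : (fun t => _) = fun t => (('X^k : {poly R}).[t / x])%:C * (z ^+ k / k`!%:R)).
  by apply: ccontM; [exact: ccont_poly|exact: ccont_cst].
by apply/funext => t; rewrite hornerXn exprMn -realcX mulrA.
Qed.

Lemma cint_legendre_taylor n N x z : 0 < x ->
  cint (- x) x (fun t => ((legendre n).[t / x])%:C * exp_taylor N ((t / x)%:C * z))
  = x%:C * legendre_exp_series n N z.
Proof.
move=> x0; have xx : - x < x by lra.
pose F (k : 'I_N) t : C := z ^+ k / k`!%:R * ((legendre n * 'X^k).[t / x])%:C.
have iF k : cintegrable (- x) x (F k).
  by apply/cintegrableZ/cintegrable_cont/ccont_poly.
rewrite (_ : cint _ _ _ = cint (- x) x (fun t => \sum_(k < N) F k t)); last first.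
  apply: eq_cint => t _; rewrite /exp_taylor mulr_sumr; apply: eq_bigr => k _.
  by rewrite /F hornerM hornerXn exprMn -realcX realcM; ring.
have [_ ->] := cint_sum iF.
rewrite /legendre_exp_series mulr_sumr; apply: eq_bigr => k _.
rewrite cintZ//; last exact/cintegrable_cont/ccont_poly.
by rewrite cint_poly// realcM; ring.
Qed.

(** The Taylor remainder of the exponential is integrated; [B] is the maximum of
    [P_n] on the interval, so it does not depend on [x], [z] and [N]. *)
Lemma legendre_exp_approx n : exists2 B : R, 0 <= B & forall x z N, 0 < x ->
  cmod (legendre_exp n x z - x%:C * legendre_exp_series n N z)
    <= 2 * x * (B * (cmod z ^+ N / N`!%:R * expR (cmod z))).
Proof.
have n11 : - 1 < 1 :> R by lra.
have n11' : -1 <= 1 :> R by lra.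
have cp : continuous (fun t => `|(legendre n).[t / (1 : R)]|).
  by move=> t; apply: cvg_norm; exact: continuous_poly_scaled.
have [c _ cmax] := EVT_max n11' (continuous_subspaceT cp).
exists `|(legendre n).[c / 1]| => // x z N x0.
set B := `|_|; have xx : - x < x by lra.
rewrite -cint_legendre_taylor//.
have iL (g : R -> C) : ccont g ->
    cintegrable (- x) x (fun t => ((legendre n).[t / x])%:C * g t).
  by move=> cg; apply/cintegrable_cont/ccontM => //; exact: ccont_poly.
rewrite /legendre_exp -cintB//; [|exact/iL/ccont_expC|exact/iL/ccont_exp_taylor].
pose M := B * (cmod z ^+ N / N`!%:R * expR (cmod z)).
apply: (@le_trans _ _ (\int[mu]_(t in `](- x), x[) M)%R); last first.
  rewrite Rintegral_cst//= lebesgue_measure_itv/= lte_fin xx /= opprK.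
  by rewrite le_eqVlt; apply/orP; left; apply/eqP; rewrite /M; ring.
apply: cmod_cint_le => //.
- by apply: cintegrable_cont; apply: ccontB; apply: ccontM;
    [exact: ccont_poly|exact: ccont_expC|exact: ccont_poly|exact: ccont_exp_taylor].
- exact/integrable_cont/cst_continuous.
- move=> t tx; have tx1 := scaled_itv x0 tx.
  rewrite -mulrBr cmodM cmod_real ler_pM ?cmod_ge0//.
    by have := cmax (t / x); rewrite divr1 in_itv/= -ler_norml => /(_ tx1).
  apply: le_trans (expC_taylor _ _) _.
  have czt : cmod ((t / x)%:C * z) <= cmod z.
    by rewrite cmodM cmod_real ler_piMl ?cmod_ge0.
  apply: ler_pM; rewrite ?expR_ge0 ?ler_expR ?divr_ge0 ?exprn_ge0 ?cmod_ge0//.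
  rewrite ler_pM2r ?invr_gt0 ?ltr0n ?fact_gt0//.
  by apply: lerXn2r; rewrite ?nnegrE ?cmod_ge0.
Qed.

End LegendreExponential.

(** * Spherical Bessel functions *)

Section LegendreExponentialSeries.
Context {R : realType}.
Local Notation C := R[i].
Implicit Types (x t : R) (z w : C) (n N k m : nat).

Lemma cmod_small_eq z w : (forall e : R, 0 < e -> cmod (z - w) < e) -> z = w.
Proof.
move=> H; apply/eqP; rewrite -subr_eq0 -cmod_eq0 eq_le cmod_ge0 andbT.
by apply/ler_addgt0Pr => e e0; rewrite add0r ltW// H.
Qed.

Lemma legendre_exp_limit n x z (e : R) : 0 < x -> 0 < e ->
  exists N0, forall N, (N0 <= N)%N ->
    cmod (legendre_exp n x z - x%:C * legendre_exp_series n N z) < e.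
Proof.
move=> x0 e0; have [B B0 H] := @legendre_exp_approx R n.
have e'0 : 0 < e / (2 * x * (B + 1) * expR (cmod z)).
  by rewrite divr_gt0// !mulr_gt0 ?expR_gt0// ltr_wpDl.
have [N0 HN] := exp_small (cmod_ge0 z) e'0; exists N0 => N /HN {}HN.
apply: le_lt_trans (H x z N x0) _.
have E0 := expR_gt0 (cmod z).
move: HN; set r := _ / _ => HN.
have r0 : 0 <= r by rewrite divr_ge0 ?exprn_ge0 ?cmod_ge0. clearbody r.
apply: (@le_lt_trans _ _ (2 * x * (B + 1) * expR (cmod z) * r)).
  rewrite -subr_ge0 (_ : _ - _ = 2 * x * expR (cmod z) * r); last by ring.
  by rewrite !mulr_ge0 ?(ltW x0) ?(ltW E0).
have k0 : 0 < 2 * x * (B + 1) * expR (cmod z) by rewrite !mulr_gt0// ltr_wpDl.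
by rewrite mulrC -ltr_pdivlMr.
Qed.

(** Both sides have the same power series in [z]; this replaces a change of
    variables. *)
Lemma legendre_exp_scale n x z : 0 < x ->
  legendre_exp n x z = x%:C * legendre_exp n 1 z.
Proof.
move=> x0; apply: cmod_small_eq => e e0.
have e2 : 0 < e / 2 by rewrite divr_gt0.
have [N1 H1] := legendre_exp_limit n z x0 e2.
have e2x : 0 < e / 2 / x by rewrite divr_gt0.
have [N2 H2] := legendre_exp_limit n z ltr01 e2x.
have := H1 _ (leq_maxl N1 N2); have := H2 _ (leq_maxr N1 N2).
set S := legendre_exp_series _ _ _; rewrite mul1r ltr_pdivlMr// mulrC => h2 h1.
rewrite (_ : _ - _ = (legendre_exp n x z - x%:C * S) - x%:C * (legendre_exp n 1 z - S)); last by ring.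
apply: le_lt_trans (le_cmodB _ _) _.
by rewrite [cmod (x%:C * _)]cmodM cmod_real (gtr0_norm x0); lra.
Qed.

Lemma pint_legendreX_parity n k : odd (n + k) -> pint (legendre n * 'X^k) = 0 :> R.
Proof.
move=> nk; have [kn|nk'] := ltnP k n.
  by rewrite pint_legendre_small// size_polyXn.
by apply: pint_legendreX_odd => //; rewrite oddB// addbC -oddD.
Qed.

(** Only powers of the parity of [n] occur in the power series. *)
Lemma legendre_expN n x z : 0 < x ->
  legendre_exp n x (- z) = (-1) ^+ n * legendre_exp n x z.
Proof.
move=> x0.
have SN N : legendre_exp_series n N (- z) = (-1) ^+ n * legendre_exp_series n N z.
  rewrite /legendre_exp_series mulr_sumr; apply: eq_bigr => k _.
  have [onk|enk] := boolP (odd (n + k)).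
    by rewrite pint_legendreX_parity// !mulr0.
  rewrite [(- z) ^+ k]exprNn -(signr_odd _ k) -(signr_odd _ n).
  have -> : odd k = odd n.
    by move: enk; rewrite oddD negb_add => /eqP ->.
  by ring.
apply: cmod_small_eq => e e0; have e2 : 0 < e / 2 by rewrite divr_gt0.
have [N1 H1] := legendre_exp_limit n z x0 e2.
have [N2 H2] := legendre_exp_limit n (- z) x0 e2.
have := H1 _ (leq_maxl N1 N2); have := H2 _ (leq_maxr N1 N2).
rewrite SN; set S := legendre_exp_series _ _ _ => h2 h1.
rewrite (_ : _ - _ = (legendre_exp n x (- z) - x%:C * ((-1) ^+ n * S)) -
  (-1) ^+ n * (legendre_exp n x z - x%:C * S)); last by ring.
apply: le_lt_trans (le_cmodB _ _) _.
by rewrite [cmod ((-1) ^+ n * _)]cmodM cmodX cmodN cmod1 expr1n mul1r; lra.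
Qed.

Lemma legendre_exp_series_shift n m z :
  legendre_exp_series n (n + m.*2) z =
  \sum_(k < m) z ^+ (n + k.*2) / (n + k.*2)`!%:R *
    (pint (legendre n * 'X^(n + k.*2)) : R)%:C.
Proof.
elim: m => [|m IH].
  rewrite double0 addn0 big_ord0 /legendre_exp_series big1// => k _.
  by rewrite pint_legendre_small ?mulr0// size_polyXn.
rewrite doubleS !addnS /legendre_exp_series 2!big_ord_recr /=.
rewrite (_ : \sum_(_ < _) _ = legendre_exp_series n (n + m.*2) z)//.
rewrite IH [RHS]big_ord_recr /= (pint_legendreX_parity (n := n) (k := (n + m.*2).+1)).
  by rewrite mulr0 addr0.
by rewrite addnS /= oddD oddD odd_double addbF addbb.
Qed.

End LegendreExponentialSeries.

Section SphericalBessel.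
Context {R : realType}.
Local Notation C := R[i].
Implicit Types (z w : C) (n N k m : nat) (s : R).

Definition logC z : C := ln (cmod z) +i* argC z.

Lemma expC_logC z : z != 0 -> expC (logC z) = z.
Proof.
move=> z0; have c0 : 0 < cmod z by rewrite cmod_gt0.
have zz := cmod_sqr z.
have r1 : -1 <= Re z / cmod z <= 1.
  by rewrite -ler_norml normrM normfV (gtr0_norm c0) ler_pdivrMr// mul1r Re_le_cmod.
have s1 : Num.sqrt (1 - (Re z / cmod z) ^+ 2) = `|Im z| / cmod z.
  have -> : 1 - (Re z / cmod z) ^+ 2 = (Im z / cmod z) ^+ 2.
    rewrite !expr_div_n -[1](divff (_ : cmod z ^+ 2 != 0)) ?expf_neq0 ?gt_eqF//.
    by rewrite -mulrBl {1}zz addrC addKr.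
  by rewrite sqrtr_sqr normrM normfV (gtr0_norm c0).
rewrite /expC /logC /= lnK ?posrE// /argC (negbTE z0).
apply: complex_ext; rewrite ?ReM ?ImM /= !mul0r ?subr0 ?addr0.
  by case: ifP => _; rewrite ?cosN acosK ?in_itv//= mulrC mulfVK ?gt_eqF.
case: ifP => [iz|/negbT]; first by rewrite sin_acos// s1 ger0_norm// mulrC mulfVK ?gt_eqF.
rewrite -ltNge => iz.
by rewrite sinN sin_acos// s1 ler0_norm ?ltW// mulNr opprK mulrC mulfVK ?gt_eqF.
Qed.

Lemma powCD z s1 s2 : powC z (s1 + s2) = powC z s1 * powC z s2.
Proof. by rewrite /powC realcD mulrDl expCD. Qed.

Lemma powC_nat z k : z != 0 -> powC z k%:R = z ^+ k.
Proof.
move=> z0; elim: k => [|k IH].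
  by rewrite /powC realc_nat mul0r expC0 expr0.
rewrite -addn1 natrD powCD IH addn1 exprSr; congr (_ * _).
by rewrite /powC realc_nat mul1r; exact: expC_logC.
Qed.

Lemma powC_half z s : z != 0 -> powC (z / 2) s = powC z s * (expR (- (s * ln 2)))%:C.
Proof.
move=> z0; have c0 : 0 < cmod z by rewrite cmod_gt0.
have c2 : cmod (z / 2) = cmod z / 2 by rewrite cmodM cmodV cmod_nat.
have z20 : z / 2 != 0 by rewrite mulf_neq0// invr_neq0// pnatr_eq0.
have z2E : z / 2 = (2^-1)%:C * z by rewrite mulrC realcV realc_nat.
have argE : argC (z / 2) = argC z.
  rewrite /argC (negbTE z0) (negbTE z20) c2.
  have -> : Re (z / 2) = Re z / 2 by rewrite z2E ReM /= mul0r subr0 mulrC.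
  have -> : Im (z / 2) = Im z / 2 by rewrite z2E ImM /= mul0r addr0 mulrC.
  rewrite pmulr_lge0 ?invr_gt0//; congr (if _ then acos _ else - acos _);
    by field; rewrite gt_eqF.
rewrite /powC c2 argE ln_div ?posrE//.
have -> : (expR (- (s * ln 2)))%:C = expC (- (s * ln 2))%:C.
  by rewrite /expC /= cos0 sin0; apply: complex_ext; rewrite !ReImE /= ?mulr1 ?mulr0 ?mul0r ?subr0 ?addr0.
rewrite -expCD; congr expC; apply: complex_ext; rewrite !ReImE /=; ring.
Qed.

(** The [m]-th term of the Bessel series is the term of index [n + m.*2] in the
    power series of Poisson's integral; the moments of the other orders vanish,
    by orthogonality below [n] and by parity above. *)
Lemma besselJ_term_legendre n z m : z != 0 ->
  (Num.sqrt (pi / 2%:R))%:C * powC z (- 2^-1) * besselJ_term (n%:R + 2^-1) z m =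
  (2 * 'i%C ^+ n)^-1 * (('i%C * z) ^+ (n + m.*2) / (n + m.*2)`!%:R *
    (pint (legendre n * 'X^(n + m.*2)) : R)%:C).
Proof.
move=> z0; rewrite /besselJ_term.
have -> : m%:R + (n%:R + 2^-1) + 1 = (m + n)%:R + 3 / 2 :> R by rewrite natrD; field.
rewrite GammaR_half gamma_valE powC_half//.
have -> : 2%:R * m%:R + (n%:R + 2^-1) = (n + m.*2)%:R + 2^-1 :> R.
  by rewrite natrD -mul2n natrM; ring.
set k := (n + m.*2)%N.
have -> : expR (- ((k%:R + 2^-1) * ln 2)) = (2 ^+ k * Num.sqrt 2)^-1 :> R.
  rewrite expRN mulrDl expRD; congr (_ * _)^-1.
    by rewrite -powR_mulrn// /powR pnatr_eq0.
  by rewrite -powR12_sqrt// /powR pnatr_eq0.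
rewrite pint_legendreX_even -/k.
have -> : powC z (k%:R + 2^-1) = z ^+ k * powC z (2^-1) by rewrite powCD powC_nat.
have pp : powC z (- 2^-1) * powC z 2^-1 = 1.
  by rewrite -powCD addNr -[0]/(0%:R) powC_nat// expr0.
have ik : ('i%C : C) ^+ k = 'i%C ^+ n * (-1) ^+ m.
  by rewrite /k exprD -mul2n exprM sqr_i.
have fR j : j`!%:R != 0 :> R by exact: fact_neq0.
have fC j : j`!%:R != 0 :> C by rewrite pnatr_eq0 -lt0n fact_gt0.
pose c : R := 2 ^+ n * (m + n)`!%:R / (m`!%:R * (m + n).*2.+1`!%:R).
transitivity (z ^+ k * ((-1) ^+ m * c)%:C).
  set a := Num.sqrt (pi / 2%:R); set d := (2 ^+ k * _)^-1; set g := _ / _.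
  have E : a * g * d = (-1) ^+ m * c.
    have -> : a = Num.sqrt pi / Num.sqrt 2.
      by rewrite /a sqrtrM ?pi_ge0// sqrtrV.
    have p0 : Num.sqrt (pi : R) != 0 by rewrite gt_eqF// sqrtr_gt0 pi_gt0.
    have s0 : Num.sqrt (2 : R) != 0 by rewrite gt_eqF// sqrtr_gt0.
    have s2 : Num.sqrt (2 : R) * Num.sqrt 2 = 2 by rewrite -expr2 sqr_sqrtr.
    rewrite /g /d /c /k {g d}.
    have -> : (m + n).*2.+2`!%:R = 2 * (m + n).+1%:R * (m + n).*2.+1`!%:R :> R.
      by rewrite factS natrM -doubleS -mul2n natrM.
    have -> : (m + n).+1`!%:R = (m + n).+1%:R * (m + n)`!%:R :> R by rewrite factS natrM.
    have -> : 4 ^+ (m + n).+1 = 4 * (2 ^+ m * 2 ^+ n) ^+ 2 :> R.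
      by rewrite exprS -exprD -exprM mulnC exprM (_ : 2 ^+ 2 = 4 :> R)// expr2 -natrM.
    have -> : 2 ^+ (n + m.*2) = 2 ^+ n * (2 ^+ m) ^+ 2 :> R by rewrite exprD -muln2 exprM.
    have m1 : (m + n).+1%:R != 0 :> R by rewrite pnatr_eq0.
    have t0 j : 2 ^+ j != 0 :> R by rewrite expf_neq0.
    move: (Num.sqrt (pi : R)) (Num.sqrt (2 : R)) (m`!%:R) ((m + n)`!%:R) ((m + n).*2.+1`!%:R)
      ((m + n).+1%:R) (2 ^+ n) (2 ^+ m) ((-1) ^+ m) p0 s0 s2 (fR m) (fR (m + n)%N)
      (fR (m + n).*2.+1) m1 (t0 n) (t0 m) => u v {}a {}d e {}g p r sg u0 v0 vv a0 d0 e0 g0 p0 r0.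
    set X := sg / _; transitivity (u * X / (p * r ^+ 2 * (v * v))).
      by field; rewrite v0 p0 r0.
    by rewrite vv /X; field; rewrite u0 a0 d0 e0 g0 p0 r0.
  rewrite -E; transitivity (z ^+ k * (a%:C * g%:C * d%:C) * (powC z (- 2^-1) * powC z 2^-1)).
    by ring.
  by rewrite pp mulr1 -!realcM.
rewrite exprMn ik.
have -> : 2 ^+ n.+1 * k`!%:R * (m + n)`!%:R / ((m + n).*2.+1`!%:R * m`!%:R) =
    k`!%:R * (2 * c) :> R.
  by rewrite /c exprS; field; rewrite !fR.
have sgE : ((-1) ^+ m)%:C = (-1) ^+ m :> C.
  rewrite -(signr_odd R) -(signr_odd C); case: (odd m) => //.
  by apply: complex_ext; rewrite /= ?oppr0.
transitivity (z ^+ k * ((-1) ^+ m * c%:C)); first by rewrite -sgE -realcM.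
have -> : (k`!%:R * (2 * c))%:C = k`!%:R * (2 * c%:C) :> C.
  by rewrite realcM realcM !realc_nat.
have I0 : ('i%C : C) ^+ n != 0 by rewrite expf_neq0// -cmod_gt0 cmodi ltr01.
move: (c%:C) ((-1) ^+ m : C) ('i%C ^+ n) (z ^+ k) (k`!%:R : C) (fC k) I0 => x sg I w f f0 I0.
by field; rewrite I0 f0.
Qed.

(** The partial sums of the two power series agree term by term. *)
Lemma sphbesselj_neq0 n z : z != 0 ->
  sphbesselj n z = (2 * 'i%C ^+ n)^-1 * legendre_exp n 1 ('i%C * z).
Proof.
move=> z0; rewrite /sphbesselj /cont0 (negbTE z0).
set A := _ * powC z _; have A0 : A != 0.
  apply: mulf_neq0; first by rewrite realc_neq0 gt_eqF// sqrtr_gt0 divr_gt0// pi_gt0.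
  by rewrite -cmod_gt0 /powC cmod_expC expR_gt0.
set L := RHS; suff -> : besselJ (n%:R + 2^-1) z = A^-1 * L by rewrite mulVKf.
rewrite /besselJ; apply: clim_eq; apply/ccvgP => e e0.
have I0 : 2 * ('i%C : C) ^+ n != 0.
  by rewrite mulf_neq0 ?pnatr_eq0// expf_neq0// -cmod_gt0 cmodi ltr01.
have k0 : 0 < cmod (A * (2 * 'i%C ^+ n)) by rewrite cmod_gt0 mulf_neq0.
have [N0 HN] := legendre_exp_limit n ('i%C * z) ltr01 (mulr_gt0 e0 k0).
near=> M.
have HM : (N0 <= n + M.*2)%N.
  by rewrite (leq_trans _ (leq_addl _ _))// -addnn (leq_trans _ (leq_addr _ _))//;
    near: M; exists N0.
have := HN _ HM; rewrite mul1r legendre_exp_series_shift.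
have -> : series (besselJ_term (n%:R + 2^-1) z) M = A^-1 * ((2 * 'i%C ^+ n)^-1 *
   \sum_(k < M) ('i%C * z) ^+ (n + k.*2) / (n + k.*2)`!%:R *
    (pint (legendre n * 'X^(n + k.*2)) : R)%:C).
  rewrite /series /= big_mkord; apply: (mulfI A0); rewrite mulVKf// !mulr_sumr.
  by apply: eq_bigr => k _; rewrite -besselJ_term_legendre.
rewrite /L; set S := \sum_(_ < _) _ => H.
rewrite cmodB -!mulrBr !cmodM.
rewrite -(ltr_pM2r k0); apply: le_lt_trans H.
rewrite -!cmodM le_eqVlt; apply/orP; left; apply/eqP; congr cmod.
rewrite {HN k0} -/A; move: I0; move: (2 * 'i%C ^+ n) => I I0; clearbody A; by field; rewrite A0 I0.
Unshelve. all: by end_near. Qed.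

Lemma legendre_exp_taylor_le n N : exists2 B : R, 0 <= B & forall z, cmod z <= 1 ->
  cmod (legendre_exp n 1 z - legendre_exp_series n N z) <= B * cmod z ^+ N.
Proof.
have [B B0 H] := @legendre_exp_approx R n.
exists (2 * (B * expR 1)) => [|z z1]; first by rewrite !mulr_ge0 ?expR_ge0.
have := H 1 z N ltr01; rewrite mul1r mulr1 => /le_trans; apply.
rewrite -[leRHS]mulrA ler_pM2l// -[leRHS]mulrA; apply: ler_wpM2l => //.
rewrite [leRHS]mulrC.
apply: ler_pM; rewrite ?expR_ge0 ?ler_expR//.
  by rewrite divr_ge0 ?exprn_ge0 ?cmod_ge0.
rewrite ler_pdivrMr ?ltr0n ?fact_gt0// ler_peMr ?exprn_ge0 ?cmod_ge0//.
by rewrite ler1n fact_gt0.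
Qed.

Lemma legendre_exp_series1 n z : legendre_exp_series n 1 z = (pint (legendre n : {poly R}))%:C.
Proof. by rewrite /legendre_exp_series big_ord1 expr0 mulr1 fact0 divr1 mul1r. Qed.

Lemma legendre_exp0 n : legendre_exp n 1 0 = (pint (legendre n : {poly R}))%:C.
Proof.
have [B _ HB] := legendre_exp_taylor_le n 1; have := HB 0.
rewrite cmod0 expr1 mulr0 ler01 legendre_exp_series1 => /(_ isT) H.
by apply/eqP; rewrite -subr_eq0 -cmod_eq0 eq_le H cmod_ge0.
Qed.

(** Poisson's integral.  At [z = 0] the left-hand side is a limit, and the
    right-hand side is continuous there. *)
Lemma sphbesseljE n z : sphbesselj n z = (2 * 'i%C ^+ n)^-1 * legendre_exp n 1 ('i%C * z).
Proof.
have [->|z0] := eqVneq z 0; last exact: sphbesselj_neq0.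
rewrite mulr0 /sphbesselj /cont0 eqxx; apply: clim_eq; apply/ccvgP => e e0.
have [B B0 HB] := legendre_exp_taylor_le n 1.
near=> w.
have w0 : w != 0 by near: w; exact: nbhs_dnbhs_neq.
have := sphbesselj_neq0 n w0; rewrite /sphbesselj /cont0 (negbTE w0) => ->.
rewrite -mulrBr cmodM.
rewrite legendre_exp0 -(legendre_exp_series1 n ('i%C * w)).
have w1 : cmod w < 1.
  by near: w; apply: cnbhs0_dnbhs.
have wB : cmod w < e / (cmod ((2 * 'i%C ^+ n)^-1) * B + 1).
  by near: w; apply: cnbhs0_dnbhs; rewrite divr_gt0// ltr_wpDl// mulr_ge0// cmod_ge0.
have iw : cmod ('i%C * w) = cmod w by rewrite cmodM cmodi mul1r.
have := HB ('i%C * w); rewrite iw expr1 => /(_ (ltW w1)) H.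
apply: le_lt_trans (ler_wpM2l (cmod_ge0 _) H) _.
move: wB; rewrite ltr_pdivlMr ?ltr_wpDl ?mulr_ge0 ?cmod_ge0// mulrDr mulr1.
by have := cmod_ge0 w; rewrite mulrA [_ * cmod w]mulrC; lra.
Unshelve. all: by end_near. Qed.

End SphericalBessel.

(** * The remainder of the Legendre expansion of the kernel *)

Section LegendreRemainder.
Context {R : realType}.
Local Notation mu := (@lebesgue_measure R).
Local Notation C := R[i].
Variables (K : R -> R -> C) (x : R).
Hypothesis x0 : 0 < x.
Hypothesis K2 : L2 (- x) x (K x).
Implicit Types (t : R) (z : C) (n M : nat) (g : R -> C) (p : {poly R}).

Let xx : - x < x. Proof. by rewrite -subr_gt0 opprK addr_gt0. Qed.

Definition kernel_rem M t : C := K x t - kernel_trunc K M x t.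

Lemma ccont_kernel_trunc M : ccont (kernel_trunc K M x).
Proof.
by apply: ccont_sum => n; apply: ccontM; [exact: ccont_cst|exact: ccont_poly].
Qed.

Lemma L2_kernel_rem M : L2 (- x) x (kernel_rem M).
Proof. by apply: L2B => //; apply: L2_cont => //; exact: ccont_kernel_trunc. Qed.

Lemma cint_kernel_trunc M g : ccont g ->
  cint (- x) x (fun t => kernel_trunc K M x t * g t) =
  \sum_(n < M.+1) coef_a K n x / x%:C *
    cint (- x) x (fun t => ((legendre n).[t / x])%:C * g t).
Proof.
move=> cg.
have cPg n : ccont (fun t => ((legendre n).[t / x])%:C * g t).
  by apply: ccontM => //; exact: ccont_poly.
pose F (n : 'I_M.+1) t := coef_a K n x / x%:C * (((legendre n).[t / x])%:C * g t).
have iF i : cintegrable (- x) x (F i) by apply: cintegrableZ; exact: cintegrable_cont.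
rewrite (_ : cint _ _ _ = cint (- x) x (fun t => \sum_(n < M.+1) F n t)); last first.
  by apply: eq_cint => t _; rewrite mulr_suml; apply: eq_bigr => n _; rewrite /F mulrA.
have [_ ->] := cint_sum iF.
by apply: eq_bigr => n _; rewrite cintZ//; exact: cintegrable_cont.
Qed.

Lemma cint_kernel_rem M g : ccont g ->
  cint (- x) x (fun t => kernel_rem M t * g t) =
  cint (- x) x (fun t => K x t * g t) - cint (- x) x (fun t => kernel_trunc K M x t * g t).
Proof.
move=> cg; rewrite -cintB.
- by apply: eq_cint => t _; rewrite mulrBl.
- exact: cintegrable_mul.
- by apply: cintegrable_cont; apply: ccontM => //; exact: ccont_kernel_trunc.
Qed.

Lemma kernel_rem_orth_legendre M n : (n <= M)%N ->
  cint (- x) x (fun t => kernel_rem M t * ((legendre n).[t / x])%:C) = 0.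
Proof.
move=> nM; rewrite cint_kernel_rem; last exact: ccont_poly.
rewrite cint_kernel_trunc; last exact: ccont_poly.
have PP m : cint (- x) x (fun t => ((legendre m).[t / x])%:C * ((legendre n).[t / x])%:C) =
    (x * pint (legendre m * legendre n : {poly R}))%:C.
  rewrite -cint_poly//; apply: eq_cint => t _; rewrite hornerM.
  by rewrite -realcM.
have nM' : (n < M.+1)%N by [].
rewrite (bigD1 (Ordinal nM'))//= big1 ?addr0; last first.
  move=> m mn; rewrite PP pint_legendre_orth ?mulr0//.
have x0C : x%:C != 0 :> C by rewrite realc_neq0 gt_eqF.
rewrite PP pint_legendre_sqr realcM mulrA mulfVK// /coef_a.
have n0 : n%:R + 2^-1 != 0 :> R by apply: lt0r_neq0; have := ler0n R n; lra.
rewrite mulrAC -realcM mulfV// mul1r.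
by rewrite subrr.
Qed.

(** It suffices to test against the Legendre polynomials, which span. *)
Lemma kernel_rem_orth M p : (size p <= M.+1)%N ->
  cint (- x) x (fun t => kernel_rem M t * (p.[t / x])%:C) = 0.
Proof.
apply: (@legendre_ind R (fun p => cint (- x) x (fun t => kernel_rem M t * (p.[t / x])%:C) = 0)).
- rewrite (_ : cint _ _ _ = cint (- x) x (fun=> 0)); first exact: cint0.
  by apply: eq_cint => t _; rewrite horner0 mulr0.
- move=> c p1 p2 H1 H2.
  have i1 q : cintegrable (- x) x (fun t => kernel_rem M t * (q.[t / x])%:C).
    by apply: cintegrable_mul => //; [exact: L2_kernel_rem|exact: ccont_poly].
  rewrite (_ : cint _ _ _ = cint (- x) x (fun t => c%:C * (kernel_rem M t * (p1.[t / x])%:C)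
      + kernel_rem M t * (p2.[t / x])%:C)).
    rewrite cintD//; last exact: cintegrableZ.
    by rewrite cintZ// H1 H2 mulr0 addr0.
  apply: eq_cint => t _; rewrite hornerD hornerZ.
  by rewrite (realcD (c * _)) realcM; ring.
- by move=> n nM; exact: kernel_rem_orth_legendre.
Qed.

Lemma kernel_rem_exp_taylor M z :
  cint (- x) x (fun t => kernel_rem M t * exp_taylor M.+1 ((t / x)%:C * z)) = 0.
Proof.
pose F (k : 'I_M.+1) t : C := z ^+ k / k`!%:R * (kernel_rem M t * (('X^k : {poly R}).[t / x])%:C).
have i1 (k : 'I_M.+1) : cintegrable (- x) x (fun t => kernel_rem M t * (('X^k : {poly R}).[t / x])%:C).
  by apply: cintegrable_mul => //; [exact: L2_kernel_rem|exact: ccont_poly].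
rewrite (_ : cint _ _ _ = cint (- x) x (fun t => \sum_(k < M.+1) F k t)); last first.
  apply: eq_cint => t _; rewrite /exp_taylor mulr_sumr; apply: eq_bigr => k _.
  by rewrite /F hornerXn exprMn -realcX; ring.
have [|_ ->] := @cint_sum R (- x) x M.+1 F.
  by move=> k; exact: cintegrableZ.
rewrite big1// => k _; rewrite cintZ//.
by rewrite kernel_rem_orth ?mulr0// size_polyXn.
Qed.

(** Bessel's inequality: the remainder is orthogonal to the truncation, hence
    their squared norms add up to that of [K x]. *)
Lemma normL2_kernel_rem M : normL2 (- x) x (kernel_rem M) <= normL2 (- x) x (K x).
Proof.
have [_ _ iK] := K2; have [_ _ iD] := L2_kernel_rem M.
have cT : ccont (fun t => (kernel_trunc K M x t)^*%C).
  by apply: ccontJ; exact: ccont_kernel_trunc.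
have DT : cint (- x) x (fun t => kernel_rem M t * (kernel_trunc K M x t)^*%C) = 0.
  pose F (n : 'I_M.+1) t : C :=
    (coef_a K n x / x%:C)^*%C * (kernel_rem M t * ((legendre n).[t / x])%:C).
  have i1 n : cintegrable (- x) x (fun t => kernel_rem M t * ((legendre n).[t / x])%:C).
    by apply: cintegrable_mul => //; [exact: L2_kernel_rem|exact: ccont_poly].
  rewrite (_ : cint _ _ _ = cint (- x) x (fun t => \sum_(n < M.+1) F n t)); last first.
    apply: eq_cint => t _; rewrite /kernel_trunc rmorph_sum mulr_sumr; apply: eq_bigr => n _.
    have cJ (c : C) (r : R) : (c * r%:C)^*%C = c^*%C * r%:C.
      by case: c => c1 c2; apply: complex_ext; rewrite /= ?mulr0 ?mul0r ?subr0 ?addr0 ?add0r ?mulNr.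
    rewrite (_ : kernel_rem M t * _ = kernel_rem M t * ((coef_a K n x / x%:C)^*%C *
      ((legendre n).[t / x])%:C)); last by congr (_ * _); exact: cJ.
    by rewrite /F; ring.
  have [|_ ->] := @cint_sum R (- x) x M.+1 F.
    by move=> k; exact: cintegrableZ.
  rewrite big1// => n _; rewrite cintZ//.
  by rewrite kernel_rem_orth_legendre ?mulr0// -ltnS.
have [iDT _] : cintegrable (- x) x (fun t => kernel_rem M t * (kernel_trunc K M x t)^*%C).
  by apply: cintegrable_mul => //; exact: L2_kernel_rem.
rewrite /normL2 ler_sqrt; last by apply: Rintegral_ge0 => t _; exact: sqr_ge0.
have E0 : (\int[mu]_(t in `](- x), x[) Re (kernel_rem M t * (kernel_trunc K M x t)^*%C))%R = 0.
  by move/(congr1 (@complex.Re R)): DT.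
have -> : (\int[mu]_(t in `](- x), x[) (cmod (kernel_rem M t) ^+ 2))%R =
    (\int[mu]_(t in `](- x), x[) (cmod (kernel_rem M t) ^+ 2 +
       2 * Re (kernel_rem M t * (kernel_trunc K M x t)^*%C)))%R.
  rewrite RintegralD//; last exact: rintegrableZ.
  by rewrite RintegralZl// E0 mulr0 addr0.
apply: le_Rintegral => //; first exact/rintegrableD/rintegrableZ.
move=> t _.
have -> : K x t = kernel_rem M t + kernel_trunc K M x t by rewrite subrK.
move: (kernel_rem M t) (kernel_trunc K M x t) => [a1 a2] [b1 b2].
by rewrite !cmod_sqr /=; have := sqr_ge0 b1; have := sqr_ge0 b2; rewrite !expr2; nra.
Qed.

(** At [z = 'i * rho * x] these are the Fourier integrals of the remainder and of
    the kernel. *)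
Definition rem_exp M z : C :=
  cint (- x) x (fun t => kernel_rem M t * expC ((t / x)%:C * z)).

Definition kernel_exp z : C := cint (- x) x (fun t => K x t * expC ((t / x)%:C * z)).

Lemma rem_expE M z : rem_exp M z =
  kernel_exp z - \sum_(n < M.+1) coef_a K n x * legendre_exp n 1 z.
Proof.
have cE := ccont_expC z x.
rewrite /rem_exp (cint_kernel_rem M cE) (cint_kernel_trunc M cE); congr (_ - _).
apply: eq_bigr => n _; rewrite -/(legendre_exp n x z) legendre_exp_scale// mulrA mulfVK//.
by rewrite realc_neq0 gt_eqF.
Qed.

Lemma normL2_le_sup g (B : R) : ccont g -> 0 <= B ->
  (forall t, t \in `](- x), x[ -> cmod (g t) <= B) ->
  normL2 (- x) x g <= Num.sqrt (2 * x) * B.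
Proof.
move=> cg B0 gB; have [_ _ ig] := L2_cont xx cg.
rewrite -[in leRHS](ger0_norm B0) -sqrtr_sqr -sqrtrM; last by rewrite mulr_ge0// ltW.
rewrite /normL2 ler_sqrt ?mulr_ge0 ?sqr_ge0 ?(ltW x0)//.
apply: (@le_trans _ _ (\int[mu]_(t in `](- x), x[) (B ^+ 2))%R).
  apply: le_Rintegral => //; first exact/integrable_cont/cst_continuous.
  by move=> t /= tx; apply: lerXn2r; rewrite ?nnegrE ?cmod_ge0 ?gB.
rewrite Rintegral_cst//= lebesgue_measure_itv/= lte_fin xx /= opprK.
by rewrite le_eqVlt; apply/orP; left; apply/eqP; ring.
Qed.

(** The Taylor polynomial of degree [M] of the exponential is subtracted for free,
    the remainder being orthogonal to it; then Cauchy-Schwarz and Bessel's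
    inequality. *)
Lemma rem_exp_le M z : cmod (rem_exp M z) <=
  normL2 (- x) x (K x) * Num.sqrt (2 * x) *
    (cmod z ^+ M.+1 / M.+1`!%:R * expR (cmod z)).
Proof.
pose g t := expC ((t / x)%:C * z) - exp_taylor M.+1 ((t / x)%:C * z).
have cg : ccont g by apply: ccontB; [exact: ccont_expC|exact: ccont_exp_taylor].
have -> : rem_exp M z = cint (- x) x (fun t => kernel_rem M t * g t).
  rewrite -[LHS]subr0 -(kernel_rem_exp_taylor M z) /rem_exp -cintB.
  - by apply: eq_cint => t _; rewrite mulrBr.
  - by apply: cintegrable_mul => //; [exact: L2_kernel_rem|exact: ccont_expC].
  - by apply: cintegrable_mul => //; [exact: L2_kernel_rem|exact: ccont_exp_taylor].
apply: le_trans (cint_cauchy_schwarz xx (L2_kernel_rem M) cg) _.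
rewrite -[leRHS]mulrA.
apply: ler_pM; [exact: sqrtr_ge0|exact: sqrtr_ge0|exact: normL2_kernel_rem|].
apply: normL2_le_sup => //; first by rewrite !mulr_ge0 ?expR_ge0 ?exprn_ge0 ?cmod_ge0.
move=> t tx; have tx1 := scaled_itv x0 tx.
apply: le_trans (expC_taylor _ _) _.
have czt : cmod ((t / x)%:C * z) <= cmod z.
  by rewrite cmodM cmod_real ler_piMl ?cmod_ge0.
apply: ler_pM; rewrite ?expR_ge0 ?ler_expR ?divr_ge0 ?exprn_ge0 ?cmod_ge0//.
rewrite ler_pM2r ?invr_gt0 ?ltr0n ?fact_gt0//.
by apply: lerXn2r; rewrite ?nnegrE ?cmod_ge0.
Qed.

(** The difference of the two sides is
    [(exp S - exp s) * (1 - exp (- S - s))], a product of nonnegative factors. *)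
Lemma cosh_mono (s S : R) : `|s| <= S -> expR s + expR (- s) <= expR S + expR (- S).
Proof.
move=> sS; have s1 : s <= S := le_trans (ler_norm s) sS.
have s2 : - s <= S by rewrite (le_trans (ler_norm _))// normrN.
have : 0 <= (expR S - expR s) * (1 - expR (- S - s)).
  by rewrite mulr_ge0// subr_ge0 ?ler_expR// -expR0 ler_expR; lra.
rewrite mulrBr mulr1 mulrBl -!expRD (_ : S + (- S - s) = - s); last by ring.
by rewrite (_ : s + (- S - s) = - S); [lra|ring].
Qed.

(** In the strip of half-width [L], the square of a trigonometric function is
    dominated by [cosh (2 L t)], whose integral is [sinh (2 L x) / L]. *)
Lemma normL2_strip g (L : R) : 0 < L -> ccont g ->
  (forall t, exists2 y : R, `|y| <= L * `|t| & cmod (g t) <= (expR y + expR (- y)) / 2) ->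
  normL2 (- x) x g <= Num.sqrt (sinhR (2 * x * L) / L).
Proof.
move=> L0 cg gy; have [_ _ ig] := L2_cont xx cg.
pose F t := sinhR (2 * L * t) / (2 * L).
pose F' t := (expR (2 * L * t) + expR (- (2 * L * t))) / 2.
have dl (c t : R) : is_derive t (1 : R) (fun s => c * s) c.
  by apply: (is_derive_eq (is_derive1Z c (is_derive_id t (1 : R)))); rewrite mulr1.
have dE (c t : R) : is_derive t (1 : R) (fun s => expR (c * s)) (expR (c * t) * c).
  exact: (is_derive1_compose (is_derive_expR _) (dl c t)).
have dF t : is_derive t (1 : R) F (F' t).
  have -> : F = fun s => (4 * L)^-1 * (expR (2 * L * s) - expR (- (2 * L) * s)).
    by apply/funext => s; rewrite /F /sinhR mulNr; field; rewrite gt_eqF.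
  apply: (is_derive_eq (is_derive1Z _ (is_derive1B (dE (2 * L) t) (dE (- (2 * L)) t)))).
  by rewrite /F' mulNr; field; rewrite gt_eqF.
have cF' : continuous F'.
  move=> t; apply: cvgM; last exact: cvg_cst.
  have cE (c : R) : continuous (fun s : R => expR (c * s)).
    by move=> s; apply/differentiable_continuous/derivable1_diffP; have [] := dE c s.
  apply: cvgD; first exact: cE.
  have cN : continuous (fun s : R => expR (- (2 * L * s))).
    rewrite (_ : (fun s => _) = fun s : R => expR (- (2 * L) * s)); first exact: cE.
    by apply/funext => s; rewrite mulNr.
  exact: cN.
have IF : (\int[mu]_(t in `](- x), x[) F' t)%R = sinhR (2 * x * L) / L.
  rewrite (Rintegral_derive xx dF cF') /F /sinhR !mulrN opprK.
  by rewrite (_ : 2 * L * x = 2 * x * L); [field; rewrite gt_eqF|ring].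
rewrite -IF /normL2 ler_sqrt; last first.
  by apply: Rintegral_ge0 => t _; rewrite divr_ge0 ?addr_ge0 ?expR_ge0.
apply: le_Rintegral => //; first exact: integrable_cont.
move=> t _; have [y yt gty] := gy t.
have y2 : `|2 * y| <= 2 * L * `|t|.
  by rewrite normrM ger0_norm// -mulrA ler_pM2l.
have := cosh_mono y2.
have -> : expR (2 * L * `|t|) + expR (- (2 * L * `|t|)) =
    expR (2 * L * t) + expR (- (2 * L * t)).
  have [t0|t0] := leP 0 t; first by rewrite ger0_norm.
  by rewrite ltr0_norm// mulrN opprK addrC.
rewrite (_ : 2 * y = y + y) ?opprD ?expRD; last by ring.
rewrite /F'; have := gty; have := cmod_ge0 (g t).
have := sqr_ge0 (expR y - expR (- y)); rewrite !expr2.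
move: (cmod (g t)) (expR y) (expR (- y)) => c1 e1 e2 H1 H2 H3 H4.
have : c1 * c1 <= (e1 + e2) / 2 * ((e1 + e2) / 2) by rewrite ler_pM.
by move: H1 H4; lra.
Qed.

End LegendreRemainder.

(** * The Neumann series *)

Section UniformConvergence.
Context {R : realType}.
Local Notation C := R[i].

Lemma cuniform_cvg (A : set R[i]^o) (F : nat -> R[i]^o -> R[i]^o) (g : R[i]^o -> R[i]^o) :
  (forall e : R, 0 < e -> exists N, forall M, (N <= M)%N ->
     forall rho, A rho -> cmod (F M rho - g rho) < e) ->
  {uniform A, F @ \oo --> g}.
Proof.
move=> H U /uniform_nbhs[E [+ EU]].
rewrite -entourage_from_ballE => -[eps eps0 ballE].
have [im_eps re_eps] : Im eps = 0 /\ 0 < Re eps.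
  by move: eps0; rewrite /= ltcE => /andP[/eqP].
have epsE : eps = (Re eps)%:C by apply: complex_ext.
have [N HN] := H _ re_eps.
exists N => //= M /= NM; apply: EU => rho Arho; apply: ballE.
by rewrite /= /ball/= epsE normC_cmod ltcR cmodB; exact: HN.
Qed.

Lemma ccompact_bounded (A : set R[i]^o) : compact A ->
  exists2 B : R, 0 <= B & forall z, A z -> cmod z <= B.
Proof.
move=> cA; have cc : continuous (fun z : R[i]^o => cmod z).
  move=> z; have FF : Filter (nbhs (z : C^o)) := nbhs_filter (z : C^o).
  apply/(@cvgrPdist_lt R R C^o (nbhs (z : C^o)) FF) => e e0; apply/nbhs_ballP.
  exists e%:C => /=; first by rewrite ltcR.
  move=> w; rewrite /ball/= normC_cmod ltcR; apply: le_lt_trans.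
  rewrite ler_norml; apply/andP; split.
    by have := le_cmodD (w - z) z; rewrite subrK (cmodB w z); lra.
  by have := le_cmodD (z - w) w; rewrite subrK; lra.
have : compact [set cmod z | z in A].
  by apply: continuous_compact => //; exact: continuous_subspaceT.
move=> /compact_bounded[B [Br HB]]; exists (`|B| + 1) => [|z Az].
  by rewrite addr_ge0.
have := HB (`|B| + 1); rewrite ltr_pwDr ?ler_norm// => /(_ isT (cmod z)) /=.
by rewrite ger0_norm ?cmod_ge0//; apply; exists z.
Qed.

End UniformConvergence.

Section ParityOfSums.
Context {R : realType}.
Implicit Types (E : nat -> R[i]) (M : nat).

(** The Neumann series run over the indices of one parity, the truncated Legendre
    expansion over all of them. *)
Lemma sum_even E M : \sum_(n < M.+1) E n.*2 =
  (\sum_(n < M.*2.+1) E n + \sum_(n < M.*2.+1) (-1) ^+ n * E n) / 2%:R.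
Proof.
elim: M => [|M IH]; first by rewrite !big_ord1 /= expr0 mul1r double0; move: (E _) => a; field.
rewrite big_ord_recr /= IH doubleS 2![in RHS]big_ord_recr /=.
have -> : \sum_(n < M.*2.+3) (-1) ^+ n * E n =
    \sum_(n < M.*2.+1) (-1) ^+ n * E n - E M.*2.+1 + E M.*2.+2.
  rewrite 2!big_ord_recr /= -(signr_odd _ M.*2.+1) -(signr_odd _ M.*2.+2) /=.
  by rewrite odd_double expr1 expr0 mulN1r mul1r.
move: (\sum_(_ < _) _) (\sum_(_ < _) _) (E _) (E _) => S1 S2 a c.
by field.
Qed.

Lemma sum_odd E M : \sum_(n < M.+1) E n.*2.+1 =
  (\sum_(n < M.*2.+2) E n - \sum_(n < M.*2.+2) (-1) ^+ n * E n) / 2%:R.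
Proof.
have two n : \sum_(k < n.*2.+2) (-1) ^+ k * E k =
    \sum_(k < n.*2) (-1) ^+ k * E k + E n.*2 - E n.*2.+1.
  rewrite 2!big_ord_recr /= -(signr_odd _ n.*2.+1) -(signr_odd _ n.*2) /=.
  by rewrite odd_double expr1 expr0 mulN1r mul1r.
elim: M => [|M IH].
  rewrite two 2![in RHS]big_ord_recr /= !big_ord0 big_ord1 /=.
  by move: (E _) (E _) => a c; field.
rewrite big_ord_recr /= IH (two M.+1) doubleS 2![in RHS]big_ord_recr /=.
move: (\sum_(_ < _) _) (\sum_(_ < _) _) (E _) (E _) => S1 S2 a c.
by field.
Qed.

End ParityOfSums.

Section Assembly.
Context {R : realType}.
Local Notation C := R[i].
Variables (b : R) (q : R -> C) (N : nat) (x_ : nat -> R) (alpha : nat -> C) (h : C).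
Variables (e : C -> R -> C) (K : R -> R -> C) (c s : C -> R -> C).
Hypothesis x00 : x_ 0%N = 0.
Hypothesis xN : x_ N.+1 = b.
Hypothesis x_lt : forall k, (k <= N)%N -> x_ k < x_ k.+1.
Hypothesis e_sol : forall rho,
  cauchy_solution b q N x_ alpha (rho ^+ 2) 1 ('i%C * rho + h) (e rho).
Hypothesis K_kernel : transmutation_kernel b e K.
Hypothesis c_sol : forall rho, cauchy_solution b q N x_ alpha (rho ^+ 2) 1 h (c rho).
Hypothesis s_sol : forall rho, cauchy_solution b q N x_ alpha (rho ^+ 2) 0 1 (s rho).

Let b_ge0 : 0 <= b. Proof. by rewrite -xN; apply: x_ge0 x00 x_lt _ _. Qed.

(** Uniqueness of the Cauchy problem is the case [lambda = lambda0] of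
    [cauchy_solution_expand], where the error term vanishes. *)
Lemma exponential_solution rho x : 0 < x -> x <= b ->
  e rho x = c rho x + 'i%C * rho * s rho x.
Proof.
move=> x0 xb.
have [B B0 HB] := cauchy_solution_expand x00 xN x_lt (c_sol rho) (s_sol rho).
have [ace _ _] := cauchy_solutionP x00 xN x_lt (e_sol rho).
have [M M0 HM] := ac_bounded b_ge0 ace.
have := HB _ _ _ _ M (e_sol rho) M0 HM x x0 xb.
rewrite subrr cmod0 mulr0 mul0r => H; apply/eqP; rewrite -subr_eq0 -cmod_eq0.
rewrite eq_le cmod_ge0 andbT; move: H.
by rewrite !mul1r addrK.
Qed.

Lemma exponential_solutionN rho x : 0 < x -> x <= b ->
  e (- rho) x = c rho x - 'i%C * rho * s rho x.
Proof.
move=> x0 xb.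
have [B B0 HB] := cauchy_solution_expand x00 xN x_lt (c_sol rho) (s_sol rho).
have [ace _ _] := cauchy_solutionP x00 xN x_lt (e_sol (- rho)).
have [M M0 HM] := ac_bounded b_ge0 ace.
have := HB _ _ _ _ M (e_sol (- rho)) M0 HM x x0 xb.
rewrite sqrrN subrr cmod0 mulr0 mul0r => H; apply/eqP; rewrite -subr_eq0 -cmod_eq0.
rewrite eq_le cmod_ge0 andbT; move: H.
by rewrite !mul1r addrK mulrN mulNr.
Qed.

(** Continuity of the sine-type solution at [rho = 0]; the bound on [s rho] on
    the whole interval absorbs itself since it comes with the small factor
    [rho ^+ 2]. *)
Lemma s_cvg0 x : 0 < x -> x <= b ->
  (fun r => s r x : C^o) @ (0 : C^o)^' --> (s 0 x : C^o).
Proof.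
move=> x0 xb.
have [B B0 HB] := cauchy_solution_expand x00 xN x_lt (c_sol 0) (s_sol 0).
have [acs0 _ _] := cauchy_solutionP x00 xN x_lt (s_sol 0).
have [S S0 HS] := ac_bounded b_ge0 acs0.
apply/ccvgP => eps eps0.
near=> r.
have r1 : cmod r < 1 by near: r; exact: cnbhs0_dnbhs.
have rB : cmod r < (2 * (B + 1))^-1.
  by near: r; apply: cnbhs0_dnbhs; rewrite invr_gt0 mulr_gt0// ltr_wpDl.
have rS : cmod r < eps / (2 * B * S + 1).
  by near: r; apply: cnbhs0_dnbhs; rewrite divr_gt0// ltr_wpDl// !mulr_ge0.
have r0 := cmod_ge0 r.
have r2 : cmod (r ^+ 2 - 0 ^+ 2) <= cmod r.
  by rewrite expr0n subr0 cmodX expr2 ler_piMl// ltW.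
have [acs s00 _] := cauchy_solutionP x00 xN x_lt (s_sol r).
have [t0 /andP[t00 t0b] tmax] := ac_max b_ge0 acs.
(* With [M] the maximum of [s r], the distance to [s 0] is at most
   [B * cmod r * M], which is at most [M / 2], whence [M <= 2 * S]. *)
set M := cmod (s r t0); have M0 : 0 <= M := cmod_ge0 _.
have Hs t : 0 < t -> t <= b -> cmod (s r t - s 0 t) <= B * cmod r * M.
  move=> tp tb; have := HB _ _ _ _ M (s_sol r) M0 tmax t tp tb.
  rewrite !mul0r subr0 add0r mul1r => /le_trans; apply.
  by rewrite ler_wpM2r// ler_wpM2l.
have M2S : M <= 2 * S.
  have [t00'|tn0] := eqVneq t0 0.
    by rewrite /M t00' s00 cmod0 mulr_ge0.
  have tp : 0 < t0 by rewrite lt_def tn0.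
  have h1 := Hs _ tp t0b; have h2 : cmod (s 0 t0) <= S by apply: HS; rewrite t00.
  have h3 : M <= cmod (s r t0 - s 0 t0) + cmod (s 0 t0).
    by have := le_cmodD (s r t0 - s 0 t0) (s 0 t0); rewrite subrK.
  have h4 : B * cmod r <= 1 / 2.
    move: rB; rewrite -[X in _ < X]mul1r ltr_pdivlMr ?mulr_gt0 ?ltr_wpDl// => h4.
    by nra.
  have : B * cmod r * M <= 1 / 2 * M by rewrite ler_wpM2r.
  by lra.
apply: le_lt_trans (Hs x x0 xb) _.
move: rS; rewrite ltr_pdivlMr ?ltr_wpDl ?mulr_ge0// => rS.
apply: le_lt_trans rS.
have : B * cmod r * M <= B * cmod r * (2 * S) by rewrite ler_wpM2l// mulr_ge0.
by nra.
Unshelve. all: by end_near. Qed.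

Section AtPoint.
Variable x : R.
Hypothesis x0 : 0 < x.
Hypothesis xb : x <= b.
Implicit Types (rho : C) (M : nat).

Let K2 : L2 (- x) x (K x). Proof. by have [] := K_kernel x0 xb. Qed.

Lemma e_kernel rho : e rho x = expC ('i%C * (rho * x%:C)) + kernel_exp K x ('i%C * (rho * x%:C)).
Proof.
have [_ ->] := K_kernel x0 xb; rewrite mulrA; congr (_ + _); apply: eq_cint => t _.
congr (_ * expC _); have xC : x%:C != 0 :> C by rewrite realc_neq0 gt_eqF.
by rewrite realcM realcV; field.
Qed.

Lemma c_kernel rho (z := 'i%C * (rho * x%:C)) :
  c rho x = cosC (rho * x%:C) + (kernel_exp K x z + kernel_exp K x (- z)) / 2%:R.
Proof.
have h1 := exponential_solution rho x0 xb; have h2 := exponential_solutionN rho x0 xb.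
have -> : c rho x = (e rho x + e (- rho) x) / 2%:R by rewrite h1 h2; field.
rewrite !e_kernel /cosC mulNr mulrN -/z.
move: (expC z) (expC (- z)) (kernel_exp K x z) (kernel_exp K x (- z)) => a1 a2 a3 a4.
by field.
Qed.

Lemma s_kernel rho (z := 'i%C * (rho * x%:C)) :
  rho * s rho x = sinC (rho * x%:C) + (kernel_exp K x z - kernel_exp K x (- z)) / (2%:R * 'i%C).
Proof.
have h1 := exponential_solution rho x0 xb; have h2 := exponential_solutionN rho x0 xb.
have i0 : ('i%C : C) != 0 by rewrite -cmod_gt0 cmodi ltr01.
have -> : rho * s rho x = (e rho x - e (- rho) x) / (2%:R * 'i%C).
  by rewrite h1 h2; field.
rewrite !e_kernel /sinC mulNr mulrN -/z.
move: (expC z) (expC (- z)) (kernel_exp K x z) (kernel_exp K x (- z)) => a1 a2 a3 a4.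
by move: 'i%C i0 => I i0; field.
Qed.

Definition exp_sum M (z : C) : C := \sum_(n < M.+1) coef_a K n x * legendre_exp n 1 z.

Lemma c_term_sum M rho (z := 'i%C * (rho * x%:C)) :
  \sum_(n < M.+1) c_term K rho x n = (exp_sum M.*2 z + exp_sum M.*2 (- z)) / 2%:R.
Proof.
have tE n : c_term K rho x n = coef_a K n.*2 x * legendre_exp n.*2 1 z.
  rewrite /c_term /coef_g sphbesseljE -/z.
  have -> : ('i%C : C) ^+ n.*2 = (-1) ^+ n by rewrite -mul2n exprM sqr_i.
  have s0 : (-1) ^+ n != 0 :> C by rewrite signr_eq0.
  by field.
pose E n := coef_a K n x * legendre_exp n 1 z.
transitivity (\sum_(n < M.+1) E n.*2); first by apply: eq_bigr => n _; exact: tE.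
rewrite sum_even; congr ((_ + _) / _).
by apply: eq_bigr => n _; rewrite /E legendre_expN// mulrCA.
Qed.

Lemma s_term_sum M rho (z := 'i%C * (rho * x%:C)) :
  \sum_(n < M.+1) s_term K rho x n =
  (exp_sum M.*2.+1 z - exp_sum M.*2.+1 (- z)) / (2%:R * 'i%C).
Proof.
have i0 : ('i%C : C) != 0 by rewrite -cmod_gt0 cmodi ltr01.
have tE n : s_term K rho x n = coef_a K n.*2.+1 x * legendre_exp n.*2.+1 1 z / 'i%C.
  rewrite /s_term /coef_s sphbesseljE -/z.
  have -> : ('i%C : C) ^+ n.*2.+1 = 'i%C * (-1) ^+ n by rewrite exprS -mul2n exprM sqr_i.
  have s0 : (-1) ^+ n != 0 :> C by rewrite signr_eq0.
  by field; rewrite s0 i0.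
pose E n := coef_a K n x * legendre_exp n 1 z.
transitivity ((\sum_(n < M.+1) E n.*2.+1) / 'i%C).
  by rewrite mulr_suml; apply: eq_bigr => n _; exact: tE.
rewrite sum_odd invfM mulrA.
congr ((_ - _) / _ / _).
by apply: eq_bigr => n _; rewrite /E legendre_expN// mulrCA.
Qed.

Lemma c_remainder M rho (z := 'i%C * (rho * x%:C)) :
  c rho x - c_trunc K M rho x = (rem_exp K x M.*2 z + rem_exp K x M.*2 (- z)) / 2%:R.
Proof.
rewrite c_kernel /c_trunc c_term_sum -/z !rem_expE// -!/(exp_sum _ _).
move: (cosC _) (kernel_exp K x z) (kernel_exp K x (- z)) (exp_sum _ z) (exp_sum _ (- z)).
by move=> a0 a1 a2 a3 a4; field.
Qed.

Lemma s_remainder M rho (z := 'i%C * (rho * x%:C)) :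
  rho * s rho x - (sinC (rho * x%:C) + \sum_(n < M.+1) s_term K rho x n) =
  (rem_exp K x M.*2.+1 z - rem_exp K x M.*2.+1 (- z)) / (2%:R * 'i%C).
Proof.
have i0 : ('i%C : C) != 0 by rewrite -cmod_gt0 cmodi ltr01.
rewrite s_kernel s_term_sum -/z !rem_expE// -!/(exp_sum _ _).
move: (sinC _) (kernel_exp K x z) (kernel_exp K x (- z)) (exp_sum _ z) (exp_sum _ (- z)).
by move: 'i%C i0 => I i0 a0 a1 a2 a3 a4; field.
Qed.

Definition kernel_bound : R := normL2 (- x) x (K x) * Num.sqrt (2 * x).
Local Notation k := kernel_bound.

Let k0 : 0 <= k. Proof. by rewrite mulr_ge0 ?sqrtr_ge0. Qed.

(** The bound of [expC_taylor]. *)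
Definition taylor_rem (r : R) n : R := r ^+ n / n`!%:R * expR r.

Lemma taylor_rem_ge0 (r : R) n : 0 <= r -> 0 <= taylor_rem r n.
Proof. by move=> r0; rewrite mulr_ge0 ?expR_ge0// divr_ge0// exprn_ge0. Qed.

Lemma taylor_remS (r : R) n : taylor_rem r n.+1 = r / n.+1%:R * taylor_rem r n.
Proof.
rewrite /taylor_rem exprS factS natrM.
have n0 : n.+1%:R != 0 :> R by rewrite pnatr_eq0.
move: (r ^+ n) (n`!%:R) (n.+1%:R) n0 (fact_neq0 (R := R) n) => p f m m0 f0.
by field; rewrite m0 f0.
Qed.

Lemma rem_exp_le_rho M rho :
  cmod (rem_exp K x M ('i%C * (rho * x%:C))) <= k * taylor_rem (cmod rho * x) M.+1 /\
  cmod (rem_exp K x M (- ('i%C * (rho * x%:C)))) <= k * taylor_rem (cmod rho * x) M.+1.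
Proof.
have zE : cmod ('i%C * (rho * x%:C)) = cmod rho * x.
  by rewrite !cmodM cmodi mul1r cmod_real gtr0_norm.
by split; (apply: le_trans (rem_exp_le x0 K2 M _) _); rewrite ?cmodN zE.
Qed.

Lemma c_trunc_le M rho :
  cmod (c rho x - c_trunc K M rho x) <= k * taylor_rem (cmod rho * x) M.*2.+1.
Proof.
have [h1 h2] := rem_exp_le_rho M.*2 rho.
rewrite c_remainder cmodM cmodV cmod_nat ler_pdivrMr//.
by apply: le_trans (le_cmodD _ _) _; rewrite mulr_natr mulr2n lerD.
Qed.

Lemma s_trunc_le_mul M rho :
  cmod (rho * s rho x - (sinC (rho * x%:C) + \sum_(n < M.+1) s_term K rho x n))
    <= k * taylor_rem (cmod rho * x) M.*2.+2.
Proof.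
have [h1 h2] := rem_exp_le_rho M.*2.+1 rho.
rewrite s_remainder cmodM cmodV cmodM cmod_nat cmodi mulr1 ler_pdivrMr//.
by apply: le_trans (le_cmodB _ _) _; rewrite mulr_natr mulr2n lerD.
Qed.

Lemma s_trunc_neq0 M rho : rho != 0 ->
  s_trunc K M rho x = rho^-1 * (sinC (rho * x%:C) + \sum_(n < M.+1) s_term K rho x n).
Proof. by move=> r0; rewrite /s_trunc /cont0 (negbTE r0) mulrDr [_ / rho]mulrC. Qed.

(** The division by [rho] is paid for by one power of [cmod rho * x]. *)
Lemma s_trunc_le_neq0 M rho : rho != 0 ->
  cmod (s rho x - s_trunc K M rho x) <= k * x * taylor_rem (cmod rho * x) M.*2.+1.
Proof.
move=> r0; have cr0 : 0 < cmod rho by rewrite cmod_gt0.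
have -> : s rho x - s_trunc K M rho x =
    rho^-1 * (rho * s rho x - (sinC (rho * x%:C) + \sum_(n < M.+1) s_term K rho x n)).
  by rewrite s_trunc_neq0// mulrBr mulKf.
rewrite cmodM cmodV mulrC ler_pdivrMr//; apply: le_trans (s_trunc_le_mul M rho) _.
rewrite -[leRHS]mulrA -[leRHS]mulrA; apply: ler_wpM2l => //; rewrite taylor_remS.
have rx0 : 0 <= cmod rho * x by rewrite mulr_ge0 ?cmod_ge0// ltW.
have p0 := taylor_rem_ge0 M.*2.+1 rx0.
rewrite (_ : x * _ = cmod rho * x * taylor_rem (cmod rho * x) M.*2.+1); last by ring.
apply: ler_wpM2r => //; rewrite ler_pdivrMr ?ltr0n//.
by apply: ler_peMr => //; rewrite ler1n.
Qed.

(** At [rho = 0] the truncated series is exact, because the remainder is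
    orthogonal to the linear functions. *)
Lemma s_trunc0 M : s_trunc K M 0 x = s 0 x.
Proof.
rewrite /s_trunc /cont0 eqxx; apply: clim_eq; apply/ccvgP => eps eps0.
have /ccvgP s0 := s_cvg0 x0 xb.
have kx : 0 <= k * x * x * expR 1.
  exact: mulr_ge0 (mulr_ge0 (mulr_ge0 k0 (ltW x0)) (ltW x0)) (expR_ge0 1).
have e2 : 0 < eps / 2 by rewrite divr_gt0.
near=> w.
have w0 : w != 0 by near: w; exact: nbhs_dnbhs_neq.
have h1 : cmod (s w x - s 0 x) < eps / 2 by near: w; exact: s0.
have h2 : cmod w < x^-1 by near: w; apply: cnbhs0_dnbhs; rewrite invr_gt0.
have h3 : cmod w < eps / 2 / (k * x * x * expR 1 + 1).
  by near: w; apply: cnbhs0_dnbhs; rewrite divr_gt0// ltr_wpDl.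
have := s_trunc_le_neq0 M w0; rewrite s_trunc_neq0// mulrDr [w^-1 * sinC _]mulrC.
set f := sinC _ / w + _ => h4.
have wx1 : cmod w * x <= 1 by rewrite -ler_pdivlMr// mul1r ltW.
have wx0 : 0 <= cmod w * x by rewrite mulr_ge0 ?cmod_ge0// ltW.
have h5 : taylor_rem (cmod w * x) M.*2.+1 <= cmod w * x * expR 1.
  apply: ler_pM; rewrite ?expR_ge0 ?ler_expR ?divr_ge0 ?exprn_ge0//.
  rewrite ler_pdivrMr ?ltr0n ?fact_gt0// exprS; apply: ler_wpM2l => //.
  by rewrite (@le_trans _ _ 1) ?exprn_ile1// ler1n fact_gt0.
have h6 : cmod (f - s w x) < eps / 2.
  rewrite cmodB; apply: le_lt_trans h4 _.
  apply: (@le_lt_trans _ _ (k * x * (cmod w * x * expR 1))).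
    by rewrite ler_wpM2l// mulr_ge0// ltW.
  move: h3; rewrite ltr_pdivlMr ?ltr_wpDl// mulrDr mulr1.
  have := cmod_ge0 w.
  have -> : k * x * (cmod w * x * expR 1) = cmod w * (k * x * x * expR 1) by ring.
  by lra.
rewrite (_ : f - s 0 x = (f - s w x) + (s w x - s 0 x)); last by rewrite addrA subrK.
by apply: le_lt_trans (le_cmodD _ _) _; lra.
Unshelve. all: by end_near. Qed.

Lemma s_trunc_le M rho :
  cmod (s rho x - s_trunc K M rho x) <= k * x * taylor_rem (cmod rho * x) M.*2.+1.
Proof.
have [->|r0] := eqVneq rho 0; last exact: s_trunc_le_neq0.
rewrite s_trunc0 subrr cmod0; apply: mulr_ge0; first by rewrite mulr_ge0// ltW.
by apply: taylor_rem_ge0; rewrite mul0r.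
Qed.

Lemma taylor_rem_small (B c0 eps : R) : 0 <= B -> 0 <= c0 -> 0 < eps ->
  exists N0, forall n, (N0 <= n)%N -> forall r, 0 <= r -> r <= B -> c0 * taylor_rem r n < eps.
Proof.
move=> B0 c00 eps0.
have e'0 : 0 < eps / (c0 * expR B + 1).
  by rewrite divr_gt0// ltr_wpDl// mulr_ge0// expR_ge0.
have [N0 HN] := exp_small B0 e'0; exists N0 => n /HN {}HN r r0 rB.
have h1 : r ^+ n / n`!%:R <= B ^+ n / n`!%:R.
  by rewrite ler_pM2r ?invr_gt0 ?ltr0n ?fact_gt0//; apply: lerXn2r.
have h2 : taylor_rem r n <= B ^+ n / n`!%:R * expR B.
  by apply: ler_pM; rewrite ?expR_ge0 ?ler_expR ?divr_ge0 ?exprn_ge0.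
apply: le_lt_trans (ler_wpM2l c00 h2) _.
have q0 : 0 <= B ^+ n / n`!%:R by rewrite divr_ge0 ?exprn_ge0.
move: HN; rewrite ltr_pdivlMr ?ltr_wpDl ?mulr_ge0 ?expR_ge0// mulrDr mulr1.
have -> : c0 * (B ^+ n / n`!%:R * expR B) = B ^+ n / n`!%:R * (c0 * expR B) by ring.
by lra.
Qed.

Lemma c_trunc_uniform (A : set R[i]^o) : compact A ->
  {uniform A, (fun M (rho : R[i]^o) => c_trunc K M rho x : R[i]^o) @ \oo
     --> (fun rho : R[i]^o => c rho x : R[i]^o)}.
Proof.
move=> /ccompact_bounded[B B0 HB]; apply: cuniform_cvg => eps eps0.
have Bx : 0 <= B * x by rewrite mulr_ge0// ltW.
have [N0 HN] := taylor_rem_small Bx k0 eps0; exists N0 => M NM rho Ar.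
rewrite cmodB; apply: le_lt_trans (c_trunc_le M rho) _; apply: HN.
- by rewrite (leq_trans NM)// -addnn -addnS leq_addr.
- by rewrite mulr_ge0 ?cmod_ge0// ltW.
- by rewrite ler_pM2r// HB.
Qed.

Lemma s_trunc_uniform (A : set R[i]^o) : compact A ->
  {uniform A, (fun M (rho : R[i]^o) => s_trunc K M rho x : R[i]^o) @ \oo
     --> (fun rho : R[i]^o => s rho x : R[i]^o)}.
Proof.
move=> /ccompact_bounded[B B0 HB]; apply: cuniform_cvg => eps eps0.
have Bx : 0 <= B * x by rewrite mulr_ge0// ltW.
have kx : 0 <= k * x by rewrite mulr_ge0// ltW.
have [N0 HN] := taylor_rem_small Bx kx eps0; exists N0 => M NM rho Ar.
rewrite cmodB; apply: le_lt_trans (s_trunc_le M rho) _; apply: HN.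
- by rewrite (leq_trans NM)// -addnn -addnS leq_addr.
- by rewrite mulr_ge0 ?cmod_ge0// ltW.
- by rewrite ler_pM2r// HB.
Qed.

Lemma cvg_series_from (u : nat -> C) (l : C) (r : R) n0 : 0 <= r ->
  (forall M, cmod (l - \sum_(n < M.+1) u n) <= k * taylor_rem r (M.*2.+1 + n0)) ->
  (series (u : nat -> C^o)) @ \oo --> (l : C^o).
Proof.
move=> r0 H; apply/ccvgP => eps eps0.
have [N0 HN] := taylor_rem_small r0 k0 eps0.
exists N0.+1 => // -[//|M] /= NM; rewrite /series /= big_mkord cmodB.
apply: le_lt_trans (H M) _; apply: HN => //.
by rewrite (leq_trans (_ : N0 <= M)%N)// -addnn -addnS -addnA leq_addr.
Qed.

Lemma c_series_cvg rho :
  (series (c_term K rho x : nat -> C^o)) @ \oo --> (c rho x - cosC (rho * x%:C) : C^o).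
Proof.
apply: (@cvg_series_from _ _ (cmod rho * x) 0).
  by rewrite mulr_ge0 ?cmod_ge0// ltW.
by move=> M; rewrite addn0 -addrA -opprD; exact: c_trunc_le.
Qed.

Lemma s_series_cvg rho :
  (series (s_term K rho x : nat -> C^o)) @ \oo --> (rho * s rho x - sinC (rho * x%:C) : C^o).
Proof.
apply: (@cvg_series_from _ _ (cmod rho * x) 1).
  by rewrite mulr_ge0 ?cmod_ge0// ltW.
by move=> M; rewrite addn1 -addrA -opprD; exact: s_trunc_le_mul.
Qed.

Lemma c_seriesE rho : c rho x = c_series K rho x.
Proof. by rewrite /c_series (clim_eq (@c_series_cvg rho)) addrC subrK. Qed.

Lemma s_seriesE rho : s rho x = s_series K rho x.
Proof.
have E r : r != 0 -> sinC (r * x%:C) / r + r^-1 * limn (series (s_term K r x : nat -> C^o)) = s r x.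
  move=> r0; rewrite (clim_eq (@s_series_cvg r)) [_ / r]mulrC -mulrDr addrC subrK.
  by rewrite mulKf.
rewrite /s_series /cont0; case: eqVneq => [->|r0]; last by rewrite E.
symmetry; apply: clim_eq; apply: cvg_trans (s_cvg0 x0 xb).
apply: near_eq_cvg; near=> w; rewrite E//.
by near: w; exact: nbhs_dnbhs_neq.
Unshelve. all: by end_near. Qed.

(** Cauchy-Schwarz and [normL2_strip]; the interval is enlarged from [x] to [b]
    in the last factor. *)
Lemma strip_le M (L : R) (g : R -> C) : 0 < L -> ccont g ->
  (forall t, exists2 y : R, `|y| <= L * `|t| & cmod (g t) <= (expR y + expR (- y)) / 2) ->
  cmod (cint (- x) x (fun t => kernel_rem K x M t * g t)) <=
    2%:R * eps_trunc K M x * Num.sqrt (sinhR (2%:R * b * L) / L).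
Proof.
move=> L0 cg gy; have xx : - x < x by rewrite -subr_gt0 opprK addr_gt0.
apply: le_trans (cint_cauchy_schwarz xx (L2_kernel_rem x0 K2 M) cg) _.
have e0 : 0 <= eps_trunc K M x by exact: sqrtr_ge0.
have h1 := normL2_strip x0 L0 cg gy.
have h2 : Num.sqrt (sinhR (2 * x * L) / L) <= Num.sqrt (sinhR (2 * b * L) / L).
  have xbL : 2 * x * L <= 2 * b * L by rewrite ler_pM2r// ler_pM2l.
  have sh : sinhR (2 * x * L) <= sinhR (2 * b * L).
    rewrite /sinhR ler_pM2r ?invr_gt0//.
    by apply: lerB; rewrite ler_expR// lerN2.
  have bL0 : 0 <= 2 * b * L by rewrite !mulr_ge0// ltW.
  have sh0 : 0 <= sinhR (2 * b * L).
    by rewrite /sinhR divr_ge0// subr_ge0 ler_expR; lra.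
  rewrite ler_sqrt; first by rewrite ler_pM2r ?invr_gt0.
  by rewrite divr_ge0// ltW.
apply: (@le_trans _ _ (eps_trunc K M x * Num.sqrt (sinhR (2 * b * L) / L))).
  by apply: ler_wpM2l => //; exact: le_trans h1 h2.
rewrite -[leRHS]mulrA; apply: ler_peMl; last by rewrite ler1n.
by rewrite mulr_ge0// sqrtr_ge0.
Qed.

(** Each exponential in [cos (rho t)] and [sin (rho t)] has modulus [exp (+- y)]
    with [y = - t * Im rho]. *)
Lemma cmod_exp_pair rho t (w := (t / x)%:C * ('i%C * (rho * x%:C))) (L : R) :
  `|Im rho| <= L -> exists2 y : R, `|y| <= L * `|t| &
    cmod (expC w) + cmod (expC (- w)) = expR y + expR (- y).
Proof.
move=> rL; exists (- (t * Im rho)).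
  by rewrite normrN normrM mulrC ler_wpM2r.
rewrite !cmod_expC ReN.
suff -> : Re w = - (t * Im rho) by [].
have xC : x%:C != 0 :> C by rewrite realc_neq0 gt_eqF.
have -> : w = t%:C * ('i%C * rho) by rewrite /w realcM realcV; field.
by rewrite !ReM /= !mul0r !mul1r subr0 sub0r mulrN.
Qed.

Lemma c_trunc_strip M (L : R) rho : 0 < L -> `|Im rho| <= L ->
  cmod (c rho x - c_trunc K M rho x)
    <= 2%:R * eps_trunc K M.*2 x * Num.sqrt (sinhR (2%:R * b * L) / L).
Proof.
move=> L0 rL; set z := 'i%C * (rho * x%:C).
pose g t := (expC ((t / x)%:C * z) + expC ((t / x)%:C * - z)) * 2%:R^-1.
have cg : ccont g.
  apply: ccontM; last exact: ccont_cst.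
  rewrite (_ : (fun t => _) = fun t => expC ((t / x)%:C * z) - (0 - expC ((t / x)%:C * - z))).
    by apply: ccontB; [exact: ccont_expC|apply: ccontB; [exact: ccont_cst|exact: ccont_expC]].
  by apply/funext => t; rewrite sub0r opprK.
have i1 w : cintegrable (- x) x (fun t => kernel_rem K x M.*2 t * expC ((t / x)%:C * w)).
  have xx : - x < x by rewrite -subr_gt0 opprK addr_gt0.
  by apply: cintegrable_mul; [exact: xx|exact: L2_kernel_rem|exact: ccont_expC].
have -> : c rho x - c_trunc K M rho x = cint (- x) x (fun t => kernel_rem K x M.*2 t * g t).
  rewrite c_remainder -/z mulrC /rem_exp -cintD// -cintZ; last exact: cintegrableD.
  by apply: eq_cint => t _; rewrite /g; ring.
apply: strip_le => // t; have [y yt yE] := cmod_exp_pair t rL.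
exists y => //; rewrite /g cmodM cmodV cmod_nat ler_pM2r ?invr_gt0// -yE mulrN.
exact: le_cmodD.
Qed.

Lemma s_trunc_strip M (L : R) rho : 0 < L -> `|Im rho| <= L ->
  cmod (rho * s rho x - rho * s_trunc K M rho x)
    <= 2%:R * eps_trunc K M.*2.+1 x * Num.sqrt (sinhR (2%:R * b * L) / L).
Proof.
move=> L0 rL; have [->|r0] := eqVneq rho 0.
  by rewrite !mul0r subrr cmod0 !mulr_ge0 ?sqrtr_ge0.
rewrite s_trunc_neq0// mulVKf//.
set z := 'i%C * (rho * x%:C).
pose g t := (expC ((t / x)%:C * z) - expC ((t / x)%:C * - z)) * (2%:R * 'i%C)^-1.
have cg : ccont g.
  apply: ccontM; last exact: ccont_cst.
  by apply: ccontB; exact: ccont_expC.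
have i1 w : cintegrable (- x) x (fun t => kernel_rem K x M.*2.+1 t * expC ((t / x)%:C * w)).
  have xx : - x < x by rewrite -subr_gt0 opprK addr_gt0.
  by apply: cintegrable_mul; [exact: xx|exact: L2_kernel_rem|exact: ccont_expC].
have -> : rho * s rho x - (sinC (rho * x%:C) + \sum_(n < M.+1) s_term K rho x n) =
    cint (- x) x (fun t => kernel_rem K x M.*2.+1 t * g t).
  rewrite s_remainder -/z mulrC /rem_exp -cintB// -cintZ.
    by apply: eq_cint => t _; rewrite /g; ring.
  have := cintegrableD (i1 z) (cintegrableZ (- 1) (i1 (- z))).
  by move=> H; rewrite (_ : (fun t => _) = (fun t =>
    kernel_rem K x M.*2.+1 t * expC ((t / x)%:C * z) +
    - 1 * (kernel_rem K x M.*2.+1 t * expC ((t / x)%:C * - z))))//;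
    apply/funext => t; rewrite mulN1r.
apply: strip_le => // t; have [y yt yE] := cmod_exp_pair t rL.
exists y => //; rewrite /g cmodM cmodV cmodM cmod_nat cmodi mulr1 ler_pM2r ?invr_gt0//.
by rewrite -yE mulrN; exact: le_cmodB.
Qed.

End AtPoint.
End Assembly.

Theorem theorem35 (R : realType) (b : R) (q : R -> R[i])
    (N : nat) (x_ : nat -> R) (alpha : nat -> R[i]) (h : R[i])
    (e : R[i] -> R -> R[i]) (K : R -> R -> R[i])
    (c s : R[i] -> R -> R[i]) :
  0 < b -> L2 0 b q ->
  x_ 0%N = 0 -> x_ N.+1 = b ->
  (forall k, (k <= N)%N -> x_ k < x_ k.+1) ->
  (forall k, (1 <= k <= N)%N -> alpha k != 0) ->
  (forall rho, cauchy_solution b q N x_ alpha (rho ^+ 2) 1 ('i%C * rho + h) (e rho)) ->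
  transmutation_kernel b e K ->
  (forall rho, cauchy_solution b q N x_ alpha (rho ^+ 2) 1 h (c rho)) ->
  (forall rho, cauchy_solution b q N x_ alpha (rho ^+ 2) 0 1 (s rho)) ->
  [/\ forall (rho : R[i]) (x : R), 0 < x -> x <= b ->
        [/\ cvgn (series (c_term K rho x : nat -> R[i]^o)),
            c rho x = c_series K rho x,
            cvgn (series (s_term K rho x : nat -> R[i]^o)) &
            s rho x = s_series K rho x],
      forall (x : R) (A : set R[i]^o), 0 < x -> x <= b -> compact A ->
        {uniform A, (fun M (rho : R[i]^o) => c_trunc K M rho x : R[i]^o) @ \oo
           --> (fun rho : R[i]^o => c rho x : R[i]^o)} /\
        {uniform A, (fun M (rho : R[i]^o) => s_trunc K M rho x : R[i]^o) @ \oo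
           --> (fun rho : R[i]^o => s rho x : R[i]^o)} &
      forall (M : nat) (L : R) (rho : R[i]) (x : R),
        0 < L -> `|complex.Im rho| <= L -> 0 < x -> x <= b ->
        cmod (c rho x - c_trunc K M rho x)
          <= 2%:R * eps_trunc K M.*2 x * Num.sqrt (sinhR (2%:R * b * L) / L) /\
        cmod (rho * s rho x - rho * s_trunc K M rho x)
          <= 2%:R * eps_trunc K M.*2.+1 x * Num.sqrt (sinhR (2%:R * b * L) / L)].
Proof.
move=> _ _ x00 xN x_lt _ e_sol K_kernel c_sol s_sol; split.
- move=> rho x x0 xb; split.
  + apply: (cvgP (c rho x - cosC (rho * x%:C) : R[i]^o)).
    exact: (c_series_cvg x00 xN x_lt e_sol K_kernel c_sol s_sol x0 xb).
  + exact: (c_seriesE x00 xN x_lt e_sol K_kernel c_sol s_sol x0 xb).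
  + apply: (cvgP (rho * s rho x - sinC (rho * x%:C) : R[i]^o)).
    exact: (s_series_cvg x00 xN x_lt e_sol K_kernel c_sol s_sol x0 xb).
  + exact: (s_seriesE x00 xN x_lt e_sol K_kernel c_sol s_sol x0 xb).
- move=> x A x0 xb cA; split.
  + exact: (c_trunc_uniform x00 xN x_lt e_sol K_kernel c_sol s_sol x0 xb cA).
  + exact: (s_trunc_uniform x00 xN x_lt e_sol K_kernel c_sol s_sol x0 xb cA).
- move=> M L rho x L0 rhoL x0 xb; split.
  + exact: (c_trunc_strip x00 xN x_lt e_sol K_kernel c_sol s_sol x0 xb).
  + exact: (s_trunc_strip x00 xN x_lt e_sol K_kernel c_sol s_sol x0 xb).
Qed.
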